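(* Let $n\geq 2$ be an integer and let $\lambda>0$ be any real number. Then there exists a $\lambda$-torus in $\mathbb{R}^{n+1}$, that is, a compact embedded rotational $\lambda$-hypersurface $X: M\rightarrow \mathbb{R}^{n+1}$ with the topology of a torus, i.e. with $M$ diffeomorphic to $S^1\times S^{n-1}$.
   Context: An immersed smooth hypersurface $X:M\to\mathbb{R}^{n+1}$ ($M$ of dimension $n$) with unit normal vector field $N$ and mean curvature $H$ is called a $\lambda$-hypersurface if $$\langle X,N\rangle+H=\lambda \quad\text{on } M,$$ where $\lambda$ is a constant. Here $H$ is the (unnormalized) mean curvature with respect to $N$, i.e. the mean curvature vector is $\mathbf{H}=HN$; with this convention the round sphere $S^n(r)$ of radius $r$ centered at the origin, with inward unit normal, has $H=n/r$ and is a $\lambda$-hypersurface with $\lambda=\frac{n}{r}-r$. A hypersurface is rotational if it is obtained from a profile curve $\gamma(s)=(x(s),r(s))$, $r>0$, in the upper half plane by $X(s,\alpha)=(x(s),r(s)\alpha)\in\mathbb{R}\times\mathbb{R}^{n}=\mathbb{R}^{n+1}$, with $\alpha\in S^{n-1}(1)$, the unit sphere in $\mathbb{R}^n$. For such a hypersurface with $s$ the arc length parameter of $\gamma$, the conventions are $N=(-r',x'\alpha)$ and $H=-x''r'+x'r''-\frac{n-1}{r}x'$. *)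

(* Defs.v *)
From mathcomp Require Import all_boot all_order all_algebra.
From mathcomp Require Import all_classical all_reals all_analysis.

Set Implicit Arguments.
Unset Strict Implicit.
Unset Printing Implicit Defensive.

Import Order.TTheory GRing.Theory Num.Theory.
Import numFieldNormedType.Exports.

Local Open Scope classical_set_scope.
Local Open Scope ring_scope.

(* The library norm on 'rV[R]_k is the sup norm: it has the right topology, but
   lengths and angles must be taken with respect to [dot]. *)
Definition dot (R : realType) (k : nat) (u v : 'rV[R]_k) : R :=
  \sum_(i < k) u 0 i * v 0 i.

(* S^(k-1) in R^k *)
Definition unit_sphere (R : realType) (k : nat) : set 'rV[R]_k :=
  [set u | dot u u = 1].

(* S^1 x S^(n-1) in R^2 x R^n *)
Definition standard_torus (R : realType) (n : nat) : set 'rV[R]_(2 + n) :=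
  [set row_mx a b | a in @unit_sphere R 2 & b in @unit_sphere R n].

(* Class C^j on a set U, meant for U open and V, W finite-dimensional: by
   differentiability and recursion on all directional derivatives. *)
Fixpoint Cn (R : realType) (V W : normedModType R) (j : nat)
    (U : set V) (f : V -> W) : Prop :=
  match j with
  | 0%N => forall x, U x -> {for x, continuous f}
  | i.+1 => (forall x, U x -> differentiable f x) /\
            (forall v : V, Cn i U (fun x => 'D_v f x))
  end.

Definition smooth (R : realType) (V W : normedModType R)
    (U : set V) (f : V -> W) : Prop := forall j, Cn j U f.

(* Smoothness on an arbitrary subset A of a Euclidean space: f is locally the
   restriction to A of a smooth map on an open set. *)
Definition smooth_on (R : realType) (V W : normedModType R)
    (A : set V) (f : V -> W) : Prop :=
  forall x, A x -> exists (U : set V) (g : V -> W),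
    [/\ open U, U x, smooth U g & forall y, A y -> U y -> f y = g y].

Definition diffeomorphic (R : realType) (k l : nat)
    (A : set 'rV[R]_k) (B : set 'rV[R]_l) : Prop :=
  exists (f : 'rV[R]_k -> 'rV[R]_l) (g : 'rV[R]_l -> 'rV[R]_k),
    [/\ smooth_on A f /\ smooth_on B g,
        forall x, A x -> B (f x), forall y, B y -> A (g y),
        forall x, A x -> g (f x) = x & forall y, B y -> f (g y) = y].

(* phi is a diffeomorphism from the open set V of R^m onto a relatively open
   subset of M. *)
Definition local_param (R : realType) (m k : nat) (M : set 'rV[R]_k)
    (V : set 'rV[R]_m) (phi : 'rV[R]_m -> 'rV[R]_k) : Prop :=
  [/\ open V, smooth V phi,
      exists2 O : set 'rV[R]_k, open O & phi @` V = M `&` O &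
      exists2 psi : 'rV[R]_k -> 'rV[R]_m,
        smooth_on (phi @` V) psi & forall u, V u -> psi (phi u) = u].

(* m-dimensional smooth manifolds, presented as submanifolds of some R^k *)
Definition manifold (R : realType) (m k : nat) (M : set 'rV[R]_k) : Prop :=
  forall p, M p -> exists (V : set 'rV[R]_m) (phi : 'rV[R]_m -> 'rV[R]_k),
    local_param M V phi /\ (phi @` V) p.

(* The i-th row of 'J F u is the i-th partial derivative of F at u. *)
Definition immersion (R : realType) (m k l : nat) (M : set 'rV[R]_k)
    (X : 'rV[R]_k -> 'rV[R]_l) : Prop :=
  smooth_on M X /\
  forall (V : set 'rV[R]_m) (phi : 'rV[R]_m -> 'rV[R]_k),
    local_param M V phi -> forall u, V u -> row_free ('J (X \o phi) u).

(* An immersion that is a homeomorphism onto its image *)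
Definition embedding (R : realType) (m k l : nat) (M : set 'rV[R]_k)
    (X : 'rV[R]_k -> 'rV[R]_l) : Prop :=
  immersion m M X /\
  exists2 Y : 'rV[R]_l -> 'rV[R]_k,
    {within X @` M, continuous Y} & forall p, M p -> Y (X p) = p.

Definition unit_normal (R : realType) (m k l : nat) (M : set 'rV[R]_k)
    (X N : 'rV[R]_k -> 'rV[R]_l) : Prop :=
  [/\ smooth_on M N, forall p, M p -> dot (N p) (N p) = 1 &
      forall (V : set 'rV[R]_m) (phi : 'rV[R]_m -> 'rV[R]_k),
        local_param M V phi -> forall u, V u -> forall v : 'rV[R]_m,
          dot ('D_v (X \o phi) u) (N (phi u)) = 0].

Section FundamentalForms.
Variables (R : realType) (m l : nat) (F : 'rV[R]_m -> 'rV[R]_l).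

Definition first_form (u : 'rV[R]_m) : 'M[R]_m :=
  \matrix_(i, j) dot ('D_(delta_mx 0 i) F u) ('D_(delta_mx 0 j) F u).

Definition second_form (nu : 'rV[R]_l) (u : 'rV[R]_m) : 'M[R]_m :=
  \matrix_(i, j)
    dot ('D_(delta_mx 0 i) (fun w => 'D_(delta_mx 0 j) F w) u) nu.

(* H = g^(ij) h_(ij), with no factor 1/m; this is the convention for which the
   mean curvature vector is H nu (H = m / r for S^m(r) and the inward normal).
   It does not depend on the parametrization. *)
Definition mean_curvature (nu : 'rV[R]_l) (u : 'rV[R]_m) : R :=
  \tr (invmx (first_form u) *m second_form nu u).

End FundamentalForms.

(* Immersed hypersurfaces X : M -> R^(n+1) with unit normal N such that
   <X, N> + H = lambda. *)
Definition lambda_hypersurface (R : realType) (n k : nat) (M : set 'rV[R]_k)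
    (X N : 'rV[R]_k -> 'rV[R]_(1 + n)) (lambda : R) : Prop :=
  [/\ immersion n M X, unit_normal n M X N &
      forall (V : set 'rV[R]_n) (phi : 'rV[R]_n -> 'rV[R]_k),
        local_param M V phi -> forall u, V u ->
          dot (X (phi u)) (N (phi u))
            + mean_curvature (X \o phi) (N (phi u)) u = lambda].

(* X is swept out by a profile curve (x, r), parametrized by arc length on an
   open interval I and lying in the upper half plane, and N is the normal
   (-r', x' alpha).  The surjection Phi : I x S^(n-1) -> M is not required to
   be injective, so that closed profile curves are covered (I is then the whole
   line and x, r are periodic). *)
Definition rotational (R : realType) (n k : nat) (M : set 'rV[R]_k)
    (X N : 'rV[R]_k -> 'rV[R]_(1 + n)) : Prop :=
  exists (I : set R) (x r : R -> R) (Phi : 'rV[R]_(1 + n) -> 'rV[R]_k),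
    let D := [set row_mx s%:M a | s in I & a in @unit_sphere R n] in
    [/\ open I /\ is_interval I,
        smooth I x /\ smooth I r,
        forall s, I s -> 0 < r s /\ (derive1 x s) ^+ 2 + (derive1 r s) ^+ 2 = 1,
        smooth_on D Phi /\ Phi @` D = M &
        forall s a, I s -> unit_sphere a ->
          X (Phi (row_mx s%:M a)) = row_mx (x s)%:M (r s *: a) /\
          N (Phi (row_mx s%:M a)) = row_mx (- derive1 r s)%:M (derive1 x s *: a)].

(* Main.v *)
Require Import Defs.
From mathcomp Require Import all_boot all_order all_algebra.
From mathcomp Require Import all_classical all_reals all_analysis.
From mathcomp Require Import ring lra.

Set Implicit Arguments.
Unset Strict Implicit.
Unset Printing Implicit Defensive.

Import Order.TTheory GRing.Theory Num.Theory.
Import numFieldNormedType.Exports.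

Local Open Scope classical_set_scope.
Local Open Scope ring_scope.

(** A rotational hypersurface is a [lambda]-hypersurface if and only if its profile
    curve, parametrized by arc length with tangent [(cos th, sin th)], solves
    [th' = lambda + x sin th - (r - (n - 1) / r) cos th]. The solution starting
    at [(0, d)] with [th = 0] is symmetric under [x -> - x]; if it meets the
    mirror line [x = 0] again at a right angle, with [th = pi], reflecting it
    closes it up.

    The initial radius [d] is found by shooting. The arc first moves away from the
    mirror line; after a quarter turn it comes back. When [d] is small the arc
    starts like the neck of a catenoid, of width about [d ln (1 / d)]; it turns by
    a quarter and is pulled back across the mirror line before [th] reaches [pi]
    ([small_neck]). When [d] is just below the radius [d0] of the cylinder that
    solves the equation, the arc follows the cylinder for a long time and gets
    farther than [2 / lambda] from the mirror line ([cylinder_escapes]); an arc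
    that does so cannot be back before it has turned by [pi] ([no_return]). Both
    behaviours persist under small changes of [d] and exclude each other, so an
    initial radius between the two has neither; its arc lasts for a bounded time
    ([time_bound]) and can only end at a right angle to the mirror line
    ([closing]). All this happens in a fixed compact region of the open half
    plane, where the equation is replaced with one whose right-hand side is
    bounded and Lipschitz; for these, global existence, uniqueness and Lipschitz
    dependence on the initial values follow from one weighted Picard estimate.
    Uniqueness turns the two orthogonal crossings of the mirror line into symmetry
    and periodicity ([closed_profile]).

    The manifold is the standard torus itself, mapped by
    [(a, b) |-> (x t, r t b)] where [t] is a fixed multiple of the polar angle of
    [a]; periodicity makes this independent of the choice of the angle and, with
    local branches, smooth. The map is injective because the profile curve is
    simple, hence an embedding by compactness. In any parametrization the first
    form is [g = s^T s + r^2 B B^T], with [s] the differential of [t] and [B] that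
    of [b], and the second form is [k s^T s - r x' B B^T] with [k = th']; as
    [s^T s] has trace 1 with respect to [g] ([rotation_trace]), the mean curvature
    is [k - (n - 1) x' / r], and the profile equation says exactly that
    [<X, N> + H = lambda]. *)

(** * Derivatives of real functions *)

Section Derivatives.
Variable R : realType.
Implicit Types (f g : R -> R) (t a b : R).

(** The lemmas [dvC] to [dvexp] build a derivative along the shape of the
    function, with the derivative as a plain term that [ring] or [field] can
    compare with the intended one through [dv_eq]. *)
Lemma dv_eq f t a b : is_derive t 1 f a -> a = b -> is_derive t 1 f b.
Proof. by move=> h <-. Qed.

Lemma dv_continuous f t a : is_derive t 1 f a -> {for t, continuous f}.
Proof.
by case=> d _; apply: differentiable_continuous; apply/derivable1_diffP.
Qed.

Lemma dvC (c t : R) : is_derive t 1 (fun=> c) (0 : R).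
Proof. exact: is_derive_cst. Qed.

Lemma dvI t : is_derive t 1 (fun u : R => u) (1 : R).
Proof. exact: is_derive_id. Qed.

Lemma dvD f g t a b : is_derive t 1 f a -> is_derive t 1 g b ->
  is_derive t 1 (fun u => f u + g u) (a + b).
Proof. exact: is_deriveD. Qed.

Lemma dvN f t a : is_derive t 1 f a -> is_derive t 1 (fun u => - f u) (- a).
Proof. exact: is_deriveN. Qed.

Lemma dvB f g t a b : is_derive t 1 f a -> is_derive t 1 g b ->
  is_derive t 1 (fun u => f u - g u) (a - b).
Proof. by move=> /dvD h /dvN; apply: h. Qed.

Lemma dvM f g t a b : is_derive t 1 f a -> is_derive t 1 g b ->
  is_derive t 1 (fun u => f u * g u) (a * g t + f t * b).
Proof.
move=> h k; have e := @is_deriveM _ _ f g t 1 a b h k; apply: (dv_eq e).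
by rewrite /GRing.scale /=; ring.
Qed.

Lemma dv_comp f g t a b : is_derive t 1 f a -> is_derive (f t) 1 g b ->
  is_derive t 1 (fun u => g (f u)) (b * a).
Proof.
move=> [df fa] [dg gb].
have /derivable1_diffP Df := df; have /derivable1_diffP Dg := dg.
apply: DeriveDef; first by apply/derivable1_diffP/differentiable_comp.
by rewrite -derive1E (derive1_comp df dg) !derive1E fa gb.
Qed.

Lemma dvV f t a : f t != 0 -> is_derive t 1 f a ->
  is_derive t 1 (fun u => (f u)^-1) (- a / f t ^+ 2).
Proof.
move=> f0 [df fa]; apply: DeriveDef; first exact: derivableV.
by rewrite deriveV // fa /GRing.scale /=; field.
Qed.

Lemma dvX n f t a : is_derive t 1 f a ->
  is_derive t 1 (fun u => f u ^+ n) (n%:R * f t ^+ n.-1 * a).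
Proof.
move=> h; elim: n => [|n ih].
  by apply: dv_eq; [exact: dvC|rewrite !mul0r].
have := dvM ih h; under eq_fun do rewrite -exprSr.
move=> /dv_eq; apply.
case: n {ih} => [|n] /=; first by rewrite !expr0; ring.
by rewrite exprS -[n.+2%:R]natr1; ring.
Qed.

Lemma dvsin f t a : is_derive t 1 f a ->
  is_derive t 1 (fun u => sin (f u)) (cos (f t) * a).
Proof. by move=> h; apply: (dv_comp h). Qed.

Lemma dvcos f t a : is_derive t 1 f a ->
  is_derive t 1 (fun u => cos (f u)) (- sin (f t) * a).
Proof. by move=> h; apply: (dv_comp h). Qed.

Lemma dvexp f t a : is_derive t 1 f a ->
  is_derive t 1 (fun u => expR (f u)) (expR (f t) * a).
Proof. by move=> h; apply: (dv_comp h). Qed.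

Lemma dv_le f (df : R -> R) a b : a <= b ->
  (forall t, a <= t <= b -> is_derive t 1 f (df t)) ->
  (forall t, a <= t <= b -> 0 <= df t) -> f a <= f b.
Proof.
move=> ab h p; have [||c cab e] := @MVT_segment R f df a b ab.
- by move=> t /[!in_itv] /= /andP[ta tb]; apply: h; rewrite !ltW.
- apply: derivable_within_continuous => t /[!in_itv] /= /h.
  by case.
by rewrite -subr_ge0 e mulr_ge0 ?subr_ge0 // p.
Qed.

Lemma dv_ge f (df : R -> R) a b : a <= b ->
  (forall t, a <= t <= b -> is_derive t 1 f (df t)) ->
  (forall t, a <= t <= b -> df t <= 0) -> f b <= f a.
Proof.
move=> ab h p; rewrite -lerN2.
apply: (@dv_le (fun u => - f u) (fun u => - df u)) => // t tab.
  exact/dvN/h.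
by rewrite oppr_ge0 p.
Qed.

Lemma dv_lt f (df : R -> R) a b : a < b ->
  (forall t, a <= t <= b -> is_derive t 1 f (df t)) ->
  (forall t, a < t < b -> 0 < df t) -> f a < f b.
Proof.
move=> ab h p; have [||c cab e] := @MVT R f df a b ab.
- by move=> t /[!in_itv] /= /andP[ta tb]; apply: h; rewrite !ltW.
- apply: derivable_within_continuous => t /[!in_itv] /= /h.
  by case.
rewrite -subr_gt0 e mulr_gt0 ?subr_gt0 // p //.
Qed.

Lemma dv_const f a b : a <= b ->
  (forall t, a <= t <= b -> is_derive t 1 f (0 : R)) -> f a = f b.
Proof.
move=> ab h; apply/eqP; rewrite eq_le.
by rewrite (@dv_le f (fun=> 0)) ?(@dv_ge f (fun=> 0)).
Qed.

Lemma dv_dist f g (df dg : R -> R) a b : a <= b ->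
  (forall t, a <= t <= b -> is_derive t 1 f (df t)) ->
  (forall t, a <= t <= b -> is_derive t 1 g (dg t)) ->
  (forall t, a <= t <= b -> `|df t| <= dg t) -> `|f b - f a| <= g b - g a.
Proof.
move=> ab hf hg hfg; rewrite ler_norml; apply/andP; split.
  have := @dv_le (fun u => f u + g u) (fun u => df u + dg u) _ _ ab.
  move=> /(_ (fun t h => dvD (hf t h) (hg t h))) H.
  suff: f a + g a <= f b + g b by lra.
  apply: H => t /hfg; rewrite ler_norml => /andP[]; lra.
have := @dv_le (fun u => g u - f u) (fun u => dg u - df u) _ _ ab.
move=> /(_ (fun t h => dvB (hg t h) (hf t h))) H.
suff: g a - f a <= g b - f b by lra.
apply: H => t /hfg; rewrite ler_norml => /andP[]; lra.
Qed.

(** Both signs of the time at once: the bound on the speed is given in terms of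
    the distance to 0. *)
Lemma dv_dist0 f g (df dg : R -> R) (s : R) :
  (forall t, is_derive t 1 f (df t)) ->
  (forall t, is_derive t 1 g (dg t)) ->
  (forall t, `|df t| <= dg `|t|) -> `|f s - f 0| <= g `|s| - g 0.
Proof.
move=> hf hg hfg; case: (lerP 0 s) => s0.
  rewrite (ger0_norm s0); apply: (@dv_dist f g df dg) => // t /andP[t0 _].
  by have := hfg t; rewrite (ger0_norm t0).
have dn t : is_derive t 1 (fun u : R => - u) (- 1 : R).
  by apply: dvN; apply: dvI.
rewrite (ltr0_norm s0).
have := @dv_dist (fun u => f (- u)) g (fun u => df (- u) * (- 1)) dg 0 (- s).
rewrite opprK oppr0; apply; rewrite ?oppr_ge0 ?ltW //; last first.
- move=> t /andP[t0 _]; rewrite normrM normrN1 mulr1.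
  by have := hfg (- t); rewrite normrN (ger0_norm t0).
Qed.

(** The integrals from [- n] agree up to a constant where two of them are
    defined, so that normalizing them at 0 glues them to a primitive on the whole
    line. *)
Lemma primitive f : continuous f ->
  exists F : R -> R, forall t, is_derive t 1 F (f t).
Proof.
move=> cf.
pose G (n : nat) (t : R) := (\int[lebesgue_measure]_(u in `[(- n%:R)%R, t]) f u)%R.
have dG n t : - n%:R < t -> is_derive t 1 (G n) (f t).
  move=> nt.
  have t1 : t < t + 1 by rewrite ltrDl.
  have int : lebesgue_measure.-integrable `[(- n%:R)%R, (t + 1)%R] (EFin \o f).
    apply: continuous_compact_integrable; first exact: segment_compact.
    exact: continuous_subspaceT.
  have [d e] := continuous_FTC1_closed t1 int nt (cf t).
  by apply: (DeriveDef d); rewrite -derive1E; exact: e.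
pose F t := let n := (Num.Def.archi_bound `|t|).+1 in G n t - G n 0.
exists F => t0.
have GG m n t : (m <= n)%N -> - m%:R < t -> - m%:R < (0 : R) ->
    G m t - G m 0 = G n t - G n 0.
  move=> mn mt m0; suff: G m t - G n t = G m 0 - G n 0 by lra.
  have d (u : R) : - m%:R < u -> is_derive u 1 (fun u => G m u - G n u) (0 : R).
    move=> mu; rewrite -[0 in X in is_derive _ _ _ X](subrr (f u)).
    apply: dvB; apply: dG => //; apply: le_lt_trans mu.
    by rewrite lerN2 ler_nat.
  case: (leP t 0) => t0'.
    apply: (@dv_const (fun u => G m u - G n u)) => // u /andP[tu _].
    by apply: d; apply: lt_le_trans tu.
  symmetry; apply: (@dv_const (fun u => G m u - G n u)) => // [|u /andP[tu _]].
    exact: ltW.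
  by apply: d; apply: lt_le_trans tu.
pose N := (Num.Def.archi_bound (`| `|t0| + 1 |)).+1.
have N0 : - N%:R < (0 : R) by rewrite oppr_lt0 ltr0n.
have Nt t : `|t| <= `|t0| + 1 -> `|t| < N%:R.
  move=> h; apply: le_lt_trans h _; apply: le_lt_trans (ler_norm _) _.
  apply: lt_trans (archi_boundP (normr_ge0 _)) _.
  by rewrite ltr_nat ltnS.
apply: (@near_eq_is_derive _ _ _ (fun t => G N t - G N 0)); last first.
  rewrite -[f t0]subr0; apply: (dvB _ (dvC (G N 0) t0)); apply: dG.
  have := Nt t0; rewrite lerDl ler01 => /(_ isT); rewrite ltr_norml.
  by case/andP.
near=> t.
have tt : `|t| < N%:R.
  apply: Nt; rewrite -lerBlDl; apply: le_trans (lerB_dist _ _) _.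
  rewrite distrC; near: t; apply/nbhs_normP; exists 1 => //= y.
  by rewrite /ball_ /= => /ltW.
rewrite /F; set n := _.+1.
have tn : `|t| < n%:R.
  by apply: lt_trans (archi_boundP (normr_ge0 _)) _; rewrite ltr_nat.
have n0 : - n%:R < (0 : R) by rewrite oppr_lt0 ltr0n.
move: tn tt; rewrite !ltr_norml => /andP[a1 a2] /andP[b1 b2].
by case: (leqP n N) => h; [symmetry|]; apply: GG => //; exact: ltnW.
Unshelve. all: by end_near. Qed.

Lemma le_geometric (x a c : R) : (forall k : nat, x <= a + c / 2 ^+ k) -> x <= a.
Proof.
move=> h; apply/ler_addgt0Pr => e e0.
have [c0|c0] := leP c 0.
  apply: le_trans (h 0%N) _; rewrite lerD2l; apply: le_trans (ltW e0).
  by rewrite expr0 divr1.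
have ce : 0 <= c / e by rewrite divr_ge0 ?ltW.
apply: le_trans (h (Num.Def.archi_bound (c / e))) _; rewrite lerD2l.
rewrite ler_pdivrMr ?exprn_gt0 // mulrC -ler_pdivrMr //.
apply: le_trans (ltW (archi_boundP ce)) _.
rewrite -natrX ler_nat; apply: ltnW; exact: ltn_expl.
Qed.

Lemma geometric_limit (u : nat -> R) (c : R) :
  (forall k, `|u k.+1 - u k| <= c / 2 ^+ k) ->
  exists l, forall k, `|l - u k| <= 2 * c / 2 ^+ k.
Proof.
move=> h; pose a k := u k - 2 * c / 2 ^+ k; pose b k := u k + 2 * c / 2 ^+ k.
have e k : 2 * c / 2 ^+ k.+1 = c / 2 ^+ k.
  by rewrite exprS invfM mulrACA divff ?mul1r // pnatr_eq0.
have e' k : 2 * c / 2 ^+ k = c / 2 ^+ k + c / 2 ^+ k by ring.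
have c0 k : 0 <= c / 2 ^+ k by apply: le_trans (h k).
have am m n : (m <= n)%N -> a m <= a n.
  move=> /subnKC <-; elim: (n - m)%N => [|k ih]; first by rewrite addn0.
  apply: le_trans ih _; rewrite addnS /a e e'.
  by have := h (m + k)%N; rewrite ler_norml => /andP[? ?]; lra.
have bm m n : (m <= n)%N -> b n <= b m.
  move=> /subnKC <-; elim: (n - m)%N => [|k ih]; first by rewrite addn0.
  apply: le_trans _ ih; rewrite addnS /b e e'.
  by have := h (m + k)%N; rewrite ler_norml => /andP[? ?]; lra.
have abk k : a k <= b k by rewrite /a /b e'; have := c0 k; lra.
have ab m n : a m <= b n.
  apply: le_trans (am m (maxn m n) (leq_maxl _ _)) _.
  by apply: le_trans (abk _) (bm _ _ (leq_maxr _ _)).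
have sa : has_sup (range a).
  by split; [exists (a 0%N), 0%N|exists (b 0%N) => _ [n _ <-]].
exists (sup (range a)) => k.
have h1 : a k <= sup (range a) by apply: sup_upper_bound => //; exists k.
have h2 : sup (range a) <= b k.
  by apply: ge_sup; [exact: (proj1 sa)|move=> _ [n _ <-]].
by move: h1 h2; rewrite /a /b ler_norml => ? ?; apply/andP; split; lra.
Qed.

Lemma lipschitz_continuous f (c : R) :
  (forall s t, `|f s - f t| <= c * `|s - t|) -> continuous f.
Proof.
move=> h t; apply/cvgrPdist_le => e e0.
have c0 : 0 < `|c| + 1 by rewrite ltr_wpDl.
near=> s; apply: le_trans (h t s) _.
apply: le_trans (_ : (`|c| + 1) * `|t - s| <= _).
  by apply: ler_wpM2r => //; have := ler_norm c; lra.
rewrite mulrC -ler_pdivlMr //; near: s.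
apply/nbhs_normP; exists (e / (`|c| + 1)); first by rewrite /= divr_gt0.
by move=> y /ltW.
Unshelve. all: by end_near. Qed.

End Derivatives.

(** * Ordinary differential equations *)

Section ODE.
Variables (R : realType) (I : Type) (F : I -> (I -> R) -> R) (C L : R).
Hypotheses (L0 : 0 < L) (F_bounded : forall i u, `|F i u| <= C).
Hypothesis F_lipschitz : forall (u v : I -> R) (D : R),
  (forall j, `|u j - v j| <= D) -> forall i, `|F i u - F i v| <= L * D.

Definition ode_solution (Y : I -> R -> R) :=
  forall i (t : R), is_derive t 1 (Y i) (F i (fun j => Y j t)).

(** The weight [E `|s|] grows twice as fast as the Lipschitz constant allows two
    solutions to separate, so that integrating against it divides by 2: Picard
    iteration contracts on the whole line at once. *)
Let E (s : R) := expR (2 * L * s).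

Let dE (c s : R) : is_derive s 1 (fun u => c * E u) (2 * L * (c * E s)).
Proof.
have h := dvM (dvC c s) (dvexp (dvM (dvC (2 * L) s) (dvI s))).
by apply: (dv_eq h); rewrite /E; ring.
Qed.

Let E_ge1 (s : R) : 1 <= E `|s|.
Proof. by rewrite -expR0 ler_expR !mulr_ge0 // ltW. Qed.

Let E0 : E 0 = 1.
Proof. by rewrite /E mulr0 expR0. Qed.

Let C0 (i : I) : 0 <= C.
Proof. exact: le_trans (F_bounded i (fun=> 0)). Qed.

(** One Picard step halves the weighted distance. *)
Let picard_step (Y Z : I -> R -> R) (f g : R -> R) (i : I) (D B : R) :
  (forall t : R, is_derive t 1 f (F i (fun j => Y j t))) ->
  (forall t : R, is_derive t 1 g (F i (fun j => Z j t))) ->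
  `|f 0 - g 0| <= D ->
  (forall j t, `|Y j t - Z j t| <= B * E `|t|) ->
  forall s, `|f s - g s| <= D + B / 2 * (E `|s| - 1).
Proof.
move=> df dg D0 hB s.
have hb t : `|F i (fun j => Y j t) - F i (fun j => Z j t)| <=
    2 * L * (B / 2 * E `|t|).
  apply: le_trans (F_lipschitz (fun j => hB j t) i) _.
  by rewrite le_eqVlt; apply/orP; left; apply/eqP; field.
have := @dv_dist0 R (fun t => f t - g t) (fun t => B / 2 * E t) _ _ s
  (fun t => dvB (df t) (dg t)) (fun t => dE _ t).
move=> /(_ hb).
rewrite /= E0 => h.
have -> : f s - g s = (f s - g s - (f 0 - g 0)) + (f 0 - g 0) by ring.
apply: le_trans (ler_normD _ _) _; rewrite mulrBr.
by move: h; lra.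
Qed.

(** Two solutions are at finite weighted distance because the field is bounded;
    a solution is a fixed point of the Picard step, so [picard_step] can be
    applied forever and only the distance at time 0 survives. *)
Lemma ode_gronwall (Y Z : I -> R -> R) (D : R) :
  ode_solution Y -> ode_solution Z -> (forall i, `|Y i 0 - Z i 0| <= D) ->
  forall i s, `|Y i s - Z i s| <= 2 * D * expR (2 * L * `|s|).
Proof.
move=> hY hZ hD i s.
have D0 : 0 <= D := le_trans (normr_ge0 _) (hD i).
have LC : 0 <= C / L by rewrite divr_ge0 ?(C0 i) // ltW.
have H (k : nat) : forall j t,
    `|Y j t - Z j t| <= (2 * D + C / L / 2 ^+ k) * E `|t|.
  elim: k => [|k ih] j t; last first.
    apply: le_trans (picard_step (hY j) (hZ j) (hD j) ih t) _.
    have -> : C / L / 2 ^+ k.+1 = C / L / 2 ^+ k / 2.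
      by rewrite exprS invfM; ring.
    have p0 : 0 <= C / L / 2 ^+ k by rewrite divr_ge0 ?exprn_ge0.
    by have := E_ge1 t; nra.
  have hb u : `|F j (fun j => Y j u) - F j (fun j => Z j u)| <=
      2 * L * (C / L * E `|u|).
    have -> : 2 * L * (C / L * E `|u|) = 2 * C * E `|u|.
      by field; rewrite gt_eqF.
    apply: le_trans (ler_normB _ _) _.
    have := F_bounded j (fun j => Y j u); have := F_bounded j (fun j => Z j u).
    by have := E_ge1 u; have := C0 j; nra.
  have := @dv_dist0 R (fun t => Y j t - Z j t) (fun t => C / L * E t) _ _ t
    (fun t => dvB (hY j t) (hZ j t)) (fun t => dE _ t).
  move=> /(_ hb).
  rewrite /= E0 => h.
  have -> : Y j t - Z j t = (Y j t - Z j t - (Y j 0 - Z j 0)) + (Y j 0 - Z j 0).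
    by ring.
  apply: le_trans (ler_normD _ _) _; rewrite expr0 divr1.
  by move: h (hD j) (E_ge1 t); nra.
apply: (@le_geometric _ _ _ (C / L * E `|s|)) => k.
apply: le_trans (H k i s) _; rewrite le_eqVlt; apply/orP; left; apply/eqP.
by rewrite /E; ring.
Qed.

Lemma ode_unique (Y Z : I -> R -> R) :
  ode_solution Y -> ode_solution Z -> (forall i, Y i 0 = Z i 0) ->
  forall i s, Y i s = Z i s.
Proof.
move=> hY hZ h0 i s; apply/eqP; rewrite -subr_eq0 -normr_le0.
have hD j : `|Y j 0 - Z j 0| <= 0 by rewrite h0 subrr normr0.
by have := ode_gronwall hY hZ hD i s; rewrite mulr0 mul0r.
Qed.

Let lip (Y : I -> R -> R) := forall j s t, `|Y j s - Y j t| <= C * `|s - t|.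

Let lip_continuous Y i : lip Y -> continuous (fun t => F i (fun j => Y j t)).
Proof.
move=> h; apply: (@lipschitz_continuous _ _ (L * C)) => s t.
by rewrite -mulrA; apply: F_lipschitz => j; apply: h.
Qed.

Let solution_lip (Y Z : I -> R -> R) :
  (forall i (t : R), is_derive t 1 (Y i) (F i (fun j => Z j t))) -> lip Y.
Proof.
move=> h j s t; wlog st : s t / t <= s.
  by move=> hw; case: (leP t s) => [/hw //|/ltW /hw]; rewrite distrC (distrC s).
rewrite (ger0_norm (_ : 0 <= s - t)) ?subr_ge0 // mulrBr.
apply: (@dv_dist _ _ (fun u => C * u) _ (fun=> C) _ _ st) => u _.
- by apply: (dv_eq (dvM (dvC C u) (dvI u))); ring.
- exact: F_bounded.
Qed.

(** The Picard iterates converge geometrically in the weighted distance, and one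
    more step from the limit does not move it. *)
Lemma ode_exists (y : I -> R) :
  exists2 Y, ode_solution Y & forall i, Y i 0 = y i.
Proof.
have prim (Y : I -> R -> R) : lip Y -> exists Z : I -> R -> R,
    (forall i, Z i 0 = y i) /\
    (forall i (t : R), is_derive t 1 (Z i) (F i (fun j => Y j t))).
  move=> hY; have /choice[P hP] : forall i, exists P : R -> R,
      forall t : R, is_derive t 1 P (F i (fun j => Y j t)).
    by move=> i; apply: primitive; exact: lip_continuous.
  exists (fun i t => P i t - P i 0 + y i); split => i; first by rewrite subrr add0r.
  move=> t; have := dvD (dvB (hP i t) (dvC (P i 0) t)) (dvC (y i) t).
  by rewrite subr0 addr0.
have /choice[T hT] : forall Y : I -> R -> R, exists Z : I -> R -> R, lip Y ->
    (forall i, Z i 0 = y i) /\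
    (forall i (t : R), is_derive t 1 (Z i) (F i (fun j => Y j t))).
  move=> Y; case: (pselect (lip Y)) => [/prim[Z hZ]|n]; first by exists Z.
  by exists Y => /n.
pose U k := iter k T (fun i _ => y i).
have lU k : lip (U k).
  case: k => [|k] /=.
    by move=> j s t; rewrite subrr normr0 mulr_ge0 // (C0 j).
  elim: k => [|k ih] /=.
    have [|_ h] := hT (fun i _ => y i); last exact: solution_lip h.
    by move=> j s t; rewrite subrr normr0 mulr_ge0 // (C0 j).
  have [_ h] := hT _ ih; exact: solution_lip h.
have dU k i t := (hT _ (lU k)).2 i t.
have U0 k i := (hT _ (lU k)).1 i.
have H (k : nat) : forall j t,
    `|U k.+1 j t - U k j t| <= C / L / 2 ^+ k * E `|t|.
  elim: k => [|k ih] j t.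
    have hb u : `|F j (fun j => U 0%N j u)| <= 2 * L * (C / L * E `|u|).
      have -> : 2 * L * (C / L * E `|u|) = 2 * C * E `|u|.
        by field; rewrite gt_eqF.
      have := F_bounded j (fun j => U 0%N j u).
      by have := E_ge1 u; have := C0 j; nra.
    have := @dv_dist0 R (U 1%N j) (fun t => C / L * E t) _ _ t
      (fun t => dU 0%N j t) (fun t => dE _ t).
    move=> /(_ hb).
    rewrite /= E0 (U0 0%N) /= expr0 divr1 => h.
    have : 0 <= C / L by rewrite divr_ge0 ?(C0 j) // ltW.
    by move: h; lra.
  have := @picard_step _ _ _ _ j 0 _ (dU k.+1 j) (dU k j) _ ih t.
  rewrite (U0 k.+1) (U0 k) subrr normr0 => /(_ (lexx _)) h; apply: le_trans h _.
  have -> : C / L / 2 ^+ k.+1 = C / L / 2 ^+ k / 2.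
    by rewrite exprS invfM; ring.
  have : 0 <= C / L / 2 ^+ k by rewrite !divr_ge0 ?exprn_ge0 ?(C0 j) // ltW.
  lra.
have /choice[Y hY] : forall i, exists Y : R -> R, forall t k,
    `|Y t - U k i t| <= 2 * (C / L * E `|t|) / 2 ^+ k.
  move=> i; have /choice[Y hY] : forall t, exists l, forall k,
      `|l - U k i t| <= 2 * (C / L * E `|t|) / 2 ^+ k.
    by move=> t; apply: geometric_limit => k; rewrite mulrAC; exact: H.
  by exists Y.
have lY : lip Y.
  move=> j s t; apply: (@le_geometric _ _ _
    (2 * (C / L * E `|s|) + 2 * (C / L * E `|t|))) => k.
  have -> : Y j s - Y j t =
    (Y j s - U k j s) + (U k j s - U k j t) - (Y j t - U k j t) by ring.
  apply: le_trans (ler_normB _ _) _; apply: le_trans (lerD (ler_normD _ _) (lexx _)) _.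
  by have := hY j s k; have := hY j t k; have := lU k j s t; lra.
have [Z [Z0 dZ]] := prim _ lY.
suff YZ : Y = Z by exists Z => // i t; rewrite -{2}YZ.
apply/funext => i; apply/funext => s; apply/eqP.
rewrite -subr_eq0 -normr_le0.
apply: (@le_geometric _ _ _ (2 * (C / L * E `|s|))) => k.
have hk j t : `|U k j t - Y j t| <= 2 * (C / L) / 2 ^+ k * E `|t|.
  by have := hY j t k; rewrite distrC; lra.
have := @picard_step _ _ _ _ i 0 _ (dU k i) (dZ i) _ hk s.
rewrite (U0 k) Z0 subrr normr0 => /(_ (lexx _)) h1.
have := hY i s k.+1.
have -> : 2 * (C / L * E `|s|) / 2 ^+ k.+1 = C / L / 2 ^+ k * E `|s|.
  by rewrite exprS; field; rewrite !gt_eqF ?exprn_gt0.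
have p0 : 0 <= C / L / 2 ^+ k by rewrite !divr_ge0 ?exprn_ge0 ?(C0 i) // ltW.
have -> : Y i s - Z i s = (Y i s - U k.+1 i s) + (U k.+1 i s - Z i s) by ring.
move=> h2; apply: le_trans (ler_normD _ _) _; rewrite add0r.
apply: le_trans (lerD h2 h1) _; lra.
Qed.

End ODE.

(** * Convex arcs of the profile equation *)

Section Trigo.
Variable R : realType.
Implicit Types t : R.

Lemma cos_ge0_phase1 t : 0 <= t <= pi / 2 -> 0 <= cos t.
Proof.
move=> /andP[t0 t1]; apply: cos_ge0_pihalf; rewrite t1 andbT.
by apply: le_trans t0; have := pi_gt0 R; lra.
Qed.

Lemma cos_gt0_phase1 t : 0 <= t < pi / 2 -> 0 < cos t.
Proof.
move=> /andP[t0 t1]; apply: cos_gt0_pihalf; rewrite t1 andbT.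
by apply: lt_le_trans t0; have := pi_gt0 R; lra.
Qed.

Lemma cos_lt0_phase2 t : pi / 2 < t <= pi -> cos t < 0.
Proof.
move=> /andP[t0 t1]; have -> : t = (t - pi / 2) + pi / 2 by ring.
rewrite cosDpihalf oppr_lt0; apply: sin_gt0_pi; have := pi_gt0 R.
by move=> ?; apply/andP; split; lra.
Qed.

Lemma cos_le0_phase2 t : pi / 2 <= t <= pi -> cos t <= 0.
Proof.
move=> /andP[t0 t1]; have -> : t = (t - pi / 2) + pi / 2 by ring.
rewrite cosDpihalf oppr_le0; apply: sin_ge0_pi; have := pi_gt0 R.
by move=> ?; apply/andP; split; lra.
Qed.

Lemma intermediate_value (f : R -> R) a b v : a <= b ->
  (forall t, a <= t <= b -> {for t, continuous f}) ->
  f a <= v <= f b -> exists2 t, a <= t <= b & f t = v.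
Proof.
move=> ab cf /andP[fa fb].
have [||t] := @IVT R f a b v ab.
- apply: continuous_in_subspaceT => t; rewrite inE /= in_itv /=; exact: cf.
- by rewrite ge_min fa /= le_max fb orbT.
by rewrite in_itv /= => tab ft; exists t.
Qed.

Lemma intermediate_value_decr (f : R -> R) a b v : a <= b ->
  (forall t, a <= t <= b -> {for t, continuous f}) ->
  f b <= v <= f a -> exists2 t, a <= t <= b & f t = v.
Proof.
move=> ab cf /andP[fa fb].
have [||t] := @IVT R f a b v ab.
- apply: continuous_in_subspaceT => t; rewrite inE /= in_itv /=; exact: cf.
- by rewrite ge_min fa orbT /= le_max fb.
by rewrite in_itv /= => tab ft; exists t.
Qed.

End Trigo.

Definition curvature (R : realType) (lam c x r th : R) : R :=
  lam + x * sin th - (r - c / r) * cos th.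

(** The profile curve of a rotational hypersurface, parametrized by arc length,
    with tangent [(cos th, sin th)] and [c = n - 1]: the equation
    [<X, N> + H = lam] says that [th] turns at the rate [curvature]. *)
Definition profile_at (R : realType) (lam c : R) (x r th : R -> R) (t : R) :=
  [/\ 0 < r t, is_derive t 1 x (cos (th t)), is_derive t 1 r (sin (th t)) &
      is_derive t 1 th (curvature lam c (x t) (r t) (th t))].

(** The arcs that will be reflected in the mirror line [x = 0]: they leave it at
    right angles at time 0. Their first phase [th <= pi / 2] moves away from the
    mirror line, the second one comes back; [r] increases all along. *)
Definition convex_arc (R : realType) (lam : R) (p : nat) (x r th : R -> R)
    (S : R) :=
  [/\ 0 <= S, forall t, 0 <= t <= S -> profile_at lam p%:R x r th t,
      x 0 = 0, th 0 = 0 &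
      forall t, 0 <= t <= S ->
        0 <= curvature lam p%:R (x t) (r t) (th t) /\ th t <= pi].

Lemma convex_arc_sub (R : realType) (lam : R) p (x r th : R -> R) S T :
  convex_arc lam p x r th S -> 0 <= T <= S -> convex_arc lam p x r th T.
Proof.
case=> S0 h x0 th0 k /andP[T0 TS].
by split=> // t /andP[t0 tT]; [apply: h|apply: k]; rewrite t0 (le_trans tT).
Qed.

Section Estimates.
Variables (R : realType) (lam : R) (p : nat).
Hypotheses (lam0 : 0 < lam) (p1 : (1 <= p)%N).
Let c : R := p%:R.
Variables (x r th : R -> R) (S : R).
Hypothesis arc : convex_arc lam p x r th S.
Let w t := curvature lam c (x t) (r t) (th t).

Let S0 : 0 <= S. Proof. by case: arc. Qed.
Let prof t : 0 <= t <= S -> profile_at lam c x r th t.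
Proof. by case: arc => _ h _ _ _; apply: h. Qed.
Let x0 : x 0 = 0. Proof. by case: arc. Qed.
Let th0 : th 0 = 0. Proof. by case: arc. Qed.
Let w_ge0 t : 0 <= t <= S -> 0 <= w t.
Proof. by case: arc => _ _ _ _ h /h[]. Qed.
Let th_le t : 0 <= t <= S -> th t <= pi.
Proof. by case: arc => _ _ _ _ h /h[]. Qed.
Let c1 : 1 <= c. Proof. by rewrite /c ler1n. Qed.
Let r_gt0 t : 0 <= t <= S -> 0 < r t. Proof. by case/prof. Qed.
Let dx t : 0 <= t <= S -> is_derive t 1 x (cos (th t)). Proof. by case/prof. Qed.
Let dr t : 0 <= t <= S -> is_derive t 1 r (sin (th t)). Proof. by case/prof. Qed.
Let dth t : 0 <= t <= S -> is_derive t 1 th (w t). Proof. by case/prof. Qed.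

Lemma wE t : w t = lam + x t * sin (th t) - r t * cos (th t) + c * cos (th t) / r t.
Proof. by rewrite /w /curvature; ring. Qed.

Lemma th_ndecr a b : 0 <= a -> a <= b -> b <= S -> th a <= th b.
Proof.
move=> a0 ab bS; apply: (@dv_le _ th w _ _ ab) => t /andP[ta tb].
  by apply: dth; rewrite (le_trans a0) //= (le_trans tb).
by apply: w_ge0; rewrite (le_trans a0) //= (le_trans tb).
Qed.

Lemma th_ge0 t : 0 <= t <= S -> 0 <= th t.
Proof. by case/andP=> t0 tS; rewrite -th0; apply: th_ndecr. Qed.

Lemma sin_th_ge0 t : 0 <= t <= S -> 0 <= sin (th t).
Proof. by move=> h; apply: sin_ge0_pi; rewrite th_ge0 // th_le. Qed.

Lemma r_ndecr a b : 0 <= a -> a <= b -> b <= S -> r a <= r b.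
Proof.
move=> a0 ab bS; apply: (@dv_le _ r (sin \o th) _ _ ab) => t /andP[ta tb].
  by apply: dr; rewrite (le_trans a0) //= (le_trans tb).
by apply: sin_th_ge0; rewrite (le_trans a0) //= (le_trans tb).
Qed.

Lemma r_le t : 0 <= t <= S -> r t <= r 0 + t.
Proof.
move=> /andP[t0 tS].
have := @dv_le _ (fun u => u - r u) (fun u => 1 - sin (th u)) 0 t t0.
suff H : 0 - r 0 <= t - r t -> r t <= r 0 + t.
  move=> h; apply: H; apply: h => u /andP[u0 ut].
    by apply: (dvB (dvI u)); apply: dr; rewrite u0 (le_trans ut).
  by rewrite subr_ge0 sin_le1.
by lra.
Qed.

Lemma x_ndecr b : 0 <= b -> b <= S -> th b <= pi / 2 ->
  forall a, 0 <= a -> a <= b -> x a <= x b.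
Proof.
move=> b0 bS hb a a0 ab; apply: (@dv_le _ x (cos \o th) _ _ ab) => t /andP[ta tb].
  by apply: dx; rewrite (le_trans a0) //= (le_trans tb).
apply: cos_ge0_phase1; rewrite th_ge0 ?(le_trans a0) ?(le_trans tb) //=.
by apply: le_trans hb; apply: th_ndecr => //; exact: le_trans ta.
Qed.

Lemma x_nincr a : 0 <= a -> pi / 2 <= th a ->
  forall b, a <= b -> b <= S -> x b <= x a.
Proof.
move=> a0 ha b ab bS; apply: (@dv_ge _ x (cos \o th) _ _ ab) => t /andP[ta tb].
  by apply: dx; rewrite (le_trans a0) //= (le_trans tb).
have t0 : 0 <= t by apply: le_trans ta.
apply: cos_le0_phase2; rewrite th_le ?t0 ?(le_trans tb) // andbT.
by apply: le_trans ha _; apply: th_ndecr => //; rewrite (le_trans tb).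
Qed.

Lemma turning_time : pi / 2 <= th S -> exists2 a, 0 <= a <= S & th a = pi / 2.
Proof.
move=> h; apply: (@intermediate_value _ th) => //.
  by move=> t /dth /dv_continuous.
by rewrite th0 h andbT divr_ge0 // ltW // pi_gt0.
Qed.

Lemma dw t : 0 <= t <= S -> is_derive t 1 w
  (w t * (x t * cos (th t) + (r t - c / r t) * sin (th t))
   - c * sin (th t) * cos (th t) / r t ^+ 2).
Proof.
move=> h; have rt := r_gt0 h; have rn : r t != 0 by rewrite gt_eqF.
have d1 := dvD (dvC lam t) (dvM (dx h) (dvsin (dth h))).
have d2 := dvM (dvB (dr h) (dvM (dvC c t) (dvV rn (dr h)))) (dvcos (dth h)).
by apply: (dv_eq (dvB d1 d2)); field.
Qed.

(** Let [a] be the time of the quarter turn, so that [a >= x a > 2 / lam]. If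
    [r a ^ 2 < c], the curvature would be at least [lam] on the first phase,
    which would then last at most [pi / (2 * lam) < 2 / lam]. Hence [r ^ 2 >= c]
    on the second phase and, as long as [x >= 0], the curvature is at least [lam]
    there too: [x] loses at most [1 / lam] while turning back. *)
Lemma no_return t : 0 <= t <= S -> 2 / lam < x t -> pi / 2 <= th S -> 0 < x S.
Proof.
move=> /andP[t0 tS] xt hS; have [a /andP[a0 aS] ha] := turning_time hS.
have xa : 2 / lam < x a.
  apply: lt_le_trans xt _; case: (leP t a) => ta.
    by apply: x_ndecr; rewrite ?ha.
  by apply: x_nincr; rewrite ?ha // ltW.
have i0 : 0 < lam^-1 by rewrite invr_gt0.
have ra : c <= r a ^+ 2.
  rewrite leNgt; apply/negP => ra.
  have w1 u : 0 <= u <= a -> lam <= w u.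
    move=> /andP[u0 ua]; have uS : 0 <= u <= S by rewrite u0 (le_trans ua).
    have x_ge0 : 0 <= x u.
      rewrite -x0; apply: (@x_ndecr u); rewrite // ?(le_trans ua) // -ha.
      exact: th_ndecr.
    have co : 0 <= cos (th u).
      by apply: cos_ge0_phase1; rewrite th_ge0 //= -ha; apply: th_ndecr.
    have ru := r_gt0 uS.
    have rua : r u <= r a by apply: r_ndecr.
    have : r u - c / r u <= 0.
      rewrite subr_le0 ler_pdivlMr // -expr2; apply: le_trans (ltW ra).
      by rewrite lerXn2r ?nnegrE // ltW // (lt_le_trans ru).
    have := mulr_ge0 x_ge0 (sin_th_ge0 uS); rewrite /w /curvature; nra.
  have h1 : lam * a <= pi / 2.
    have d u : 0 <= u <= a -> is_derive u 1 (fun u => th u - lam * u) (w u - lam).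
      move=> /andP[u0 ua]; have uS : 0 <= u <= S by rewrite u0 (le_trans ua).
      by apply: (dv_eq (dvB (dth uS) (dvM (dvC lam u) (dvI u)))); ring.
    have := @dv_le _ _ _ 0 a a0 d; rewrite th0 ha; move=> H.
    suff: 0 - lam * 0 <= pi / 2 - lam * a by lra.
    by apply: H => u /w1; lra.
  have h2 : x a <= a.
    have d u : 0 <= u <= a -> is_derive u 1 (fun u => u - x u) (1 - cos (th u)).
      move=> /andP[u0 ua]; apply: (dvB (dvI u)).
      by apply: dx; rewrite u0 (le_trans ua).
    have := @dv_le _ _ _ 0 a a0 d; rewrite x0; move=> H.
    suff: 0 - 0 <= a - x a by lra.
    by apply: H => u _; rewrite subr_ge0 cos_le1.
  have := lt_le_trans xa h2; rewrite ltr_pdivrMr // => h3.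
  by have := @pihalf_lt2 R; lra.
rewrite ltNge; apply/negP => xS.
have [b /andP[ab bS] xb] : exists2 b, a <= b <= S & x b = 0.
  apply: (@intermediate_value_decr _ x) => //.
    move=> u /andP[au uS]; apply: (@dv_continuous _ _ _ (cos (th u))); apply: dx.
    by rewrite (le_trans a0).
  by rewrite xS (le_trans _ (ltW xa)) // divr_ge0 // ltW.
have d u : a <= u <= b -> is_derive u 1 (fun u => x u - lam^-1 * sin (th u))
    (cos (th u) * (1 - lam^-1 * w u)).
  move=> /andP[au ub].
  have uS : 0 <= u <= S by rewrite (le_trans a0) //= (le_trans ub).
  by apply: (dv_eq (dvB (dx uS) (dvM (dvC lam^-1 u) (dvsin (dth uS))))); ring.
have := @dv_le _ _ _ a b ab d; rewrite ha xb sin_pihalf => H.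
suff: x a - lam^-1 * 1 <= 0 - lam^-1 * sin (th b).
  have bS' : 0 <= b <= S by rewrite (le_trans a0).
  by have := mulr_ge0 (ltW i0) (sin_th_ge0 bS'); lra.
apply: H => u /andP[au ub].
have u0 : 0 <= u := le_trans a0 au.
have uS : 0 <= u <= S by rewrite u0 (le_trans ub).
have hu : pi / 2 <= th u by rewrite -ha th_ndecr // (le_trans ub).
have co : cos (th u) <= 0 by apply: cos_le0_phase2; rewrite hu th_le.
have xu : 0 <= x u by rewrite -xb; apply: (@x_nincr u).
have rau : r a <= r u by apply: r_ndecr => //; rewrite (le_trans ub).
have ra0 : 0 < r a by apply: r_gt0; rewrite a0.
have ru : 0 <= r u - c / r u.
  rewrite subr_ge0 ler_pdivrMr ?r_gt0 // -expr2; apply: le_trans ra _.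
  by rewrite lerXn2r ?nnegrE // ltW // r_gt0.
have wl : lam <= w u.
  by have := mulr_ge0 xu (sin_th_ge0 uS); rewrite /w /curvature; nra.
apply: mulr_le0 => //; rewrite subr_le0.
by rewrite mulrC ler_pdivlMr // mul1r.
Qed.

(** The term of [dw] that is not a multiple of [w] is nonnegative in the second
    phase, so [w] decays at most exponentially. *)
Lemma w_gt0_phase2 a : 0 <= a <= S -> pi / 2 <= th a -> 0 < w a -> 0 < w S.
Proof.
move=> /andP[a0 aS] ha wa.
have r00 : 0 < r 0 by apply: r_gt0; rewrite lexx.
(* [- K] is a lower bound for the coefficient of [w] in [dw]. *)
pose K := S + c / r 0.
have d t : a <= t <= S -> is_derive t 1 (fun t => w t * expR (K * t))
   ((w t * (x t * cos (th t) + (r t - c / r t) * sin (th t))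
   - c * sin (th t) * cos (th t) / r t ^+ 2 + K * w t) * expR (K * t)).
  move=> /andP[at_ tS]; have tS' : 0 <= t <= S by rewrite (le_trans a0).
  have d1 := dvM (dw tS') (dvexp (dvM (dvC K t) (dvI t))).
  by apply: (dv_eq d1); rewrite /=; ring.
have := @dv_le _ _ _ a S aS d.
suff H : w a * expR (K * a) <= w S * expR (K * S) -> 0 < w S.
  move=> h; apply: H; apply: h => t /andP[at_ tS].
  have t0 : 0 <= t := le_trans a0 at_.
  have tS' : 0 <= t <= S by rewrite t0.
  apply: mulr_ge0; last exact: expR_ge0.
  have ht : pi / 2 <= th t by apply: le_trans ha _; apply: th_ndecr.
  have co : cos (th t) <= 0 by apply: cos_le0_phase2; rewrite ht th_le.
  have s0 := sin_th_ge0 tS'; have rt := r_gt0 tS'.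
  have : 0 <= - (c * sin (th t) * cos (th t) / r t ^+ 2).
    rewrite -mulNr; apply: divr_ge0; last by rewrite exprn_ge0 // ltW.
    by rewrite -mulrN !mulr_ge0 ?oppr_ge0 // (le_trans _ c1).
  suff : 0 <= x t * cos (th t) + (r t - c / r t) * sin (th t) + K.
    by move=> h1 h2; have := mulr_ge0 (w_ge0 tS') h1; lra.
  have xt : `|x t| <= S.
    have h : `|x t - x 0| <= t - 0.
      apply: (@dv_dist _ x (fun u => u) (cos \o th) (fun=> 1)) => // u.
        by move=> /andP[u0 ut]; apply: dx; rewrite u0 (le_trans ut).
      by move=> _; exact: cos_max.
    by apply: le_trans tS; move: h; rewrite x0 !subr0.
  have h1 : - S <= x t * cos (th t).
    have : `|x t * cos (th t)| <= S.
      by rewrite normrM; have := cos_max (th t); have := normr_ge0 (x t); nra.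
    by rewrite ler_norml => /andP[].
  have h2 : c / r t <= c / r 0.
    by rewrite ler_pM2l ?(lt_le_trans _ c1) // lef_pV2 ?posrE // r_ndecr.
  have h3 : 0 <= c / r t by rewrite divr_ge0 ?(le_trans _ c1) ?ltW.
  by have := sin_le1 (th t); rewrite /K; have := ltW rt; nra.
have := expR_gt0 (K * a); have := expR_gt0 (K * S) => e1 e2 h.
by rewrite -(pmulr_lgt0 _ e1); apply: lt_le_trans h; rewrite mulr_gt0.
Qed.

(** The equation in divergence form: the derivative of [- r ^ p * cos th] is
    [lam * r ^ p * sin th] plus terms that are nonnegative in the second phase
    where [x >= 0], and [r ^ p * sin th] integrates to [r ^ p.+1 / p.+1]. *)
Lemma phase2_slope a t : 0 <= a -> a <= t -> t <= S -> pi / 2 <= th a ->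
  (forall u, a <= u <= t -> 0 <= x u) ->
  lam / p.+1%:R * (r t - r a) <= - cos (th t).
Proof.
move=> a0 at_ tS ha x_ge0; have t0 : 0 <= t := le_trans a0 at_.
have n0 : (0 : R) < p.+1%:R by rewrite ltr0n.
have d u : a <= u <= t -> is_derive u 1
    (fun u => r u ^+ p * - cos (th u) - lam / p.+1%:R * r u ^+ p.+1)
    (r u ^+ p * sin (th u) * (x u * sin (th u) - r u * cos (th u))).
  move=> /andP[au ut]; have uS : 0 <= u <= S.
    by rewrite (le_trans a0) //= (le_trans ut).
  have d1 := dvM (dvX p (dr uS)) (dvN (dvcos (dth uS))).
  have d2 := dvM (dvC (lam / p.+1%:R) u) (dvX p.+1 (dr uS)).
  apply: (dv_eq (dvB d1 d2)); have ru := r_gt0 uS.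
  rewrite /= wE /c; case: (p) p1 n0 => // q _ n0 /=; rewrite !exprS.
  by field; rewrite !gt_eqF.
have := @dv_le _ _ _ a t at_ d => H.
have {}H : r a ^+ p * - cos (th a) - lam / p.+1%:R * r a ^+ p.+1 <=
   r t ^+ p * - cos (th t) - lam / p.+1%:R * r t ^+ p.+1.
  apply: H => u /andP[au ut]; have uS : 0 <= u <= S.
    by rewrite (le_trans a0) //= (le_trans ut).
  have s0 := sin_th_ge0 uS; have ru := ltW (r_gt0 uS).
  have xu : 0 <= x u by apply: x_ge0; rewrite au.
  have co : cos (th u) <= 0.
    apply: cos_le0_phase2; rewrite th_le // andbT; apply: le_trans ha _.
    by apply: th_ndecr => //; rewrite (le_trans ut).
  apply: mulr_ge0; first by rewrite mulr_ge0 // exprn_ge0.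
  by have := mulr_ge0 xu s0; nra.
have aS : 0 <= a <= S by rewrite a0 (le_trans at_).
have ca : 0 <= r a ^+ p * - cos (th a).
  apply: mulr_ge0; first by rewrite exprn_ge0 // ltW // r_gt0.
  rewrite oppr_ge0; apply: cos_le0_phase2.
  by rewrite ha th_le.
have rt : 0 < r t ^+ p by rewrite exprn_gt0 // r_gt0 // t0.
rewrite -(ler_pM2l rt).
have k0 : 0 <= lam / p.+1%:R by rewrite divr_ge0 // ltW.
have ra : r a ^+ p.+1 <= r t ^+ p * r a.
  rewrite exprSr; apply: ler_wpM2r; first by rewrite ltW // r_gt0.
  have ra0 : 0 <= r a by rewrite ltW // r_gt0.
  have rat : r a <= r t by apply: r_ndecr.
  by rewrite lerXn2r // nnegrE // (le_trans ra0).
have := ler_wpM2l k0 ra; rewrite [r t ^+ p.+1]exprSr in H; move: H ca.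
move: (lam / _) (r t ^+ p) (r a ^+ p.+1) (r a ^+ p) => k A B D h1 h2 h3; lra.
Qed.

(** At every time of the first phase either [r * cos th] or the curvature is at
    least [lam / 2]; since [r <= d0 + t], in both cases [x + th] grows at least
    logarithmically. *)
Lemma phase1_time X d0 : th S <= pi / 2 -> x S <= X -> r 0 <= d0 ->
  1 + d0 + S <= (1 + d0) * expR (2 / lam * (X + pi / 2)).
Proof.
move=> hS xS rd0.
pose k := 2 / lam; have k0 : 0 < k by rewrite divr_gt0.
have d u : 0 <= u <= S -> is_derive u 1
    (fun u => (1 + d0 + u) * expR (- (k * (x u + th u))))
    (expR (- (k * (x u + th u))) * (1 - k * ((1 + d0 + u) * (cos (th u) + w u)))).
  move=> uS.
  have d1 := dvM (dvD (dvC (1 + d0) u) (dvI u))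
                 (dvexp (dvN (dvM (dvC k u) (dvD (dx uS) (dth uS))))).
  by apply: (dv_eq d1); ring.
have := @dv_ge _ _ _ 0 S S0 d; rewrite x0 th0 !addr0 mulr0 oppr0 expR0 mulr1.
move=> H; have r00 : 0 < r 0 by apply: r_gt0; rewrite lexx.
have {}H : (1 + d0 + S) * expR (- (k * (x S + th S))) <= 1 + d0.
  apply: H => u /andP[u0 uS]; have uS' : 0 <= u <= S by rewrite u0.
  rewrite mulr_ge0_le0 ?expR_ge0 // subr_le0.
  suff : lam / 2 <= (1 + d0 + u) * (cos (th u) + w u).
    move=> h; have := ler_wpM2l (ltW k0) h.
    by rewrite {1}/k mulrA divfK ?gt_eqF // divff.
  have ru := r_gt0 uS'; have rul := r_le uS'.
  have hu : th u <= pi / 2 by apply: le_trans hS; apply: th_ndecr.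
  have co : 0 <= cos (th u) by apply: cos_ge0_phase1; rewrite th_ge0.
  have wu := w_ge0 uS'.
  have q0 : 0 <= c * cos (th u) / r u.
    by rewrite divr_ge0 ?mulr_ge0 // ?(ltW ru) // (le_trans _ c1).
  have xu : 0 <= x u by rewrite -x0; apply: (@x_ndecr u).
  have xs := mulr_ge0 xu (sin_th_ge0 uS').
  case: (leP (r u * cos (th u)) (lam / 2)) => h.
    have : lam / 2 <= w u by rewrite wE; lra.
    by nra.
  have : r u * cos (th u) <= (1 + d0 + u) * (cos (th u) + w u).
    by apply: ler_pM => //; [exact: ltW|lra|lra].
  by lra.
have e0 := expR_gt0 (- (k * (x S + th S))).
rewrite -ler_pdivlMr // in H; apply: le_trans H _.
rewrite -expRN opprK; apply: ler_wpM2l; first by lra.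
by rewrite ler_expR ler_pM2l //; lra.
Qed.

(** The support function [r * cos th - x * sin th] decreases along the first
    phase, from the value [r 0]. *)
Lemma phase1_curvature : th S <= pi / 2 ->
  lam - r 0 + c * cos (th S) / r S <= w S.
Proof.
move=> hS.
have d u : 0 <= u <= S -> is_derive u 1
    (fun u => r u * cos (th u) - x u * sin (th u))
    (- (w u * (r u * sin (th u) + x u * cos (th u)))).
  move=> uS; apply: (dv_eq (dvB (dvM (dr uS) (dvcos (dth uS)))
                                (dvM (dx uS) (dvsin (dth uS))))).
  by ring.
have := @dv_ge _ _ _ 0 S S0 d; rewrite x0 th0 cos0 mulr1 mul0r subr0 => H.
suff : r S * cos (th S) - x S * sin (th S) <= r 0 by rewrite wE; lra.
apply: H => u uS; have /andP[u0 uS'] := uS.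
have hu : th u <= pi / 2 by apply: le_trans hS; apply: th_ndecr.
have co : 0 <= cos (th u) by apply: cos_ge0_phase1; rewrite th_ge0.
have xu : 0 <= x u by rewrite -x0; apply: (@x_ndecr u).
rewrite oppr_le0 mulr_ge0 ?w_ge0 // addr_ge0 // mulr_ge0 ?sin_th_ge0 //.
by rewrite ltW // r_gt0.
Qed.

End Estimates.

Section NeckEstimates.
Variables (R : realType) (lam : R) (p : nat).
Hypotheses (lam0 : 0 < lam) (p1 : (1 <= p)%N).
Let c : R := p%:R.
Variables (x r th : R -> R) (S : R).
Hypothesis arc : convex_arc lam p x r th S.
Hypotheses (hS : th S <= pi / 2) (r0_le : r 0 <= lam).
Let w t := curvature lam c (x t) (r t) (th t).

Let S0 : 0 <= S. Proof. by case: arc. Qed.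
Let c1 : 1 <= c. Proof. by rewrite /c ler1n. Qed.
Let r_gt0 t : 0 <= t <= S -> 0 < r t.
Proof. by case: arc => _ h _ _ _ /h[]. Qed.
Let dx t : 0 <= t <= S -> is_derive t 1 x (cos (th t)).
Proof. by case: arc => _ h _ _ _ /h[]. Qed.
Let dr t : 0 <= t <= S -> is_derive t 1 r (sin (th t)).
Proof. by case: arc => _ h _ _ _ /h[]. Qed.
Let dth t : 0 <= t <= S -> is_derive t 1 th (w t).
Proof. by case: arc => _ h _ _ _ /h[]. Qed.
Let th_phase1 t : 0 <= t <= S -> th t <= pi / 2.
Proof. by move=> /andP[t0 tS]; apply: le_trans hS; apply: (th_ndecr arc). Qed.
Let cos_ge0 t : 0 <= t <= S -> 0 <= cos (th t).
Proof.
by move=> h; apply: cos_ge0_phase1; rewrite (th_ge0 arc) // th_phase1.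
Qed.
Let w_ge t : 0 <= t <= S -> lam - r 0 + c * cos (th t) / r t <= w t.
Proof.
by move=> h; apply: (phase1_curvature (convex_arc_sub arc h) (th_phase1 h)).
Qed.
Let w_ge_cos t : 0 <= t <= S -> cos (th t) / r t <= w t.
Proof.
move=> h; apply: le_trans (w_ge h).
have q0 : 0 <= cos (th t) / r t by rewrite divr_ge0 ?cos_ge0 // ltW // r_gt0.
by have := ler_wpM2r q0 c1; move: r0_le; rewrite -mulrA; lra.
Qed.

(** On the classical catenoid [r * cos th] is constant; here the curvature is
    larger. *)
Lemma neck_rcos : r S * cos (th S) <= r 0.
Proof.
have d u : 0 <= u <= S -> is_derive u 1 (fun u => r u * cos (th u))
    (sin (th u) * (cos (th u) - r u * w u)).
  by move=> uS; apply: (dv_eq (dvM (dr uS) (dvcos (dth uS)))); ring.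
have := @dv_ge _ _ _ 0 S S0 d; case: (arc) => _ _ _ th0 _.
rewrite th0 cos0 mulr1; apply => u uS; have ru := r_gt0 uS.
apply: mulr_ge0_le0; first exact: (sin_th_ge0 arc).
by have := w_ge_cos uS; rewrite ler_pdivrMr //; lra.
Qed.

Lemma neck_time : lam / 2 <= lam - r 0 -> S <= pi / lam.
Proof.
move=> h; rewrite ler_pdivlMr //.
have d u : 0 <= u <= S -> is_derive u 1 (fun u => th u - lam / 2 * u)
    (w u - lam / 2).
  move=> uS; apply: (dv_eq (dvB (dth uS) (dvM (dvC (lam / 2) u) (dvI u)))).
  by ring.
have := @dv_le _ _ _ 0 S S0 d; case: (arc) => _ _ _ th0 _; rewrite th0 => H.
suff : 0 - lam / 2 * 0 <= th S - lam / 2 * S by move: hS; lra.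
apply: H => u uS; have := w_ge uS.
have : 0 <= c * cos (th u) / r u.
  by rewrite divr_ge0 ?mulr_ge0 ?cos_ge0 // ?(le_trans _ c1) ?ltW ?r_gt0.
by lra.
Qed.

End NeckEstimates.

Section NeckWidth.
Variables (R : realType) (lam : R) (p : nat).
Hypotheses (lam0 : 0 < lam) (p1 : (1 <= p)%N).
Variables (x r th : R -> R) (S : R).
Hypothesis arc : convex_arc lam p x r th S.
Hypotheses (hS : th S <= pi / 2) (r0_le : r 0 <= lam).

(** A catenoid of neck radius [r 0] is at distance about [r 0 * ln (2 * r / r 0)]
    from its mirror line when its radius [r] is large; with a larger curvature
    the arc stays closer. So a thin neck is narrow. *)
Lemma neck_width : x S <= r 0 * (ln (r S / r 0) + th S).
Proof.
case: (arc) => S0 prof x0 th0 _.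
have r_gt0 t : 0 <= t <= S -> 0 < r t by case/prof.
have r00 : 0 < r 0 by apply: r_gt0; rewrite lexx.
have d u : 0 <= u <= S -> is_derive u 1
    (fun u => r 0 * (ln (r u / r 0) + th u) - x u)
    (r 0 * (sin (th u) / r u + curvature lam p%:R (x u) (r u) (th u))
      - cos (th u)).
  move=> uS; have [ru dxu dru dtu] := prof _ uS.
  have q0 : 0 < r u / r 0 by rewrite divr_gt0.
  have dl := dv_comp (dvM dru (dvC (r 0)^-1 u)) (is_derive1_ln q0).
  apply: (dv_eq (dvB (dvM (dvC (r 0) u) (dvD dl dtu)) dxu)).
  by rewrite /=; field; rewrite !gt_eqF.
have := @dv_le _ _ _ 0 S S0 d; rewrite th0 x0 divff ?gt_eqF // ln1 => H.
suff : r 0 * (0 + 0) - 0 <= r 0 * (ln (r S / r 0) + th S) - x S by lra.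
apply: H => u uS; have [ru _ _ _] := prof _ uS; have /andP[u0 uS'] := uS.
have arcu := convex_arc_sub arc uS.
have hu : th u <= pi / 2 by apply: le_trans hS; apply: (th_ndecr arc).
have co : 0 <= cos (th u) by apply: cos_ge0_phase1; rewrite (th_ge0 arc).
have si : 0 <= sin (th u) by apply: (sin_th_ge0 arc).
have rc : r u * cos (th u) <= r 0 by exact: (neck_rcos p1 arcu).
have w1 : cos (th u) / r u <= curvature lam p%:R (x u) (r u) (th u).
  apply: le_trans (phase1_curvature arcu hu).
  have q0 : 0 <= cos (th u) / r u by rewrite divr_ge0 // ltW.
  have c1 : (1 : R) <= p%:R by rewrite ler1n.
  by have := ler_wpM2r q0 c1; move: r0_le; rewrite -mulrA; lra.
have : cos (th u) <= r 0 / r u by rewrite ler_pdivlMr // mulrC.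
have : r 0 / r u <= r 0 * (sin (th u) / r u + cos (th u) / r u).
  rewrite -mulrDl; apply: ler_wpM2l; first exact: ltW.
  rewrite -[leLHS]mul1r ler_pM2r ?invr_gt0 //.
  have := cos2Dsin2 (th u); have := cos_le1 (th u); have := sin_le1 (th u).
  by nra.
have := ler_wpM2l (ltW r00) w1; lra.
Qed.

End NeckWidth.

Section Times.
Variables (R : realType) (lam : R) (p : nat).
Hypotheses (lam0 : 0 < lam) (p1 : (1 <= p)%N).

Lemma phase2_speed (x r th : R -> R) S a b : convex_arc lam p x r th S ->
  0 <= a -> a <= b -> b <= S -> pi / 2 <= th a ->
  - cos (th a) * (b - a) <= x a - x b.
Proof.
move=> arc a0 ab bS ha; have [S0 prof _ _ k] := arc.
have d u : a <= u <= b -> is_derive u 1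
    (fun u => - x u - - cos (th a) * u) (- cos (th u) - - cos (th a)).
  move=> /andP[au ub]; have [|_ du _ _] := prof u.
    by rewrite (le_trans a0) //= (le_trans ub).
  by apply: (dv_eq (dvB (dvN du) (dvM (dvC (- cos (th a)) u) (dvI u)))); ring.
have := @dv_le _ _ _ a b ab d => H.
suff : - x a - - cos (th a) * a <= - x b - - cos (th a) * b by lra.
apply: H => u /andP[au ub]; rewrite opprK addrC subr_ge0.
have u0 : 0 <= u := le_trans a0 au; have uS : u <= S := le_trans ub bS.
have tt : th a <= th u by apply: (th_ndecr arc).
have ta : 0 <= th a by apply: (th_ge0 arc); rewrite a0 (le_trans au).
have tu : th u <= pi by have [|_] := k u; rewrite ?u0.
rewrite leNgt ltr_cos ?in_itv /= -?leNgt //.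
  by rewrite (le_trans ta).
by rewrite ta (le_trans tt).
Qed.

(** The first phase is bounded by [phase1_time]. One unit of time after the
    quarter turn the tangent points back by at least [k]: otherwise the radius
    would have grown by [1 / 2] and [phase2_slope] gives the same conclusion. From
    then on the arc can only last [X / k]. *)
Lemma time_bound (d0 X : R) : exists T, forall (x r th : R -> R) (S : R),
  convex_arc lam p x r th S -> r 0 <= d0 ->
  (forall t, 0 <= t <= S -> x t <= X) ->
  (forall t, 0 <= t <= S -> pi / 2 <= th t -> 0 <= x t) -> S <= T.
Proof.
pose T1 := (1 + d0) * expR (2 / lam * (X + pi / 2)).
pose k := Num.min (1 / 2) (lam / p.+1%:R * (1 / 2)).
have k0 : 0 < k by rewrite lt_min !mulr_gt0 ?invr_gt0 ?ltr0n.
exists (T1 + 1 + X / k) => x r th S arc rd xX x_ge0.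
have [S0 prof x0 th0 cw] := arc.
have X0 : 0 <= X by rewrite -x0; apply: xX; rewrite lexx.
have Xk : 0 <= X / k by rewrite divr_ge0 // ltW.
have d00 : 0 <= d0.
  by apply: le_trans rd; have [|r00 _ _ _] := prof 0; rewrite ?lexx // ltW.
have T1b t : 0 <= t <= S -> th t <= pi / 2 -> t <= T1.
  move=> tS ht; have := phase1_time lam0 (convex_arc_sub arc tS) ht (xX _ tS) rd.
  by rewrite -/T1; lra.
case: (leP (th S) (pi / 2)) => hS.
  by have := T1b S; rewrite S0 lexx => /(_ isT hS); lra.
have [a aS ha] := turning_time arc (ltW hS); have /andP[a0 aS'] := aS.
have aT : a <= T1 by apply: T1b; rewrite ?ha.
case: (leP S (a + 1)) => Sa; first by lra.
pose b := a + 1; have ab : a <= b by rewrite /b; lra.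
have b0 : 0 <= b := le_trans a0 ab.
have hb : pi / 2 <= th b by rewrite -ha; apply: (th_ndecr arc) => //; exact: ltW.
have kb : k <= - cos (th b).
  case: (leP (1 / 2) (- cos (th b))) => h; first by rewrite ge_min h.
  rewrite ge_min; apply/orP; right.
  have rab : 1 / 2 <= r b - r a.
    have d u : a <= u <= b -> is_derive u 1 (fun u => r u - 1 / 2 * u)
        (sin (th u) - 1 / 2).
      move=> /andP[au ub]; have [|_ _ du _] := prof u.
        by rewrite (le_trans a0) //= (le_trans ub) // ltW.
      by apply: (dv_eq (dvB du (dvM (dvC (1 / 2) u) (dvI u)))); ring.
    have := @dv_le _ _ _ a b ab d => H.
    suff : r a - 1 / 2 * a <= r b - 1 / 2 * b by rewrite /b; lra.
    apply: H => u /andP[au ub]; rewrite subr_ge0.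
    have u0 : 0 <= u := le_trans a0 au.
    have uS : 0 <= u <= S by rewrite u0 (le_trans ub) // ltW.
    have si : 0 <= sin (th u) by apply: (sin_th_ge0 arc).
    have hu : pi / 2 <= th u by rewrite -ha; apply: (th_ndecr arc); case/andP: uS.
    have co : cos (th u) <= 0.
      by apply: cos_le0_phase2; rewrite hu; have [] := cw _ uS.
    have co2 : - cos (th u) < 1 / 2.
      apply: le_lt_trans h; rewrite lerN2 leNgt.
      have tt : th u <= th b by apply: (th_ndecr arc) => //; exact: ltW.
      have [|_ tp] := cw b; first by rewrite b0 ltW.
      have tu : 0 <= th u by apply: (th_ge0 arc).
      rewrite ltr_cos ?in_itv /= -?leNgt //; rewrite ?tu ?(le_trans tt) //.
      by rewrite (le_trans tu).
    by have := cos2Dsin2 (th u); nra.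
  have h1 : lam / p.+1%:R * (r b - r a) <= - cos (th b).
    apply: (phase2_slope lam0 p1 arc a0 ab (ltW Sa)); first by rewrite ha.
    move=> u /andP[au ub]; have u0 : 0 <= u := le_trans a0 au.
    have uS : u <= S by rewrite (le_trans ub) // ltW.
    by apply: x_ge0; rewrite ?u0 // -ha; apply: (th_ndecr arc).
  apply: le_trans h1; apply: ler_wpM2l => //.
  by rewrite divr_ge0 // ltW.
have := phase2_speed arc b0 (ltW Sa) (lexx S) hb.
have xS : 0 <= x S by apply: x_ge0; rewrite ?S0 ?lexx // ltW.
have xb : x b <= X by apply: xX; rewrite b0 ltW.
have Sb : 0 <= S - b by rewrite subr_ge0 ltW.
have := ler_wpM2r Sb kb => h1 h2.
have : S - b <= X / k by rewrite ler_pdivlMr // mulrC; lra.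
by rewrite /b; lra.
Qed.

(** Just after the quarter turn a bound on the curvature keeps the tangent
    steep, hence the radius grows. *)
Lemma steep_after_turn (x r th : R -> R) S a b W : convex_arc lam p x r th S ->
  0 <= a -> a <= b -> b <= S -> th a = pi / 2 -> 0 <= W -> W * (b - a) <= 1 / 2 ->
  (forall u, a <= u <= b -> curvature lam p%:R (x u) (r u) (th u) <= W) ->
  1 / 2 <= sin (th b) /\ 1 / 2 * (b - a) <= r b - r a.
Proof.
move=> arc a0 ab bS ha W0 Wb kW; have [_ prof _ _ cw] := arc.
have uS u : a <= u <= b -> 0 <= u <= S.
  by move=> /andP[au ub]; rewrite (le_trans a0) //= (le_trans ub).
have si u : a <= u <= b -> 1 / 2 <= sin (th u).
  move=> /andP[au ub].
  have d v : a <= v <= u -> is_derive v 1 (fun v => sin (th v) + W * v)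
      (cos (th v) * curvature lam p%:R (x v) (r v) (th v) + W).
    move=> /andP[av vu]; have [|_ _ _ dv] := prof v.
      by apply: uS; rewrite av (le_trans vu).
    by apply: (dv_eq (dvD (dvsin dv) (dvM (dvC W v) (dvI v)))); ring.
  have := @dv_le _ _ _ a u au d; rewrite ha sin_pihalf => H.
  have {H} : 1 + W * a <= sin (th u) + W * u.
    apply: H => v /andP[av vu]; have vb : a <= v <= b by rewrite av (le_trans vu).
    have [wv _] := cw v (uS v vb).
    by have := kW v vb; have := cos_geN1 (th v); move: wv; clear; nra.
  have : W * (u - a) <= W * (b - a) by rewrite ler_wpM2l // lerD2r.
  by move: Wb; clear; lra.
split; first by apply: si; rewrite ab lexx.
have d u : a <= u <= b -> is_derive u 1 (fun u => r u - 1 / 2 * u)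
    (sin (th u) - 1 / 2).
  move=> ub; have [|_ _ du _] := prof u; first exact: uS.
  by apply: (dv_eq (dvB du (dvM (dvC (1 / 2) u) (dvI u)))); ring.
have := @dv_le _ _ _ a b ab d => H.
suff : r a - 1 / 2 * a <= r b - 1 / 2 * b by clear; lra.
by apply: H => u /si; rewrite subr_ge0.
Qed.

(** Integrating [phase2_slope] once more: while the radius grows linearly, [x]
    falls quadratically. *)
Lemma phase2_drop (x r th : R -> R) S a b : convex_arc lam p x r th S ->
  0 <= a -> a <= b -> b <= S -> pi / 2 <= th a ->
  (forall u, a <= u <= b -> 0 <= x u) ->
  (forall u, a <= u <= b -> 1 / 2 * (u - a) <= r u - r a) ->
  x b + lam / p.+1%:R * ((b - a) ^+ 2 / 4) <= x a.
Proof.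
move=> arc a0 ab bS ha x_ge0 hr; have [_ prof _ _ _] := arc.
have k0 : 0 <= lam / p.+1%:R by rewrite divr_ge0 ?ltW.
have slope u : a <= u <= b -> lam / p.+1%:R * (r u - r a) <= - cos (th u).
  move=> /andP[au ub].
  apply: (phase2_slope lam0 p1 arc a0 au (le_trans ub bS) ha) => v /andP[av vu].
  by apply: x_ge0; rewrite av (le_trans vu).
move: (lam / _) k0 slope => k k0 slope.
have d u : a <= u <= b -> is_derive u 1 (fun u => x u + k * (1 / 4 * (u - a) ^+ 2))
    (cos (th u) + k * (1 / 2 * (u - a))).
  move=> /andP[au ub]; have [|_ du _ _] := prof u.
    by rewrite (le_trans a0) //= (le_trans ub).
  have d2 := dvX 2 (dvB (dvI u) (dvC a u)).
  apply: (dv_eq (dvD du (dvM (dvC k u) (dvM (dvC (1 / 4) u) d2)))).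
  by rewrite /=; field.
have := @dv_ge _ _ _ a b ab d; rewrite subrr => H.
have {H} : x b + k * (1 / 4 * (b - a) ^+ 2) <= x a + k * (1 / 4 * 0 ^+ 2).
  apply: H => u ub; have := ler_wpM2l k0 (hr u ub); have := slope u ub.
  by clear; lra.
by clear; lra.
Qed.

(** A thin neck is narrow by [neck_width], so that [x] is smaller than [eps] at
    the quarter turn, while [phase2_drop] would take away [eps] from it within
    time [tau]. The arc is thus back at the mirror line within time [tau], too
    soon to complete the half turn. *)
Lemma small_neck : exists rho T0 : R, [/\ 0 < rho, rho <= lam / 2 &
  forall (x r th : R -> R) (S : R), convex_arc lam p x r th S -> r 0 = rho ->
    (forall t, 0 <= t <= S -> pi / 2 <= th t -> 0 <= x t) ->
    [/\ S <= T0, th S < pi &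
        th S <= pi / 2 -> 0 < curvature lam p%:R (x S) (r S) (th S)]].
Proof.
have l0 : 0 < lam := lam0.
pose R2 := lam / 2 + pi / lam + 1.
have pl : 0 < pi / lam by rewrite divr_gt0 // pi_gt0.
have R20 : 0 < R2 by rewrite /R2; lra.
(* [W] bounds the curvature after the quarter turn, so that the sine stays
   above [1 / 2] for a time [tau]; [R2] bounds the radius. *)
pose W := lam + 1 + R2; pose tau := 1 / (2 * W).
pose eps := Num.min 1 (lam / p.+1%:R * (tau ^+ 2 / 4)).
have W1 : 1 < W by rewrite /W; lra.
have W0 : 0 < W by lra.
have tau0 : 0 < tau by rewrite /tau divr_gt0 // mulr_gt0 //; lra.
have tauW : W * tau = 1 / 2 by rewrite /tau; field; lra.
have tau1 : tau <= 1 by nra.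
have n0 : (0 : R) < p.+1%:R by rewrite ltr0n.
have t2 : 0 < tau ^+ 2 := exprn_gt0 2 tau0.
have eps0 : 0 < eps by rewrite lt_min ltr01 /= mulr_gt0 ?(divr_gt0 t2) ?(divr_gt0 l0).
(* The width [rho * (ln (R2 / rho) + pi / 2)] of a neck of radius
   [rho = R2 / y ^+ 2] is at most [rho * (2 * y + 2)]. *)
pose y := 1 + 4 * R2 / eps + 2 * R2 / lam.
have Re : 0 < R2 / eps by rewrite divr_gt0.
have Rl : 0 < R2 / lam by rewrite divr_gt0.
have y1 : 1 < y by rewrite /y; lra.
have y0 : 0 < y by lra.
pose rho := R2 / y ^+ 2.
have rho0 : 0 < rho by rewrite divr_gt0 // exprn_gt0.
have rhol : rho <= lam / 2.
  rewrite /rho ler_pdivrMr ?exprn_gt0 //.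
  have : R2 <= lam / 2 * y.
    have -> : R2 = lam / 2 * (2 * R2 / lam) by field; lra.
    by apply: ler_wpM2l; rewrite ?divr_ge0 ?ltW // /y; lra.
  by nra.
have rhoe : rho * (2 * y + 2) < eps.
  have h1 : 4 * R2 < eps * y.
    have -> : 4 * R2 = eps * (4 * R2 / eps) by field; lra.
    by rewrite ltr_pM2l // /y; lra.
  rewrite /rho mulrAC ltr_pdivrMr ?exprn_gt0 //.
  by nra.
exists rho, (pi / lam + 1); split=> // x r th S arc r0 x_ge0.
have [S0 prof x0 th0 cw] := arc.
have r0l : r 0 <= lam by rewrite r0; lra.
have time1 t : 0 <= t <= S -> th t <= pi / 2 -> t <= pi / lam.
  move=> tS ht; apply: (neck_time lam0 (convex_arc_sub arc tS) ht).
  by rewrite r0; lra.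
have k1 : th S <= pi / 2 -> 0 < curvature lam p%:R (x S) (r S) (th S).
  move=> hS; apply: lt_le_trans (phase1_curvature arc hS).
  have [|rS _ _ _] := prof S; first by rewrite S0 lexx.
  have : 0 <= p%:R * cos (th S) / r S.
    rewrite divr_ge0 ?(ltW rS) // mulr_ge0 // cos_ge0_phase1 // hS andbT.
    by apply: (th_ge0 arc); rewrite S0 lexx.
  by rewrite r0; lra.
case: (leP (th S) (pi / 2)) => hS.
  have tS := time1 S; rewrite S0 lexx in tS; have {}tS := tS isT hS.
  split; [lra| |by move=> _; apply: k1].
  by apply: le_lt_trans hS _; have := pi_gt0 R; lra.
have [a aS ha] := turning_time arc (ltW hS); have /andP[a0 aS'] := aS.
have ha' : th a <= pi / 2 by rewrite ha.
have aT : a <= pi / lam by apply: time1.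
have xa : x a < eps.
  have ara := convex_arc_sub arc aS.
  apply: le_lt_trans (neck_width p1 ara ha' r0l) _.
  rewrite r0 ha; apply: le_lt_trans rhoe; apply: ler_wpM2l; first exact: ltW.
  have [ra _ _ _] := prof _ aS.
  have h1 : r a / rho <= y ^+ 2.
    have -> : y ^+ 2 = R2 / rho by rewrite /rho; field; rewrite !gt_eqF ?exprn_gt0.
    rewrite ler_pM2r ?invr_gt0 //; apply: le_trans (r_le arc aS) _.
    by rewrite r0 /R2; lra.
  have h2 : ln (r a / rho) <= 2 * y.
    apply: le_trans (_ : ln (y ^+ 2) <= _).
      by rewrite ler_ln ?posrE ?divr_gt0 ?exprn_gt0.
    rewrite lnXn // mulr_natl lerMn2r /=.
    apply: le_trans (_ : y - 1 <= _); last by lra.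
    have := @le_ln1Dx R (y - 1); rewrite [1 + _]addrC subrK; apply; lra.
  by have := @pihalf_lt2 R; lra.
have eps1 : eps <= 1 by rewrite ge_min lexx.
have kW u : a <= u -> u <= S -> u <= a + tau ->
    curvature lam p%:R (x u) (r u) (th u) <= W.
  move=> au uS ut; have u0 : 0 <= u := le_trans a0 au.
  have uS' : 0 <= u <= S by rewrite u0.
  have [ru _ _ _] := prof _ uS'; have [_ tu] := cw _ uS'.
  have hu : pi / 2 <= th u by rewrite -ha; apply: (th_ndecr arc).
  have co : cos (th u) <= 0 by apply: cos_le0_phase2; rewrite hu.
  have co1 := cos_geN1 (th u).
  have xu : x u <= x a by apply: (x_nincr arc) => //; rewrite ha.
  have xu0 : 0 <= x u by apply: x_ge0.
  have rul : r u <= R2.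
    apply: le_trans (r_le arc uS') _; rewrite r0 /R2.
    by move: ut aT tau1 rhol; clear; lra.
  have q0 : 0 <= - (p%:R * cos (th u) / r u).
    by rewrite -mulNr divr_ge0 ?(ltW ru) // -mulrN mulr_ge0 // oppr_ge0.
  have h1 : x u * sin (th u) <= 1.
    have : x u * sin (th u) <= x u * 1 by apply: ler_wpM2l => //; exact: sin_le1.
    by move: xu xa eps1; clear; lra.
  have h2 : - (r u * cos (th u)) <= R2 by move: ru rul co co1; clear; nra.
  by rewrite wE /W; move: q0 h1 h2; clear; lra.
have facts u : a <= u -> u <= S -> u <= a + tau ->
    1 / 2 <= sin (th u) /\ 1 / 2 * (u - a) <= r u - r a.
  move=> au uS ut; apply: (steep_after_turn arc a0 au uS ha (ltW W0)).
    by rewrite -tauW ler_pM2l // lerBlDl.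
  by move=> v /andP[av vu]; apply: kW; rewrite // (le_trans vu).
have St : S < a + tau.
  rewrite ltNge; apply/negP => tS.
  have ab : a <= a + tau by rewrite lerDl ltW.
  have ha2 : pi / 2 <= th a by rewrite ha.
  have x_ge0' u : a <= u <= a + tau -> 0 <= x u.
    move=> /andP[au ub]; have u0 : 0 <= u := le_trans a0 au.
    have uS : u <= S := le_trans ub tS.
    by apply: x_ge0; rewrite ?u0 // -ha; apply: (th_ndecr arc).
  have hr u : a <= u <= a + tau -> 1 / 2 * (u - a) <= r u - r a.
    by move=> /andP[au ub]; case: (facts u au (le_trans ub tS) ub).
  have := phase2_drop arc a0 ab tS ha2 x_ge0' hr.
  rewrite [a + tau - a]addrAC subrr add0r.
  have xb : 0 <= x (a + tau) by apply: x_ge0'; rewrite ab lexx.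
  have : eps <= lam / p.+1%:R * (tau ^+ 2 / 4) by rewrite ge_min lexx orbT.
  by move: (lam / p.+1%:R * _) xa xb; clear=> *; lra.
have [s1 _] := facts S aS' (lexx S) (ltW St).
split; [lra| |by []].
have [|_ h] := cw S; first by rewrite S0 lexx.
by rewrite lt_neqAle h andbT; apply/eqP => e; move: s1; rewrite e sinpi; lra.
Qed.

End Times.

(** * Zeros and distances of real functions *)

Section RealFunctions.
Variable R : realType.
Implicit Types (f : R -> R) (s t : R).

Lemma continuous_gt0 f s : {for s, continuous f} -> 0 < f s ->
  exists2 e, 0 < e & forall t, `|t - s| < e -> 0 < f t.
Proof.
move=> cf fs; have : \forall t \near s, 0 < f t by exact: (cvgr_gt (f s) cf).
move=> /nbhs_normP[e e0 he]; exists e => // t ht; apply: he.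
by rewrite /ball_ /= distrC.
Qed.

Lemma first_zero f T : 0 <= T -> continuous f -> 0 < f 0 ->
  (forall t, 0 <= t <= T -> 0 < f t) \/
  exists s, [/\ 0 < s, s <= T, f s = 0 & forall t, 0 <= t < s -> 0 < f t].
Proof.
move=> T0 cf f0; pose E := [set t | 0 <= t <= T /\ f t <= 0].
have [[t0 Et0]|nE] := pselect (exists t, E t); last first.
  left=> t tT; rewrite ltNge; apply/negP => ft; apply: nE.
  by exists t.
right; have hE : has_inf E.
  by split; [exists t0|exists 0 => t [/andP[]]].
have lb t : E t -> inf E <= t by move=> Et; apply: ge_inf => //; exact: (proj2 hE).
have glb y : (forall t, E t -> y <= t) -> y <= inf E.
  by move=> h; apply: lb_le_inf => //; exists t0.
have s0 : 0 <= inf E by apply: glb => t [/andP[]].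
have sT : inf E <= T by apply: le_trans (lb _ Et0) _; case: Et0 => /andP[].
have bef t : 0 <= t < inf E -> 0 < f t.
  move=> /andP[t0' ts]; rewrite ltNge; apply/negP => ft.
  have : inf E <= t by apply: lb; split=> //; rewrite t0' (le_trans (ltW ts)).
  by rewrite leNgt ts.
have le0 : f (inf E) <= 0.
  rewrite leNgt; apply/negP => fs; have [e e0 he] := continuous_gt0 (cf _) fs.
  have : inf E + e <= inf E.
    apply: glb => t Et; have := lb _ Et => st.
    rewrite leNgt; apply/negP => te; have [_] := Et; apply/negP; rewrite -ltNge.
    by apply: he; rewrite ger0_norm ?subr_ge0 //; lra.
  by lra.
have s0' : 0 < inf E.
  rewrite lt_neqAle s0 andbT; apply/eqP => e.
  by move: le0; rewrite -e leNgt f0.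
exists (inf E); split=> //; apply/eqP; rewrite eq_le le0 /= leNgt; apply/negP => fs.
have cN : {for inf E, continuous (fun t => - f t)} by apply: continuousN; exact: cf.
have fN : 0 < - f (inf E) by rewrite oppr_gt0.
have [e e0 he] := continuous_gt0 cN fN.
pose d := Num.min (e / 2) (inf E / 2).
have d0 : 0 < d by rewrite lt_min !divr_gt0.
have de : d <= e / 2 by rewrite ge_min lexx.
have ds : d <= inf E / 2 by rewrite ge_min lexx orbT.
have := he (inf E - d); rewrite addrAC subrr add0r normrN gtr0_norm //.
have : 0 < f (inf E - d) by apply: bef; apply/andP; split; lra.
move=> h1 h2; have h3 : 0 < - f (inf E - d) by apply: h2; lra.
by lra.
Qed.

Lemma decreases_right f s d e : is_derive s 1 f d -> d < 0 -> 0 < e ->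
  exists2 t, s < t < s + e & f t < f s.
Proof.
move=> [df fd] d0 e0.
have : (h^-1 *: ((f \o shift s) h%:A - f s)) @[h --> 0^'] --> d.
  by rewrite -fd; exact: df.
move=> /cvgr_lt/(_ 0 d0) [r /= r0 hr].
pose h := Num.min (r / 2) (e / 2).
have h0 : 0 < h by rewrite lt_min !divr_gt0.
have hr' : h <= r / 2 by rewrite ge_min lexx.
have he : h <= e / 2 by rewrite ge_min lexx orbT.
exists (s + h); first by apply/andP; split; lra.
have := hr h; rewrite /ball /= sub0r normrN gtr0_norm //.
have -> : h%:A = h by rewrite /GRing.scale /= mulr1.
move=> H; rewrite -subr_lt0 [s + h]addrC.
have : h^-1 * (f (h + s) - f s) < 0 by apply: H; [lra|rewrite gt_eqF].
by rewrite pmulr_rlt0 // invr_gt0.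
Qed.

(** Compactness: a positive continuous function on [[0, s]] has a positive
    minimum, which survives a small change of the parameter. *)
Lemma persists (G : R -> R -> R) d s M : 0 <= s -> 0 < M ->
  (forall d' t, 0 <= t <= s -> `|G d t - G d' t| <= M * `|d - d'|) ->
  continuous (G d) -> (forall t, 0 <= t <= s -> 0 < G d t) ->
  exists2 eta, 0 < eta &
    forall d', `|d' - d| < eta -> forall t, 0 <= t <= s -> 0 < G d' t.
Proof.
move=> s0 M0 hM cG hG.
have [|t0 t0s tmin] := @EVT_min R (G d) 0 s s0.
  exact: continuous_subspaceT.
have {}t0s : 0 < G d t0 by apply: hG; move: t0s; rewrite in_itv.
exists (G d t0 / M); first by rewrite divr_gt0.
move=> d' hd t ts; have := hM d' t ts; rewrite distrC in hd.
rewrite ltr_pdivlMr // mulrC in hd => h.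
have := tmin t; rewrite in_itv /= => /(_ ts) h1.
by have := le_lt_trans h hd; rewrite ltr_norml => /andP[_]; lra.
Qed.

Lemma max_dist (a b a' b' D : R) : `|a - a'| <= D -> `|b - b'| <= D ->
  `|Num.max a b - Num.max a' b'| <= D.
Proof.
rewrite !ler_norml => /andP[? ?] /andP[? ?]; apply/andP.
by split; rewrite /Num.max; do 2 case: ltP => ?; lra.
Qed.

Lemma min_dist (a b a' b' D : R) : `|a - a'| <= D -> `|b - b'| <= D ->
  `|Num.min a b - Num.min a' b'| <= D.
Proof.
rewrite !ler_norml => /andP[? ?] /andP[? ?]; apply/andP.
by split; rewrite /Num.min; do 2 case: ltP => ?; lra.
Qed.

Lemma sin_dist (a b : R) : `|sin a - sin b| <= `|a - b|.
Proof.
wlog ab : a b / b <= a.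
  by move=> h; case: (leP b a) => [/h //|/ltW /h]; rewrite distrC (distrC b).
rewrite (ger0_norm (_ : 0 <= a - b)) ?subr_ge0 //.
apply: (@dv_dist _ _ (fun u => u) cos (fun=> 1)) => // t _.
exact: cos_max.
Qed.

Lemma cos_dist (a b : R) : `|cos a - cos b| <= `|a - b|.
Proof.
have := sin_dist (a + pi / 2) (b + pi / 2).
by rewrite !sinDpihalf opprD addrACA subrr addr0.
Qed.

Lemma mul_dist (a b a' b' A B D E : R) : `|a - a'| <= D -> `|b - b'| <= E ->
  `|b| <= B -> `|a'| <= A -> `|a * b - a' * b'| <= D * B + A * E.
Proof.
move=> h1 h2 h3 h4.
have -> : a * b - a' * b' = (a - a') * b + a' * (b - b') by ring.
apply: le_trans (ler_normD _ _) _; rewrite !normrM.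
by apply: lerD; apply: ler_pM.
Qed.

Definition clamp (a b v : R) := Num.max a (Num.min b v).

Lemma clamp_id a b v : a <= v <= b -> clamp a b v = v.
Proof.
by move=> /andP[av vb]; rewrite /clamp (min_idPr vb) (max_idPr av).
Qed.

Lemma clamp_bounds a b v : a <= b -> a <= clamp a b v <= b.
Proof. by move=> ab; rewrite /clamp le_max lexx /= ge_max ab ge_min lexx. Qed.

Lemma clamp_dist a b v v' D : `|v - v'| <= D -> `|clamp a b v - clamp a b v'| <= D.
Proof.
move=> h; have D0 : 0 <= D := le_trans (normr_ge0 _) h.
by apply: max_dist; [|apply: min_dist]; rewrite // subrr normr0.
Qed.

Lemma clampN K v : 0 <= K -> clamp (- K) K (- v) = - clamp (- K) K v.
Proof.
rewrite /clamp /Num.max /Num.min => K0.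
by case: (ltP K (- v)) => h1; case: (ltP K v) => h2; do ?case: ltP => ?; lra.
Qed.

End RealFunctions.

(** * A bounded Lipschitz extension of the profile field *)

Inductive coord := Cx | Cr | Ct.

Section ClampedField.
Variables (R : realType) (lam c rho K : R).
Hypotheses (lam0 : 0 < lam) (c0 : 0 <= c) (rho0 : 0 < rho) (rhoK : rho <= K).

(** The field of the profile equation is neither bounded nor Lipschitz, and not
    even defined at [r = 0]. Clamping the two coordinates of the plane makes it
    bounded and Lipschitz without changing it on the compact region where the
    arcs in question live; clamping [x] symmetrically preserves the reflection
    [x -> - x]. *)
Definition clamped_field (i : coord) (u : coord -> R) : R :=
  match i with
  | Cx => cos (u Ct)
  | Cr => sin (u Ct)
  | Ct => curvature lam c (clamp (- K) K (u Cx)) (clamp rho K (u Cr)) (u Ct)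
  end.

Let K0 : 0 < K. Proof. exact: lt_le_trans rhoK. Qed.
Let Kx v : `|clamp (- K) K v| <= K.
Proof. by rewrite ler_norml clamp_bounds // ge0_cp // ltW. Qed.
Let Kr v : rho <= clamp rho K v <= K. Proof. exact: clamp_bounds. Qed.
Let Kr' v : `|clamp rho K v - c / clamp rho K v| <= K + c / rho.
Proof.
have /andP[h1 h2] := Kr v; have v0 := lt_le_trans rho0 h1.
apply: le_trans (ler_normB _ _) _.
rewrite (gtr0_norm v0) (ger0_norm (divr_ge0 c0 (ltW v0))).
by apply: lerD => //; apply: ler_wpM2l => //; rewrite lef_pV2.
Qed.

Lemma clamped_bounded i u :
  `|clamped_field i u| <= 1 + lam + K + (K + c / rho).
Proof.
have cr : 0 <= c / rho by rewrite divr_ge0 // ltW.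
have [l k] := (lam0, K0).
case: i => /=.
- by apply: le_trans (cos_max _) _; lra.
- by apply: le_trans (sin_max _) _; lra.
rewrite /curvature; apply: le_trans (ler_normB _ _) _.
apply: le_trans (lerD (ler_normD _ _) (lexx _)) _; rewrite !normrM (gtr0_norm l).
have h1 : `|clamp (- K) K (u Cx)| * `|sin (u Ct)| <= K * 1.
  by apply: ler_pM => //; exact: sin_max.
have h2 : `|clamp rho K (u Cr) - c / clamp rho K (u Cr)| * `|cos (u Ct)|
    <= (K + c / rho) * 1 by apply: ler_pM => //; exact: cos_max.
by move: h1 h2; lra.
Qed.

Lemma clamped_lipschitz : exists2 L, 0 < L & forall (u v : coord -> R) (D : R),
  (forall j, `|u j - v j| <= D) ->
  forall i, `|clamped_field i u - clamped_field i v| <= L * D.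
Proof.
have cr : 0 <= c / rho by rewrite divr_ge0 // ltW.
have cr2 : 0 <= c / rho ^+ 2 by rewrite divr_ge0 // exprn_ge0 // ltW.
have k := K0.
pose L := 1 + (1 + K) + ((1 + c / rho ^+ 2) + (K + c / rho)).
have L0 : 1 <= L by rewrite /L; lra.
exists L; first by lra.
move=> u v D h i; have D0 : 0 <= D := le_trans (normr_ge0 _) (h i).
have LD : D <= L * D by rewrite -{1}[D]mul1r ler_wpM2r.
case: i => /=.
- by apply: le_trans (cos_dist _ _) _; apply: le_trans LD.
- by apply: le_trans (sin_dist _ _) _; apply: le_trans LD.
rewrite /curvature.
set a := clamp _ _ (u Cx); set a' := clamp _ _ (v Cx).
set b := clamp _ _ (u Cr); set b' := clamp _ _ (v Cr).
have da : `|a - a'| <= D by apply: clamp_dist.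
have db : `|b - b'| <= D by apply: clamp_dist.
have /andP[b1 _] : rho <= b <= K := Kr _.
have /andP[b1' _] : rho <= b' <= K := Kr _.
have [p1 p2] := (lt_le_trans rho0 b1, lt_le_trans rho0 b1').
have di : `|(b - c / b) - (b' - c / b')| <= (1 + c / rho ^+ 2) * D.
  have -> : (b - c / b) - (b' - c / b') = (b - b') + c / (b * b') * (b - b').
    by field; rewrite !gt_eqF.
  apply: le_trans (ler_normD _ _) _; rewrite mulrDl mul1r lerD // normrM.
  have bb : 0 < b * b' by rewrite mulr_gt0.
  apply: ler_pM => //; rewrite (ger0_norm (divr_ge0 c0 (ltW bb))).
  apply: ler_wpM2l => //; rewrite lef_pV2 ?posrE ?exprn_gt0 // expr2.
  by apply: ler_pM => //; exact: ltW.
have h1 := mul_dist da (le_trans (sin_dist _ _) (h Ct)) (sin_max (u Ct)) (Kx (v Cx)).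
have h2 := mul_dist di (le_trans (cos_dist _ _) (h Ct)) (cos_max (u Ct)) (Kr' (v Cr)).
set p := a * _ in h1 *; set q := a' * _ in h1 *.
set y := _ * _ in h2 *; set z := _ * cos (v Ct) in h2 *.
have -> : lam + p - y - (lam + q - z) = (p - q) - (y - z) by ring.
apply: le_trans (ler_normB _ _) _; apply: le_trans (lerD h1 h2) _.
by rewrite /L; lra.
Qed.

Let F := clamped_field.

Lemma clamped_shift (Y : coord -> R -> R) (a : R) :
  ode_solution F Y -> ode_solution F (fun i t => Y i (t + a)).
Proof.
move=> h i t.
apply: (dv_eq (dv_comp (dvD (dvI t) (dvC a t)) (h i (t + a)))).
by rewrite addr0 mulr1.
Qed.

(** Reflection in the mirror line [x = 0], run backwards. At a time 0 where
    [x = 0], the tangent is orthogonal to the mirror line when [th = b / 2] and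
    [b] is a multiple of [2 * pi]; then the mirror image has the same initial
    values. *)
Definition mirror (b : R) (Y : coord -> R -> R) (i : coord) (t : R) : R :=
  match i with
  | Cx => - Y Cx (- t)
  | Cr => Y Cr (- t)
  | Ct => b - Y Ct (- t)
  end.

Lemma clamped_mirror (Y : coord -> R -> R) (b : R) :
  (forall a : R, cos (b - a) = cos a) -> (forall a : R, sin (b - a) = - sin a) ->
  ode_solution F Y -> ode_solution F (mirror b Y).
Proof.
move=> hc hs h i t; have dm : is_derive t 1 (fun u : R => - u) (- 1 : R).
  by apply: dvN; apply: dvI.
case: i.
- by apply: (dv_eq (dvN (dv_comp dm (h Cx (- t))))); rewrite /F /= hc; ring.
- by apply: (dv_eq (dv_comp dm (h Cr (- t)))); rewrite /F /= hs; ring.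
apply: (dv_eq (dvB (dvC b t) (dv_comp dm (h Ct (- t))))).
by rewrite /F /= /curvature hc hs clampN ?ltW //; ring.
Qed.

End ClampedField.

(** * Shooting *)

Section Shooting.
Variables (R : realType) (lam : R) (p : nat) (rho d0 T : R).
Hypotheses (lam0 : 0 < lam) (p1 : (1 <= p)%N) (rho0 : 0 < rho) (rhod : rho < d0).
Hypotheses (d0E : d0 - p%:R / d0 = lam) (T0 : 2 / lam + 2 <= T).
Let K := d0 + T + 1.
Let F := @clamped_field R lam p%:R (rho / 2) K.
Variable Y : R -> coord -> R -> R.
Hypotheses (solY : forall d, ode_solution F (Y d)).
Hypotheses (Yx : forall d, Y d Cx 0 = 0) (Yr : forall d, Y d Cr 0 = d).
Hypothesis (Yt : forall d, Y d Ct 0 = 0).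
Let X d := Y d Cx.
Let Q d := Y d Cr.
Let Th d := Y d Ct.
Let W d t := F Ct (fun i => Y d i t).
(** [m] is positive as long as the arc is in its first phase or has not come
    back to the mirror line; unlike [X] it is also positive at time 0. *)
Let m d t := Num.max (X d t) (pi / 2 - Th d t).

Let Tgt0 : 2 < T.
Proof. by have : 0 < 2 / lam by [rewrite divr_gt0]; move: T0; lra. Qed.
Let d00 : 0 < d0. Proof. exact: lt_trans rhod. Qed.
Let c0 : (0 : R) <= p%:R. Proof. by []. Qed.
Let rho2 : 0 < rho / 2. Proof. by rewrite divr_gt0. Qed.
Let rhoK : rho / 2 <= K.
Proof. by have [[h1 h2] h3] := (rhod, Tgt0, rho0); rewrite /K; lra. Qed.

Let dX d (t : R) : is_derive t 1 (X d) (cos (Th d t)). Proof. exact: (solY d Cx t). Qed.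
Let dQ d (t : R) : is_derive t 1 (Q d) (sin (Th d t)). Proof. exact: (solY d Cr t). Qed.
Let dTh d (t : R) : is_derive t 1 (Th d) (W d t). Proof. exact: (solY d Ct t). Qed.

Lemma flow_dist : exists2 M, 0 < M & forall d d' t, 0 <= t <= T ->
  [/\ `|X d t - X d' t| <= M * `|d - d'|, `|Th d t - Th d' t| <= M * `|d - d'|,
      `|W d t - W d' t| <= M * `|d - d'| & `|m d t - m d' t| <= M * `|d - d'|].
Proof.
have [L L0 hL] := clamped_lipschitz lam c0 rho2 rhoK.
have hB := clamped_bounded lam0 c0 rho2 rhoK.
pose N := 2 * expR (2 * L * T).
have N0 : 0 < N by rewrite mulr_gt0 // expR_gt0.
have dist d d' t i : 0 <= t <= T -> `|Y d i t - Y d' i t| <= N * `|d - d'|.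
  move=> /andP[t0 tT].
  have h0 j : `|Y d j 0 - Y d' j 0| <= `|d - d'|.
    by case: j; rewrite ?Yx ?Yr ?Yt ?subrr ?normr0.
  apply: le_trans (ode_gronwall L0 hB hL (solY d) (solY d') h0 i t) _.
  rewrite /N mulrAC ler_wpM2r // ler_wpM2l // ler_expR ger0_norm //.
  by rewrite ler_wpM2l // mulr_ge0 // ltW.
exists (N + L * N) => [|d d' t tT]; first by rewrite addr_gt0 // mulr_gt0.
have a0 : 0 <= `|d - d'| := normr_ge0 _.
have e0 : 0 <= N * `|d - d'| by rewrite mulr_ge0 // ltW.
have e1 : 0 <= L * N * `|d - d'| by rewrite mulr_ge0 // mulr_ge0 // ltW.
have hw : `|W d t - W d' t| <= L * (N * `|d - d'|).
  by apply: hL => j; apply: dist.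
have hx := dist d d' t Cx tT; have ht := dist d d' t Ct tT.
rewrite mulrDl; split; [|  |by lra|apply: max_dist].
- by apply: le_trans hx _; rewrite lerDl.
- by apply: le_trans ht _; rewrite lerDl.
- by apply: le_trans hx _; rewrite lerDl.
have -> : pi / 2 - Th d t - (pi / 2 - Th d' t) = - (Th d t - Th d' t) by ring.
by rewrite normrN; apply: le_trans ht _; rewrite lerDl.
Qed.

Lemma cX d : continuous (X d). Proof. by move=> t; exact: (dv_continuous (dX d t)). Qed.
Lemma cTh d : continuous (Th d). Proof. by move=> t; exact: (dv_continuous (dTh d t)). Qed.
Lemma cW d : continuous (W d).
Proof.
have [L L0 hL] := clamped_lipschitz lam c0 rho2 rhoK.
have hB := clamped_bounded lam0 c0 rho2 rhoK.
pose C := 1 + lam + K + (K + p%:R / (rho / 2)).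
apply: (@lipschitz_continuous _ _ (L * C)) => s t; rewrite -mulrA.
apply: hL => i; wlog st : s t / t <= s.
  by move=> hw; case: (leP t s) => [/hw //|/ltW /hw]; rewrite distrC (distrC s).
rewrite (ger0_norm (_ : 0 <= s - t)) ?subr_ge0 // mulrBr.
apply: (@dv_dist _ _ (fun u => C * u) _ (fun=> C) _ _ st) => u _.
- exact: solY.
- by apply: (dv_eq (dvM (dvC C u) (dvI u))); ring.
- exact: hB.
Qed.
Lemma cm d : continuous (m d).
Proof.
move=> t; apply: continuous_max; first exact: cX.
by apply: continuousB; [exact: cst_continuous|exact: cTh].
Qed.

(** The arc crosses the mirror line before the half turn. *)
Definition returns d := exists s, [/\ 0 <= s <= T, m d s < 0 &
  forall t, 0 <= t <= s -> 0 < W d t /\ 0 < pi - Th d t].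

(** Before it is back at the mirror line the arc does something that no arc which
    returns can do. *)
Definition escapes d := exists s, [/\ 0 <= s <= T,
  [\/ 0 < Th d s - pi, 0 < - W d s | 0 < X d s - 2 / lam] &
  forall t, 0 <= t <= s -> 0 < m d t].

(** Both conditions are strict inequalities on a compact interval of time, and
    the flow is Lipschitz in the initial radius by [flow_dist]. *)
Lemma returns_open d : returns d ->
  exists2 eta, 0 < eta & forall d', `|d' - d| < eta -> returns d'.
Proof.
move=> [s [/andP[s0 sT] ms h]]; have [M M0 hM] := flow_dist.
have [||e1 e10 h1] := @persists _ W d s M s0 M0 _ (@cW d) _.
- by move=> d' t /andP[t0 ts]; case: (hM d d' t) => //; rewrite t0 (le_trans ts).
- by move=> t /h[].
have [|||e2 e20 h2] := @persists _ (fun d t => pi - Th d t) d s M s0 M0 _ _ _.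
- move=> d' t /andP[t0 ts]; case: (hM d d' t); rewrite ?t0 ?(le_trans ts) //.
  move=> _ ht _ _; have -> : pi - Th d t - (pi - Th d' t) = - (Th d t - Th d' t).
    by ring.
  by rewrite normrN.
- by move=> t; exact: (dv_continuous (dvB (dvC pi t) (dTh d t))).
- by move=> t /h[].
have e30 : 0 < - m d s / M by rewrite divr_gt0 // oppr_gt0.
exists (Num.min (Num.min e1 e2) (- m d s / M)) => [|d'].
  by rewrite !lt_min e10 e20.
rewrite !lt_min => /andP[/andP[d1 d2] d3]; exists s; split.
- by rewrite s0.
- case: (hM d d' s) => [|_ _ _]; first by rewrite s0.
  rewrite distrC (distrC d) => hm; rewrite ltr_pdivlMr // mulrC in d3.
  by have := le_lt_trans hm d3; rewrite ltr_norml => /andP[_]; lra.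
- by move=> t ts; split; [apply: h1|apply: h2].
Qed.

Lemma escapes_open d : escapes d ->
  exists2 eta, 0 < eta & forall d', `|d' - d| < eta -> escapes d'.
Proof.
move=> [s [/andP[s0 sT] hs h]]; have [M M0 hM] := flow_dist.
have [|e1 e10 h1] := @persists _ m d s M s0 M0 _ (@cm d) h.
  by move=> d' t /andP[t0 ts]; case: (hM d d' t) => //; rewrite t0 (le_trans ts).
have [e2 e20 h2] : exists2 e, 0 < e & forall d', `|d' - d| < e ->
    [\/ 0 < Th d' s - pi, 0 < - W d' s | 0 < X d' s - 2 / lam].
  have ss : 0 <= s <= T by rewrite s0.
  case: hs => hs.
  - exists ((Th d s - pi) / M) => [|d']; first by rewrite divr_gt0.
    rewrite ltr_pdivlMr // mulrC => hd; case: (hM d d' s ss) => _ ht _ _.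
    apply: Or31; rewrite distrC in hd; have := le_lt_trans ht hd.
    by rewrite ltr_norml => /andP[_]; lra.
  - exists (- W d s / M) => [|d']; first by rewrite divr_gt0.
    rewrite ltr_pdivlMr // mulrC => hd; case: (hM d d' s ss) => _ _ ht _.
    apply: Or32; rewrite distrC in hd; have := le_lt_trans ht hd.
    by rewrite ltr_norml => /andP[]; lra.
  - exists ((X d s - 2 / lam) / M) => [|d']; first by rewrite divr_gt0.
    rewrite ltr_pdivlMr // mulrC => hd; case: (hM d d' s ss) => ht _ _ _.
    apply: Or33; rewrite distrC in hd; have := le_lt_trans ht hd.
    by rewrite ltr_norml => /andP[_]; lra.
exists (Num.min e1 e2) => [|d']; first by rewrite lt_min e10.
rewrite lt_min => /andP[d1 d2]; exists s; split; [by rewrite s0|exact: h2|].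
exact: h1.
Qed.

(** The radius starts at [d >= rho] and increases, and the speed is 1: up to
    time [T] the curve does not reach the clamps. *)
Lemma unclamped d S : rho <= d -> d <= d0 -> 0 <= S <= T ->
  (forall t, 0 <= t <= S -> 0 <= Th d t <= pi) ->
  forall t, 0 <= t <= S -> [/\ d <= Q d t, Q d t <= d + t, `|X d t| <= t &
    W d t = curvature lam p%:R (X d t) (Q d t) (Th d t)].
Proof.
move=> rd dd /andP[S0 ST] hT t /andP[t0 tS].
have q1 : d <= Q d t.
  rewrite -{1}(Yr d : Q d 0 = d); apply: (@dv_le _ _ (fun t => sin (Th d t)) _ _ t0) => u.
    by move=> _; exact: dQ.
  by move=> /andP[u0 ut]; apply: sin_ge0_pi; apply: hT; rewrite u0 (le_trans ut).
have q2 : `|Q d t - Q d 0| <= t - 0.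
  apply: (@dv_dist _ _ (fun u => u) (fun t => sin (Th d t)) (fun=> 1)) => // u _.
  exact: sin_max.
have x1 : `|X d t - X d 0| <= t - 0.
  apply: (@dv_dist _ _ (fun u => u) (fun t => cos (Th d t)) (fun=> 1)) => // u _.
  exact: cos_max.
rewrite (Yr d : Q d 0 = d) in q2; rewrite (Yx d : X d 0 = 0) !subr0 in x1.
have q3 : Q d t <= d + t.
  by move: q2; rewrite subr0 ler_norml => /andP[_]; lra.
have tT : t <= T := le_trans tS ST.
have [r0' d0'] := (rho0, d00).
split=> //; rewrite /W /F /= !clamp_id //.
  by rewrite /K; apply/andP; split; rewrite -/(Q d t); lra.
by rewrite -ler_norml; apply: le_trans x1 _; rewrite /K; lra.
Qed.

Lemma flow_arc d S : rho <= d -> d <= d0 -> 0 <= S <= T ->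
  (forall t, 0 <= t <= S -> 0 <= W d t /\ Th d t <= pi) ->
  convex_arc lam p (X d) (Q d) (Th d) S /\ (forall t, 0 <= t <= S ->
    [/\ d <= Q d t, Q d t <= d + t, `|X d t| <= t &
      W d t = curvature lam p%:R (X d t) (Q d t) (Th d t)]).
Proof.
move=> rd dd ST h; have /andP[S0 _] := ST.
have hT t : 0 <= t <= S -> 0 <= Th d t <= pi.
  move=> tS; have [_ ->] := h t tS; rewrite andbT -(Yt d).
  have /andP[t0 tS'] := tS.
  apply: (@dv_le _ _ (W d) _ _ t0) => u; first by move=> _; exact: dTh.
  by move=> /andP[u0 ut]; case: (h u) => //; rewrite u0 (le_trans ut).
have hU := unclamped rd dd ST hT; split=> //; split=> //.
- move=> t tS; have [q1 q2 x1 wE] := hU t tS.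
  split; [|exact: dX|exact: dQ|by rewrite -wE; exact: dTh].
  by apply: lt_le_trans q1; apply: lt_le_trans rd.
- exact: Yx.
- exact: Yt.
by move=> t tS; have [q1 q2 x1 <-] := hU t tS; exact: h.
Qed.

(** The curve is a convex arc up to the time where it crosses the mirror line;
    having [x > 2 / lam] before is excluded by [no_return]. *)
Lemma returns_not_escapes d : rho <= d -> d <= d0 -> returns d -> escapes d -> False.
Proof.
move=> rd dd [s [/andP[s0 sT] ms hs]] [u [/andP[u0 uT] hu hm]].
case: (leP u s) => us; last first.
  by have := hm s; rewrite s0 ltW // => /(_ isT); lra.
have sT' : 0 <= s <= T by rewrite s0.
have hs' t : 0 <= t <= s -> 0 <= W d t /\ Th d t <= pi.
  by move=> /hs[h1 h2]; split; lra.
have [arc _] := flow_arc rd dd sT' hs'.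
have us' : 0 <= u <= s by rewrite u0.
have [wu tu] := hs u us'.
have xu : 2 / lam < X d u by case: hu => h; lra.
have : m d s < 0 := ms; rewrite /m gt_max => /andP[xs ts].
have H : 0 < X d s by apply: (no_return lam0 arc us' xu); lra.
by lra.
Qed.

Lemma flow_lip d (u v : R) :
  `|X d u - X d v| <= `|u - v| /\ `|Q d u - Q d v| <= `|u - v|.
Proof.
wlog uv : u v / v <= u.
  move=> h; case: (leP v u) => [/h //|/ltW /h].
  by rewrite distrC (distrC v) (distrC (Q d v)).
rewrite (ger0_norm (_ : 0 <= u - v)) ?subr_ge0 //; split.
  apply: (@dv_dist _ _ (fun u => u) (fun t => cos (Th d t)) (fun=> 1)) => // t _.
  exact: cos_max.
apply: (@dv_dist _ _ (fun u => u) (fun t => sin (Th d t)) (fun=> 1)) => // t _.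
exact: sin_max.
Qed.

(** An arc is followed up to the first time [S] at which the curvature, [m] or
    [pi - th] vanishes. *)
Section FirstExit.
Variables d S : R.
Hypotheses (rd : rho <= d) (dd : d <= d0) (S0 : 0 < S) (ST : S < T).
Hypothesis inside :
  forall t, 0 <= t < S -> [/\ 0 < W d t, 0 < m d t & 0 < pi - Th d t].
Hypotheses (WS_ge0 : 0 <= W d S) (mS_ge0 : 0 <= m d S) (tS_ge0 : 0 <= pi - Th d S).

Let ThS_le : Th d S <= pi. Proof. by rewrite -subr_ge0. Qed.

Let pihalf_lt : pi / 2 < pi :> R.
Proof. by rewrite ltr_pdivrMr // ltr_pMr ?pi_gt0 // ltr1n. Qed.

Let SS : 0 <= S <= S. Proof. by rewrite lexx ltW. Qed.

Let flow : convex_arc lam p (X d) (Q d) (Th d) S /\ (forall t, 0 <= t <= S ->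
    [/\ d <= Q d t, Q d t <= d + t, `|X d t| <= t &
      W d t = curvature lam p%:R (X d t) (Q d t) (Th d t)]).
Proof.
apply: flow_arc => // [|t /andP[t0]]; first by rewrite !ltW.
rewrite le_eqVlt => /orP[/eqP->//|tS].
by have [|h1 _] := inside (t := t); rewrite ?t0 // subr_gt0 => h3; rewrite !ltW.
Qed.

Let arc := proj1 flow.
Let hU := proj2 flow.

Let m_persists : 0 < m d S -> exists2 e, 0 < e & S + e <= T /\
  (forall t, 0 <= t <= S + e -> 0 < m d t).
Proof.
move=> mS; have [e1 e10 he1] := continuous_gt0 (@cm d S) mS.
have h1 : Num.min (e1 / 2) (T - S) <= e1 / 2 by rewrite ge_min lexx.
have h2 : Num.min (e1 / 2) (T - S) <= T - S by rewrite ge_min lexx orbT.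
exists (Num.min (e1 / 2) (T - S)); first by rewrite lt_min divr_gt0 //= subr_gt0.
split; first by rewrite -lerBrDl.
move=> t /andP[t0 te]; case: (ltP t S) => tS.
  by have [|] := inside (t := t); rewrite ?t0.
apply: he1; rewrite ger0_norm ?subr_ge0 // ltrBlDl (le_lt_trans te) // ltrD2l.
by rewrite (le_lt_trans h1) // ltr_pdivrMr // ltr_pMr // ltr1n.
Qed.

Let Th_incr s t : 0 <= s -> s < t -> t <= S -> Th d s < Th d t.
Proof.
move=> s0 st tS; apply: (@dv_lt _ _ (W d) _ _ st) => u; first by move=> _; exact: dTh.
move=> /andP[su ut]; have [|//] := inside (t := u).
by rewrite (le_trans s0 (ltW su)) (lt_le_trans ut).
Qed.

Let ThS_gt0 : 0 < Th d S.
Proof. by rewrite -[ltLHS](Yt d); exact: Th_incr. Qed.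

(** By [w_gt0_phase2] the curvature can only vanish before the quarter turn,
    and there its derivative is negative: it becomes negative at once. *)
Lemma exit_flat : W d S = 0 -> Th d S < pi / 2 /\ escapes d.
Proof.
move=> W0; have hS : Th d S < pi / 2.
  rewrite ltNge; apply/negP => hS.
  have [a aS ha] := turning_time arc hS; have /andP[a0 aS'] := aS.
  have Wa : 0 < W d a.
    case: (ltP a S) => as_; first by have [|] := inside (t := a); rewrite ?a0.
    have [_ _ _ ->] := hU aS.
    rewrite /curvature -/(Th d a) [Th d a]ha sin_pihalf cos_pihalf mulr0 subr0 mulr1.
    apply: (ltr_wpDr _ lam0); rewrite -[leLHS](Yx d).
    apply: (x_ndecr (convex_arc_sub arc aS) a0 (lexx a)) => //.
    by rewrite [Th d a]ha.
  have ha' : pi / 2 <= Th d a by rewrite [Th d a]ha.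
  have := w_gt0_phase2 p1 arc aS ha'.
  have [_ _ _ <-] := hU aS; have [_ _ _ <-] := hU SS.
  by rewrite -/(W d S) W0 ltxx => /(_ Wa).
split=> //; have pi0 := pi_gt0 R.
have mS : 0 < m d S by rewrite /m lt_max subr_gt0 hS orbT.
have dWS : is_derive S 1 (W d) (- (p%:R * sin (Th d S) * cos (Th d S) / Q d S ^+ 2)).
  have [q1 q2 x1 wE] := hU SS.
  have := dw arc SS; rewrite -wE W0 mul0r sub0r; apply: near_eq_is_derive.
  apply/nbhs_normP; exists (Num.min (rho / 2) 1); first by rewrite /= lt_min ltr01 rho2.
  move=> u; rewrite /ball_ /= lt_min => /andP[u1 u2].
  (* the clamps are inactive near time S *)
  have [l1 l2] := flow_lip d S u.
  have l3 := le_lt_trans l2 u1; have l4 := le_lt_trans l1 u2.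
  have l5 := le_lt_trans l2 u2.
  move: x1 l3 l4 l5; rewrite !ltr_norml ler_norml.
  move=> /andP[? ?] /andP[? ?] /andP[? ?] /andP[? ?].
  have [[r0 d0'] [[rd' dd'] ST']] := ((rho0, d00), ((rd, dd), ST)).
  have kx : - K <= X d u <= K by rewrite /K; apply/andP; split; lra.
  have kr : rho / 2 <= Q d u <= K by rewrite /K; apply/andP; split; lra.
  by rewrite /W /F /= (clamp_id kx) (clamp_id kr).
have [e' e0' [eT he']] := m_persists mS.
have neg : - (p%:R * sin (Th d S) * cos (Th d S) / Q d S ^+ 2) < 0.
  have [q1 _ _ _] := hU SS.
  rewrite oppr_lt0 divr_gt0 ?exprn_gt0 //; last first.
    by apply: lt_le_trans q1; apply: lt_le_trans rd.
  rewrite mulr_gt0 // ?mulr_gt0 ?ltr0n //; last first.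
    by apply: cos_gt0_phase1; rewrite ltW.
  by apply: sin_gt0_pi; rewrite ThS_gt0 /=; apply: lt_trans hS _; exact: pihalf_lt.
have [t /andP[St te] Wt] := decreases_right dWS neg e0'.
exists t; split.
- by rewrite (le_trans (ltW S0) (ltW St)) (le_trans (ltW te)).
- by apply: Or32; rewrite W0 in Wt; rewrite oppr_gt0.
- by move=> u /andP[u0 ut]; apply: he'; rewrite u0 (le_trans ut) ?ltW.
Qed.

(** The mirror line is crossed with nonzero velocity, since the angle lies strictly
    between a quarter turn and a half turn. *)
Lemma exit_mirror : 0 < W d S -> m d S = 0 -> Th d S < pi -> returns d.
Proof.
move=> WS mS hT; have pi0 := pi_gt0 R.
have hS : pi / 2 <= Th d S.
  by rewrite -subr_le0 -mS le_max lexx orbT.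
have XmS : X d S <= 0 by rewrite -mS le_max lexx.
have [a aS ha] := turning_time arc hS; have /andP[a0 aS'] := aS.
have a0' : 0 < a.
  rewrite lt_neqAle a0 andbT; apply/eqP => ea; move: ha.
  by rewrite -ea [Th d 0](Yt d) => /eqP; rewrite lt_eqF // divr_gt0.
have Xa : 0 < X d a.
  rewrite -[ltLHS](Yx d).
  apply: (@dv_lt _ _ (fun t => cos (Th d t)) _ _ a0') => t; first by move=> _; exact: dX.
  move=> /andP[t0 ta]; apply: cos_gt0_phase1; rewrite (th_ge0 arc) ?ltW //=; last first.
    by apply: lt_le_trans aS'.
  by rewrite -[pi / 2]ha; apply: Th_incr; rewrite // ltW.
have aS2 : a < S.
  rewrite lt_neqAle aS' andbT; apply/eqP => ea.
  by move: Xa; rewrite ea ltNge XmS.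
have hS' : pi / 2 < Th d S by rewrite -[pi / 2]ha; apply: Th_incr.
have cS : cos (Th d S) < 0 by apply: cos_lt0_phase2; rewrite hS' ltW.
have [e1 e10 h1] := continuous_gt0 (@cW d S) WS.
have [||e2 e20 h2] := @continuous_gt0 _ (fun t => pi - Th d t) S.
- exact: (dv_continuous (dvB (dvC pi S) (dTh d S))).
- by rewrite subr_gt0.
have [||e3 e30 h3] := @continuous_gt0 _ (fun t => Th d t - pi / 2) S.
- exact: (dv_continuous (dvB (dTh d S) (dvC (pi / 2) S))).
- by rewrite subr_gt0.
pose e := Num.min (Num.min e1 e2) (Num.min e3 (T - S)).
have ep : 0 < e by rewrite !lt_min e10 e20 e30 subr_gt0 ST.
have [ee1 ee2 ee3 ee4] : [/\ e <= e1, e <= e2, e <= e3 & e <= T - S].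
  by rewrite /e; split; rewrite !ge_min lexx ?orbT.
have [t /andP[St te] Xt] := decreases_right (dX d S) cS ep.
have near_S u : S <= u <= t -> `|u - S| < e.
  move=> /andP[Su ut]; rewrite ger0_norm ?subr_ge0 // ltrBlDl.
  exact: le_lt_trans te.
exists t; split.
- by rewrite (le_trans (ltW S0) (ltW St)) (le_trans (ltW te)) // -lerBrDl.
- rewrite /m gt_max (lt_le_trans Xt XmS) /= subr_lt0 -subr_gt0.
  by apply: h3; apply: lt_le_trans ee3; apply: near_S; rewrite lexx ltW.
- move=> u /andP[u0 ut]; case: (ltP u S) => uS.
    by have [|] := inside (t := u); rewrite ?u0.
  have Sut : S <= u <= t by rewrite uS.
  split; [apply: h1|apply: h2]; apply: lt_le_trans (near_S u Sut) _ => //.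
Qed.

(** The angle passes the half turn with positive velocity. *)
Lemma exit_turned : 0 < W d S -> 0 < m d S -> Th d S = pi -> escapes d.
Proof.
move=> WS mS hT; have [e' e0' [eT he']] := m_persists mS.
have dN : is_derive S 1 (fun t => - Th d t) (- W d S) by exact: (dvN (dTh d S)).
have neg : - W d S < 0 by rewrite oppr_lt0.
have [t /andP[St te] Wt] := decreases_right dN neg e0'.
exists t; split.
- by rewrite (le_trans (ltW S0) (ltW St)) (le_trans (ltW te)).
- by apply: Or31; rewrite subr_gt0 -hT -ltrN2.
- by move=> u /andP[u0 ut]; apply: he'; rewrite u0 (le_trans ut) ?ltW.
Qed.

(** Of the ways in which an arc can stop being strictly convex with [m] positive
    only the last one, where it meets the mirror line at right angles, is
    compatible with neither returning nor escaping. *)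
Lemma first_exit : Num.min (Num.min (W d S) (m d S)) (pi - Th d S) = 0 ->
  [\/ returns d, W d S = 0 /\ Th d S < pi / 2 /\ escapes d,
      Th d S = pi /\ escapes d |
      X d S = 0 /\ Th d S = pi].
Proof.
move=> e0; have [W0|WN] := eqVneq (W d S) 0.
  by apply: Or42; split=> //; exact: exit_flat.
have WS : 0 < W d S by rewrite lt_neqAle eq_sym WN.
have [mS|mN] := eqVneq (m d S) 0; last first.
  have mS : 0 < m d S by rewrite lt_neqAle eq_sym mN.
  have hT : Th d S = pi.
    apply/eqP; rewrite eq_le ThS_le leNgt; apply/negP => hT.
    have : 0 < Num.min (Num.min (W d S) (m d S)) (pi - Th d S).
      by rewrite !lt_min WS mS subr_gt0.
    by rewrite e0 ltxx.
  by apply: Or43; split=> //; exact: exit_turned.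
move: ThS_le; rewrite le_eqVlt => /orP[/eqP hT|hT].
  apply: Or44; split=> //; have := mS; rewrite /m hT /Num.max.
  by case: ifP => // _ /eqP; rewrite lt_eqF // subr_lt0 pihalf_lt.
by apply: Or41; exact: exit_mirror.
Qed.

End FirstExit.

Lemma initial_curvature d : rho <= d -> d < d0 -> 0 < W d 0.
Proof.
move=> rd dd; rewrite /W /F /= /curvature Yx Yr Yt sin0 cos0 mulr0 mulr1 addr0.
have [[r0 T2] d0'] := (rho0, Tgt0, d00).
rewrite clamp_id; last by rewrite /K; apply/andP; split; lra.
have dp : 0 < d by lra.
rewrite subr_gt0 -d0E; apply: ltr_leB => //.
by rewrite ler_wpM2l // lef_pV2 ?posrE // ltW.
Qed.

Lemma exit_dichotomy d : rho <= d -> d < d0 ->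
  (forall t, 0 <= t <= T -> [/\ 0 < W d t, 0 < m d t & 0 < pi - Th d t]) \/
  exists S, [/\ 0 < S, S <= T,
    Num.min (Num.min (W d S) (m d S)) (pi - Th d S) = 0 &
    forall t, 0 <= t < S -> [/\ 0 < W d t, 0 < m d t & 0 < pi - Th d t]].
Proof.
move=> rd dd.
pose f t := Num.min (Num.min (W d t) (m d t)) (pi - Th d t).
have fE t : (0 < f t) -> [/\ 0 < W d t, 0 < m d t & 0 < pi - Th d t].
  by rewrite !lt_min => /andP[/andP[]].
have cf : continuous f.
  move=> t; apply: (continuous_min (continuous_min (@cW d t) (@cm d t))).
  exact: (dv_continuous (dvB (dvC pi t) (dTh d t))).
have f0 : 0 < f 0.
  have pi0 := pi_gt0 R.
  rewrite !lt_min initial_curvature //= subr_gt0 [Th d 0](Yt d) pi0 andbT.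
  by rewrite lt_max [Th d 0](Yt d) subr0 divr_gt0 ?orbT.
have T0' : 0 <= T by have := Tgt0; lra.
have [h|[S [S0 ST e h]]] := first_zero T0' cf f0.
  by left=> t /h /fE.
by right; exists S; split=> // t /h /fE.
Qed.

Lemma exit_arc d S : rho <= d -> d < d0 -> 0 < S -> S <= T ->
  (forall t, 0 <= t < S -> [/\ 0 < W d t, 0 < m d t & 0 < pi - Th d t]) ->
  0 <= W d S -> 0 <= m d S -> 0 <= pi - Th d S ->
  convex_arc lam p (X d) (Q d) (Th d) S /\
  (forall t, 0 <= t <= S -> pi / 2 <= Th d t -> 0 <= X d t).
Proof.
move=> rd dd S0 ST h hW hm hT.
have ST' : 0 <= S <= T by rewrite ltW.
have h' t : 0 <= t <= S -> 0 <= W d t /\ Th d t <= pi.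
  move=> /andP[t0]; rewrite le_eqVlt => /orP[/eqP->|tS]; first by split; lra.
  by have [|h1 h2 h3] := h t; [rewrite t0|split; lra].
have [arc hU] := flow_arc rd (ltW dd) ST' h'; split=> // t tS ht.
case: (leP (Th d t) (pi / 2)) => ht'.
  rewrite -[leLHS](Yx d); have /andP[t0 tS'] := tS.
  exact: (x_ndecr (convex_arc_sub arc tS) t0 (lexx t)).
have : 0 <= m d t.
  have /andP[t0] := tS; rewrite le_eqVlt => /orP[/eqP->//|tS'].
  by have [|_ h2 _] := h t; [rewrite t0|rewrite ltW].
by rewrite le_max => /orP[//|]; lra.
Qed.

(** The estimates of [small_neck] exclude every other way to exit. *)
Lemma small_returns Ts : Ts < T ->
  (forall (x r th : R -> R) (S : R), convex_arc lam p x r th S -> r 0 = rho ->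
    (forall t, 0 <= t <= S -> pi / 2 <= th t -> 0 <= x t) ->
    [/\ S <= Ts, th S < pi &
        th S <= pi / 2 -> 0 < curvature lam p%:R (x S) (r S) (th S)]) ->
  returns rho.
Proof.
move=> TsT small; have T2 := Tgt0.
have [h|[S [S0 ST e h]]] := exit_dichotomy (lexx rho) rhod.
  have [//|||||arc xp] := @exit_arc rho T (lexx _) rhod _ (lexx _).
  - lra.
  - by move=> t /andP[t0 tT]; apply: h; rewrite t0 ltW.
  - by have [|/ltW//] := h T; rewrite lexx andbT; lra.
  - by have [|_ /ltW//] := h T; rewrite lexx andbT; lra.
  - by have [|_ _ /ltW//] := h T; rewrite lexx andbT; lra.
  by have [] := small _ _ _ _ arc (Yr rho) xp; lra.
have [e1 e2 e3] : [/\ 0 <= W rho S, 0 <= m rho S & 0 <= pi - Th rho S].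
  by rewrite -e; split; rewrite !ge_min lexx ?orbT.
have [arc xp] := exit_arc (lexx rho) rhod S0 ST h e1 e2 e3.
have [STs hpi hk] := small _ _ _ _ arc (Yr rho) xp.
have ST' : S < T by lra.
have [//|[W0 [hS _]]|[hS _]|[_ hS]] := first_exit (lexx rho) (ltW rhod) S0 ST' h e1 e2 e3 e.
- have SS : 0 <= S <= S by rewrite lexx ltW.
  have hT t : 0 <= t <= S -> 0 <= Th rho t <= pi.
    move=> tS; rewrite (th_ge0 arc tS) /=; case: arc => _ _ _ _ k.
    by case: (k t tS).
  have ST2 : 0 <= S <= T by rewrite ltW.
  have [_ _ _ wE] := unclamped (lexx rho) (ltW rhod) ST2 hT SS.
  by have := hk (ltW hS); rewrite -wE W0 ltxx.
- by move: hpi; rewrite hS ltxx.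
- by move: hpi; rewrite hS ltxx.
Qed.

(** The line [r = d0] is a solution, the profile of a cylinder. Neighbouring
    solutions follow it beyond [x = 2 / lam]. *)
Lemma cylinder_escapes : exists d, [/\ rho <= d, d < d0 & escapes d].
Proof.
have [L L0 hL] := clamped_lipschitz lam c0 rho2 rhoK.
have hB := clamped_bounded lam0 c0 rho2 rhoK.
have [[r0 T2] d0'] := (rho0, Tgt0, d00).
have rd := rhod.
pose C i (t : R) : R := match i with Cx => t | Cr => d0 | Ct => 0 end.
have solC : ode_solution F C.
  case=> t.
  - by apply: (dv_eq (dvI t)); rewrite /F /= cos0.
  - by apply: (dv_eq (dvC d0 t)); rewrite /F /= sin0.
  apply: (dv_eq (dvC 0 t)); rewrite /F /= /curvature sin0 cos0 mulr0 addr0 mulr1.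
  by rewrite clamp_id ?d0E ?subrr // /K; apply/andP; split; lra.
pose N := 2 * expR (2 * L * T).
have N0 : 0 < N by rewrite mulr_gt0 // expR_gt0.
(* Close enough to [d0] for the two solutions to stay within [1 / 2] of each
   other up to time [T]. *)
pose d := Num.max rho (d0 - 1 / (2 * N)).
have Ni : 0 < 1 / (2 * N) by rewrite divr_gt0 // mulr_gt0.
have dd : d < d0 by rewrite gt_max rd ltrBlDr ltrDl.
have rd' : rho <= d by rewrite le_max lexx.
have hN : N * (d0 - d) <= 1 / 2.
  have : d0 - d <= 1 / (2 * N).
    by rewrite lerBlDr -lerBlDl le_max lexx orbT.
  rewrite -(ler_pM2l N0) => h; apply: le_trans h _; rewrite le_eqVlt.
  by apply/orP; left; apply/eqP; field; rewrite gt_eqF.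
have dist t i : 0 <= t <= T -> `|Y d i t - C i t| <= 1 / 2.
  move=> /andP[t0 tT].
  have h0 j : `|Y d j 0 - C j 0| <= d0 - d.
    case: j; rewrite /= ?Yx ?Yr ?Yt ?subrr ?normr0; [lra| |lra].
    by rewrite distrC ger0_norm //; lra.
  apply: le_trans (ode_gronwall L0 hB hL (solY d) solC h0 i t) _.
  apply: le_trans hN; rewrite /N mulrAC ler_wpM2r //; first by lra.
  rewrite ler_wpM2l // ler_expR ger0_norm //.
  by rewrite ler_wpM2l // mulr_ge0 // ltW.
exists d; split=> //; exists (2 / lam + 1).
have l2 : 0 < 2 / lam by rewrite divr_gt0.
have TT := T0.
split.
- by apply/andP; split; lra.
- apply: Or33; have hT : 0 <= 2 / lam + 1 <= T by apply/andP; split; lra.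
  have := dist _ Cx hT.
  by rewrite ler_norml /= -/(X d _) => /andP[]; lra.
- move=> t /andP[t0 tT]; rewrite lt_max; apply/orP; right.
  have hT : 0 <= t <= T by apply/andP; split; lra.
  have := dist t Ct hT; rewrite ler_norml /= -/(Th d _) => /andP[_].
  by have := @pihalf_ge1 R; lra.
Qed.

(** The supremum of the initial radii that return neither returns nor escapes,
    since both conditions are open and exclude each other. By [first_exit] its
    arc ends at right angles to the mirror line, provided that it ends before
    time [T]: this is what the a priori bound [Tb] is for. *)
Lemma closing Ts Tb : Ts < T -> Tb < T ->
  (forall (x r th : R -> R) (S : R), convex_arc lam p x r th S -> r 0 = rho ->
    (forall t, 0 <= t <= S -> pi / 2 <= th t -> 0 <= x t) ->
    [/\ S <= Ts, th S < pi &
        th S <= pi / 2 -> 0 < curvature lam p%:R (x S) (r S) (th S)]) ->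
  (forall (x r th : R -> R) (S : R),
    convex_arc lam p x r th S -> r 0 <= d0 ->
    (forall t, 0 <= t <= S -> x t <= 2 / lam) ->
    (forall t, 0 <= t <= S -> pi / 2 <= th t -> 0 <= x t) -> S <= Tb) ->
  exists d S, [/\ rho <= d, d < d0, 0 < S & S <= T] /\
    [/\ X d S = 0, Th d S = pi &
      forall t, 0 <= t < S -> [/\ 0 < W d t, 0 < m d t & 0 < pi - Th d t]].
Proof.
move=> TsT TbT small bound.
have Arho := small_returns TsT small.
have [d1 [rd1 d1d0 Bd1]] := cylinder_escapes.
have nA1 : ~ returns d1.
  by move=> A1; exact: (returns_not_escapes rd1 (ltW d1d0) A1 Bd1).
pose E := [set d | rho <= d <= d1 /\ returns d].
have Erho : E rho by rewrite /E /= lexx.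
have hE : has_sup E by split; [exists rho|exists d1 => d [/andP[]]].
pose ds := sup E.
have ub d : E d -> d <= ds by move=> Ed; apply: ub_le_sup => //; exact: (proj2 hE).
have rds : rho <= ds by apply: ub.
have dsd1 : ds <= d1 by apply: ge_sup; [exists rho|move=> d [/andP[]]].
have dsd0 : ds < d0 by apply: le_lt_trans d1d0.
have nA : ~ returns ds.
  move=> A; have dlt : ds < d1.
    rewrite lt_neqAle dsd1 andbT; apply/eqP => e.
    by apply: nA1; rewrite -e.
  have [eta eta0 he] := returns_open A.
  pose d' := Num.min d1 (ds + eta / 2).
  have h1 : ds < d' by rewrite lt_min dlt ltrDl divr_gt0.
  have h2 : d' <= ds + eta / 2 by rewrite ge_min lexx orbT.
  have : d' <= ds.
    apply: ub; split; first by rewrite ge_min lexx /= andbT (le_trans rds) // ltW.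
    by apply: he; rewrite ger0_norm ?subr_ge0 ?ltW //; lra.
  by rewrite leNgt h1.
have nB : ~ escapes ds.
  move=> B; have [eta eta0 he] := escapes_open B.
  have [d Ed dl] := sup_adherent eta0 hE; have dle := ub _ Ed.
  have [/andP[rd dd1] Ad] := Ed.
  have ddd : d <= d0 by lra.
  apply: (returns_not_escapes rd ddd Ad); apply: he.
  by rewrite distrC ger0_norm ?subr_ge0 //; move: dl; rewrite -/ds; lra.
(* Going beyond [2 / lam] would be an escape. *)
have xb S : S <= T -> (forall t, 0 <= t < S -> 0 < m ds t) ->
    forall t, 0 <= t < S -> X ds t <= 2 / lam.
  move=> ST hm t /andP[t0 tS]; rewrite leNgt; apply/negP => h; apply: nB.
  exists t; split; [by apply/andP; split; lra|by apply: Or33; lra|].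
  by move=> u /andP[u0 ut]; apply: hm; rewrite u0 (le_lt_trans ut).
have T2 := Tgt0.
have bnd S : 0 < S -> S <= T ->
    (forall t, 0 <= t < S -> [/\ 0 < W ds t, 0 < m ds t & 0 < pi - Th ds t]) ->
    0 <= W ds S -> 0 <= m ds S -> 0 <= pi - Th ds S -> S <= Tb.
  move=> S0 ST h h1 h2 h3.
  have [arc xp] := exit_arc rds dsd0 S0 ST h h1 h2 h3.
  apply: (bound _ _ _ _ arc) => //; first by rewrite [Q ds 0](Yr ds) ltW.
  move=> t /andP[t0]; rewrite le_eqVlt => /orP[/eqP->|tS]; last first.
    by apply: (xb S) => //; [by move=> u /h[]|by rewrite t0].
  rewrite leNgt; apply/negP => hX.
  have [||e e0 he] := @continuous_gt0 _ (fun t => X ds t - 2 / lam) S.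
  - exact: (dv_continuous (dvB (dX ds S) (dvC (2 / lam) S))).
  - by rewrite subr_gt0.
  pose u := S - Num.min (e / 2) (S / 2).
  have k1 : Num.min (e / 2) (S / 2) <= e / 2 by rewrite ge_min lexx.
  have k2 : Num.min (e / 2) (S / 2) <= S / 2 by rewrite ge_min lexx orbT.
  have k3 : 0 < Num.min (e / 2) (S / 2) by rewrite lt_min !divr_gt0.
  have uS : 0 <= u < S by apply/andP; rewrite /u; split; lra.
  have : X ds u <= 2 / lam by apply: (xb S) => // v /h[].
  have : 0 < X ds u - 2 / lam by apply: he; rewrite /u ler0_norm; lra.
  by lra.
have [h|[S [S0 ST e h]]] := exit_dichotomy rds dsd0.
  have [|h1 h2 h3] := h T; first by rewrite lexx andbT; lra.
  suff : T <= Tb by lra.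
  have T00 : 0 < T by lra.
  apply: (bnd T T00 (lexx T) _ (ltW h1) (ltW h2) (ltW h3)).
  by move=> t /andP[t0 tT]; apply: h; rewrite t0 ltW.
have [e1 e2 e3] : [/\ 0 <= W ds S, 0 <= m ds S & 0 <= pi - Th ds S].
  by rewrite -e; split; rewrite !ge_min lexx ?orbT.
have STb := bnd S S0 ST h e1 e2 e3.
have ST' : S < T by lra.
have [//|[_ [_ //]]|[_ //]|[X0 hS]] := first_exit rds (ltW dsd0) S0 ST' h e1 e2 e3 e.
by exists ds, S.
Qed.

End Shooting.

(** * The closed profile curve *)

Section Periodic.
Variable R : realType.

Lemma periodic_int (T : Type) (f : R -> T) (l : R) :
  (forall t, f (t + l) = f t) -> forall (k : int) t, f (t + l * k%:~R) = f t.
Proof.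
move=> h k t; case: (intP k) => [|n|n].
- by rewrite mulr0 addr0.
- elim: (n.+1) => [|m ih]; first by rewrite mulr0 addr0.
  by rewrite -[m.+1]addn1 PoszD intrD mulrDr mulr1 addrA h.
rewrite intrN mulrN; elim: (n.+1) => [|m ih]; first by rewrite mulr0 subr0.
by rewrite -ih -[LHS]h; congr (f _); rewrite -[m.+1]addn1 PoszD intrD; ring.
Qed.

Lemma reduce_period (l t : R) : 0 < l ->
  exists k : int, 0 <= t + l * k%:~R < l.
Proof.
move=> l0; exists (- Num.floor (t / l)).
have /andP[h1 h2] := real_floor_itv (num_real (t / l)).
rewrite intrN mulrN subr_ge0; apply/andP; split.
  by rewrite mulrC -ler_pdivlMr.
move: h2; rewrite intrD ltr_pdivrMr //; move: (_%:~R) => z; lra.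
Qed.

End Periodic.

Section ClosedProfile.
Variables (R : realType) (lam : R) (p : nat).
Hypotheses (lam0 : 0 < lam) (p1 : (1 <= p)%N).

(** The arc of [closing] runs from the mirror line to the mirror line, meeting it
    at right angles at both ends. By uniqueness of solutions the curve is
    invariant under the reflections at time 0 and at time [l], whose composition
    is the translation of time by [2 * l]. *)
Theorem closed_profile : exists (x r th : R -> R) (l : R),
  [/\ 0 < l, forall t, profile_at lam p%:R x r th t,
      forall t, [/\ x (- t) = - x t, r (- t) = r t & th (- t) = - th t],
      forall t, [/\ x (t + 2 * l) = x t, r (t + 2 * l) = r t &
                    th (t + 2 * l) = th t + pi *+ 2] &
      forall t, 0 < t < l -> 0 < x t /\ 0 < th t < pi].
Proof.
have pi0 := pi_gt0 R.
have l0 : 0 < lam := lam0.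
have p0 : (0 : R) < p%:R by rewrite ltr0n.
pose q := Num.sqrt (lam ^+ 2 + 4 * p%:R).
have q2 : q ^+ 2 = lam ^+ 2 + 4 * p%:R.
  by rewrite sqr_sqrtr // addr_ge0 ?sqr_ge0 ?mulr_ge0 // ltW.
have q0 : 0 <= q := sqrtr_ge0 _.
pose d0 := (lam + q) / 2.
have d00 : lam / 2 < d0.
  have : 0 < q by rewrite lt_neqAle q0 andbT; apply/eqP => e; move: q2; rewrite -e; nra.
  by rewrite /d0; lra.
have d0p : 0 < d0 by lra.
have d0E : d0 - p%:R / d0 = lam.
  have e : d0 * d0 - p%:R = lam * d0 by rewrite /d0; nra.
  have -> : d0 - p%:R / d0 = (d0 * d0 - p%:R) / d0 by field; rewrite gt_eqF.
  by rewrite e mulfK // gt_eqF.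
have [rho [Ts [rho0 rhol small]]] := small_neck lam0 p1.
have [Tb bound] := time_bound lam0 p1 d0 (2 / lam).
have rhod : rho < d0 by lra.
pose T := Num.max (2 / lam + 2) (Num.max Ts Tb + 1).
have T0 : 2 / lam + 2 <= T by rewrite le_max lexx.
have T1 : Num.max Ts Tb + 1 <= T by rewrite le_max lexx orbT.
have TsT : Ts < T by have : Ts <= Num.max Ts Tb; [rewrite le_max lexx|lra].
have TbT : Tb < T by have : Tb <= Num.max Ts Tb; [rewrite le_max lexx orbT|lra].
have T2 : 2 < T by have : 0 < 2 / lam; [rewrite divr_gt0|lra].
pose K := d0 + T + 1.
have rhoK : rho / 2 <= K by rewrite /K; lra.
have rho2 : 0 < rho / 2 by rewrite divr_gt0.
have K0 : 0 <= K by rewrite /K; lra.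
pose F := @clamped_field R lam p%:R (rho / 2) K.
have [L L0 hL] := clamped_lipschitz lam (ltW p0) rho2 rhoK.
have hB := clamped_bounded lam0 (ltW p0) rho2 rhoK.
pose init (d : R) (i : coord) : R := if i is Cr then d else 0.
have /choice[Y hY] : forall d : R, exists Y : coord -> R -> R,
    ode_solution F Y /\ (forall i, Y i 0 = init d i).
  by move=> d; have [Y h1 h2] := ode_exists L0 hB hL (init d); exists Y.
have solY d : ode_solution F (Y d) := (hY d).1.
have [d [l [[rd dd lp lT] [Xl Thl h]]]] := closing lam0 p1 rho0 rhod d0E T0 solY
  (fun d => (hY d).2 Cx) (fun d => (hY d).2 Cr) (fun d => (hY d).2 Ct) TsT TbT
  small bound.
pose x := Y d Cx; pose r := Y d Cr; pose th := Y d Ct.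
have x0 : x 0 = 0 := (hY d).2 Cx.
have r0 : r 0 = d := (hY d).2 Cr.
have th0 : th 0 = 0 := (hY d).2 Ct.
have dx (t : R) : is_derive t 1 x (cos (th t)) := solY d Cx t.
have dr (t : R) : is_derive t 1 r (sin (th t)) := solY d Cr t.
pose w t := F Ct (fun i => Y d i t).
have dth (t : R) : is_derive t 1 th (w t) := solY d Ct t.
have c1 (a : R) : cos (0 - a) = cos a by rewrite sub0r cosN.
have s1 (a : R) : sin (0 - a) = - sin a by rewrite sub0r sinN.
have sym0 i t : Y d i t = mirror 0 (Y d) i t.
  apply: (ode_unique L0 hB hL (solY d) (clamped_mirror rho2 rhoK c1 s1 (solY d))).
  case=> /=; rewrite oppr0 //.
    by rewrite [Y d Cx 0]x0 oppr0.
  by rewrite [Y d Ct 0]th0 subr0.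
have c2 (a : R) : cos (pi *+ 2 - a) = cos a.
  by rewrite addrC cosD2pi cosN.
have sn2 (a : R) : sin (pi *+ 2 - a) = - sin a.
  by rewrite addrC sinD2pi sinN.
have syml i t : Y d i (t + l) = mirror (pi *+ 2) (fun i t => Y d i (t + l)) i t.
  have sol2 := clamped_shift l (solY d).
  apply: (ode_unique L0 hB hL sol2 (clamped_mirror rho2 rhoK c2 sn2 sol2)).
  case=> /=; rewrite oppr0 add0r //; first by rewrite [Y d Cx l]Xl oppr0.
  by rewrite [Y d Ct l]Thl mulr2n addrK.
have odd t : [/\ x (- t) = - x t, r (- t) = r t & th (- t) = - th t].
  split; first by rewrite /x (sym0 Cx) /= opprK.
    by rewrite /r (sym0 Cr) /= opprK.
  by rewrite /th (sym0 Ct) /= opprK sub0r.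
have per t : [/\ x (t + 2 * l) = x t, r (t + 2 * l) = r t &
    th (t + 2 * l) = th t + pi *+ 2].
  have [u1 u2 u3] := odd t.
  have e1 : t + 2 * l = t + l + l by ring.
  have e2 : - (t + l) + l = - t by ring.
  rewrite /x /r /th e1 !syml /= e2 -/x -/r -/th; split.
  - by rewrite -[LHS]/(- x (- t)) u1 opprK.
  - by rewrite -[LHS]/(r (- t)) u2.
  - by rewrite u3 opprK addrC.
have pos t : 0 < t < l -> 0 < x t /\ 0 < th t < pi.
  move=> /andP[t0 tl]; have [|h1 h2 h3] := h t; first by rewrite ltW.
  have tht : 0 < th t.
    rewrite -th0; apply: (@dv_lt _ th w _ _ t0) => u.
    by move=> /andP[u0 ut]; have [|//] := h u; rewrite (ltW u0) (lt_trans ut).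
  split; last by rewrite tht /=; rewrite subr_gt0 in h3.
  case: (ltP (th t) (pi / 2)) => hh; last first.
    by move: h2; rewrite lt_max => /orP[//|]; rewrite subr_gt0 ltNge -/(th t) hh.
  rewrite -x0; apply: (@dv_lt _ x (fun t => cos (th t)) _ _ t0) => u.
  move=> /andP[u0 ut]; apply: cos_gt0_phase1.
  have -> : 0 <= th u.
    rewrite -th0; apply: (@dv_le _ th w _ _ (ltW u0)) => v.
    move=> /andP[v0 vu]; have [|/ltW//] := h v.
    by rewrite v0 (le_lt_trans vu) ?(lt_trans ut).
  apply: le_lt_trans hh; apply: (@dv_le _ th w _ _ (ltW ut)) => v.
  move=> /andP[uv vt]; have [|/ltW//] := h v.
  by rewrite (le_trans (ltW u0)) // (le_lt_trans vt).
exists x, r, th, l; split=> // t.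
(* The clamps are inactive on the arc, hence by symmetry and periodicity at
   all times. *)
have inside u : 0 <= u <= l -> rho <= r u /\ r u <= K /\ `|x u| <= K.
  move=> ul; have hT v : 0 <= v <= l -> 0 <= th v <= pi.
    move=> /andP[v0 vl]; have [->|vn0] := eqVneq v 0; first by rewrite th0 lexx ltW.
    have [->|vnl] := eqVneq v l; first by rewrite /th Thl lexx andbT ltW.
    have [|_ /andP[a b]] := pos v; last by rewrite !ltW.
    by rewrite !lt_neqAle eq_sym vn0 v0 vnl vl.
  have lT' : 0 <= l <= T by rewrite ltW.
  have [k1 k2 k3 _] := unclamped rho0 rhod solY (fun d => (hY d).2 Cx)
    (fun d => (hY d).2 Cr) rd (ltW dd) lT' hT ul.
  have /andP[u0 ul'] := ul; split; first exact: le_trans k1.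
  have dK : d + u <= K by rewrite /K -addrA lerD ?(ltW dd) // ler_wpDr // (le_trans ul').
  split; first exact: le_trans k2 dK.
  by apply: le_trans k3 (le_trans _ dK); rewrite lerDr ltW // (lt_le_trans rho0).
have [k /andP[k0 kl]] : exists k : int, 0 <= t + (2 * l) * k%:~R < 2 * l.
  by apply: reduce_period; rewrite mulr_gt0.
have ins : rho <= r t /\ r t <= K /\ `|x t| <= K.
  have px u : x (u + 2 * l) = x u by case: (per u).
  have pr u : r (u + 2 * l) = r u by case: (per u).
  rewrite -(periodic_int px k t) -(periodic_int pr k t).
  move: (t + _) k0 kl => u u0 ul.
  case: (leP u l) => ul'; first by apply: inside; rewrite u0.
  have [u1 u2 _] := odd (2 * l - u).
  have e : - (2 * l - u) + 2 * l = u by ring.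
  rewrite -e px pr u1 u2 normrN; apply: inside.
  rewrite subr_ge0 (ltW ul) lerBlDr.
  by rewrite mulr_natl mulr2n lerD2l ltW.
case: ins => i1 [i2 i3]; split; [exact: lt_le_trans i1|exact: dx|exact: dr|].
have kx : - K <= Y d Cx t <= K by rewrite -ler_norml.
have kr : rho / 2 <= Y d Cr t <= K.
  by rewrite i2 andbT; apply: le_trans i1; rewrite ler_pdivrMr // ler_pMr // ler1n.
by have := dth t; rewrite /w /F /= (clamp_id kx) (clamp_id kr).
Qed.

End ClosedProfile.

(** * Calculus of smooth maps *)

Section NearDifferentiable.
Variables (R : realType) (V W : normedModType R).

Lemma near_eq_differentiable (f g : V -> W) (x : V) :
  (\forall y \near x, f y = g y) -> differentiable f x -> differentiable g x.
Proof.
move=> fg df; have fgx : f x = g x := nbhs_singleton fg.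
have H : g \o shift x = cst (g x) + 'd f x +o_ 0 id.
  apply/eqaddoP => _/posnumP[e].
  have /eqaddoP/(_ e%:num) := diff_locally df.
  move=> /(_ (gt0 e)) h; near=> y.
  have -> : (g \o shift x - (cst (g x) + 'd f x)) y =
            (f \o shift x - (cst (f x) + 'd f x)) y.
    rewrite /= !fctE /= fgx; congr (_ - _).
    have : (fun z => f z = g z) (y + x); last by move=> <-.
    near: y; have := fg; rewrite (near_shift 0 x) /=.
    by apply: filterS => y; rewrite /= subr0.
  by near: y.
have e : 'd g x = 'd f x :> (V -> W).
  by apply: diff_unique H; exact: diff_continuous.
apply/diff_locallyP; split; first by rewrite e; exact: diff_continuous.
by rewrite e.
Unshelve. all: by end_near. Qed.

End NearDifferentiable.

Section Smoothness.
Variables (R : realType) (V W : normedModType R).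
Implicit Types (U : set V) (f g : V -> W).

(** Smoothness is local: on an open set the values determine the
    derivatives. *)
Lemma Cn_eq U f g : open U -> (forall x, U x -> f x = g x) ->
  forall j, Cn j U f -> Cn j U g.
Proof.
move=> oU fg j; elim: j f g fg => [|j ih] f g fg /=.
  move=> h x Ux; have /= := h x Ux; rewrite /prop_for /continuous_at.
  rewrite -(fg x Ux); apply: cvg_trans; apply: near_eq_cvg.
  by near do apply: fg; exact: open_nbhs_nbhs.
have near_fg x : U x -> \forall y \near x, f y = g y.
  by move=> Ux; near do apply: fg; exact: open_nbhs_nbhs.
move=> [df h]; split=> [x Ux|v].
  by apply: near_eq_differentiable (df _ Ux); exact: near_fg.
apply: ih (h v) => x Ux; apply: near_eq_derive; exact: near_fg.
Unshelve. all: by end_near. Qed.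

Lemma Cn_sub U U' f j : U' `<=` U -> Cn j U f -> Cn j U' f.
Proof.
move=> UU; elim: j f => [|j ih] f /=; first by move=> h x /UU; exact: h.
by move=> [df h]; split=> [x /UU|v]; [exact: df|exact: ih].
Qed.

Lemma Cn_pred U f j : Cn j.+1 U f -> Cn j U f.
Proof.
elim: j f => [|j ih] f [df h].
  by move=> x /df /differentiable_continuous.
by split=> // v; apply: ih.
Qed.

Lemma Cn_cst U (c : W) j : Cn j U (fun=> c).
Proof.
elim: j c => [|j ih] c /=; first by move=> x _; exact: cst_continuous.
split=> [x _|v]; first exact: differentiable_cst.
have -> : (fun x : V => 'D_v (fun=> c) x) = (fun=> 0).
  by apply/funext => x; exact: derive_cst.
exact: ih.
Qed.

Lemma Cn_add U f g j : open U -> Cn j U f -> Cn j U g ->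
  Cn j U (fun x => f x + g x).
Proof.
move=> oU; elim: j f g => [|j ih] f g /=.
  by move=> hf hg x Ux; apply: continuousD; [exact: hf|exact: hg].
move=> [df hf] [dg hg]; split=> [x Ux|v].
  by apply: differentiableD; [exact: df|exact: dg].
apply: (Cn_eq oU _ (ih _ _ (hf v) (hg v))) => x Ux.
by rewrite deriveD //; apply: diff_derivable; [exact: df|exact: dg].
Qed.

End Smoothness.

Section ScalarSmoothness.
Variables (R : realType) (V : normedModType R).
Implicit Types (U : set V) (f g : V -> R).

Lemma Cn_mul U f g j : open U -> Cn j U f -> Cn j U g ->
  Cn j U (fun x => f x * g x).
Proof.
move=> oU; elim: j f g => [|j ih] f g.
  by move=> hf hg x Ux; apply: continuousM; [exact: hf|exact: hg].
move=> cf cg; have [df hf] := cf; have [dg hg] := cg; split=> [x Ux|v].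
  by apply: differentiableM; [exact: df|exact: dg].
have h : Cn j U (fun x => f x * 'D_v g x + g x * 'D_v f x).
  by apply: Cn_add; [|exact: ih (Cn_pred cf) (hg v)|exact: ih (Cn_pred cg) (hf v)].
apply: (Cn_eq oU _ h) => x Ux.
by rewrite deriveM //; apply: diff_derivable; [exact: df|exact: dg].
Qed.

Lemma Cn_opp U f j : open U -> Cn j U f -> Cn j U (fun x => - f x).
Proof.
move=> oU hf; have := Cn_mul oU (Cn_cst U (-1 : R) j) hf.
by apply: Cn_eq => // x _; rewrite mulN1r.
Qed.

Lemma Cn_sub_fun U f g j : open U -> Cn j U f -> Cn j U g ->
  Cn j U (fun x => f x - g x).
Proof. by move=> oU hf hg; apply: Cn_add => //; exact: Cn_opp. Qed.

Lemma Cn_sum U (I : Type) (s : seq I) (F : I -> V -> R) j : open U ->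
  (forall i, Cn j U (F i)) -> Cn j U (fun x => \sum_(i <- s) F i x).
Proof.
move=> oU h; elim: s => [|i s ih].
  by apply: (Cn_eq oU _ (Cn_cst U (0 : R) j)) => x _; rewrite big_nil.
by apply: (Cn_eq oU _ (Cn_add oU (h i) ih)) => x _; rewrite big_cons.
Qed.

Lemma derive_comp1 (f : V -> R) (g : R -> R) (x v : V) :
  differentiable f x -> differentiable g (f x) ->
  'D_v (fun y => g (f y)) x = 'D_1 g (f x) * 'D_v f x.
Proof.
move=> df dg; rewrite deriveE; last exact: differentiable_comp.
rewrite (@diff_comp _ _ _ _ f g) //= -!deriveE //.
rewrite -[in LHS](mulr1 ('D_v f x)) deriveE // -/(GRing.scale _ _) linearZ /=.
by rewrite deriveE // mulrC -(deriveE _ dg).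
Qed.

Lemma Cn_comp U (U' : set R) (f : V -> R) (g : R -> R) j : open U ->
  (forall x, U x -> U' (f x)) -> Cn j U f -> Cn j U' g ->
  Cn j U (fun x => g (f x)).
Proof.
move=> oU UU'; elim: j g => [|j ih] g.
  by move=> hf hg x Ux; exact: (continuous_comp (hf x Ux) (hg _ (UU' x Ux))).
move=> cf [dg hg]; have [df hf] := cf; have dg' := hg 1; split=> [x Ux|v].
  exact: (differentiable_comp (df x Ux) (dg _ (UU' x Ux))).
have h : Cn j U (fun x => 'D_1 g (f x) * 'D_v f x).
  exact: (Cn_mul oU (ih (fun y => 'D_1 g y) (Cn_pred cf) dg') (hf v)).
apply: (Cn_eq oU _ h) => x Ux.
by rewrite (derive_comp1 _ (df x Ux) (dg _ (UU' x Ux))).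
Qed.

End ScalarSmoothness.

Section RealSmoothness.
Variable R : realType.
Implicit Types (U : set R) (f g : R -> R).

Lemma Cn_derive U f (f' : R -> R) j : open U ->
  (forall t : R, U t -> is_derive t 1 f (f' t)) -> Cn j U f' -> Cn j.+1 U f.
Proof.
move=> oU h c; split=> [t Ut|v].
  by apply/derivable1_diffP; case: (h t Ut).
apply: (Cn_eq oU _ (Cn_mul oU (Cn_cst U v j) c)) => t Ut.
have [d e] := h t Ut; have /derivable1_diffP df := d.
rewrite -[v in RHS]mulr1 deriveE // -/(GRing.scale v 1) linearZ /= -deriveE //.
by rewrite e.
Qed.

Lemma Cn0_derive U f (f' : R -> R) :
  (forall t : R, U t -> is_derive t 1 f (f' t)) -> Cn 0 U f.
Proof. by move=> h t /h /dv_continuous. Qed.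

Lemma Cn_id U j : open U -> Cn j U (fun t : R => t).
Proof.
move=> oU; case: j => [|j]; first exact: (@Cn0_derive U _ (fun=> 1)).
by apply: (@Cn_derive U _ (fun=> 1)) => //; exact: Cn_cst.
Qed.

Lemma Cn_sin_cos j U : open U -> Cn j U (@sin R) /\ Cn j U (@cos R).
Proof.
move=> oU; elim: j => [|j [hs hc]].
  split; first exact: (@Cn0_derive U _ (@cos R)).
  exact: (@Cn0_derive U _ (fun t => - sin t)).
split; first exact: (@Cn_derive U _ (@cos R)).
by apply: (@Cn_derive U _ (fun t => - sin t)) => //; exact: Cn_opp.
Qed.

Lemma open_neq0 : open [set t : R | t != 0].
Proof.
have -> : [set t : R | t != 0] = ~` [set 0].
  by apply/seteqP; split=> t /= /eqP.
by rewrite openC; exact: closed_eq.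
Qed.

Lemma Cn_inv j : Cn j [set t : R | t != 0] (fun t => t^-1).
Proof.
have d (t : R) : t != 0 -> is_derive t 1 (fun t => t^-1) (- (t^-1 * t^-1)).
  move=> t0; apply: (dv_eq (dvV t0 (dvI t))).
  by rewrite expr2 invfM; field.
elim: j => [|j ih]; first exact: (@Cn0_derive _ _ (fun t => - (t^-1 * t^-1))).
apply: Cn_derive d _; first exact: open_neq0.
by apply: Cn_opp; [exact: open_neq0|apply: Cn_mul => //; exact: open_neq0].
Qed.

Lemma Cn_atan j : Cn j setT (@atan R).
Proof.
case: j => [|j]; first exact: (@Cn0_derive _ _ (fun t => (1 + t ^+ 2)^-1)).
apply: (@Cn_derive _ _ (fun t => (1 + t ^+ 2)^-1)) => //; first exact: openT.
have h1 : Cn j setT (fun t : R => 1 + t ^+ 2).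
  apply: Cn_add; [exact: openT|exact: Cn_cst|].
  have h := Cn_mul openT (Cn_id j openT) (Cn_id j openT).
  by apply: (Cn_eq openT _ h) => t _; rewrite expr2.
have h2 (t : R) : setT t -> [set u : R | u != 0] (1 + t ^+ 2).
  by move=> _ /=; rewrite gt_eqF // ltr_pwDl // sqr_ge0.
exact: (Cn_comp openT h2 h1 (@Cn_inv j)).
Qed.

End RealSmoothness.

Section DivSmoothness.
Variables (R : realType) (V : normedModType R).

Lemma Cn_div (U : set V) (f g : V -> R) j : open U ->
  (forall x, U x -> g x != 0) -> Cn j U f -> Cn j U g ->
  Cn j U (fun x => f x / g x).
Proof.
move=> oU g0 hf hg; apply: Cn_mul => //.
exact: (Cn_comp oU g0 hg (Cn_inv R j)).
Qed.

End DivSmoothness.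

Section RowSmoothness.
Variables (R : realType).

Lemma Cn_rV (V : normedModType R) n (U : set V) (f : V -> 'rV[R]_n) j :
  open U -> (forall i, Cn j U (fun x => f x 0 i)) -> Cn j U f.
Proof.
move=> oU; elim: j f => [|j ih] f h.
  move=> x Ux; apply/cvgrPdist_le => /= e e0; near=> y.
  rewrite /Num.Def.normr /= mx_normrE (bigmax_le _ (ltW e0)) //= => -[i k] _.
  rewrite !mxE /= ord1; move: k; near: y; apply: filter_forall => k.
  by have /cvgrPdist_le/(_ _ e0) := h k x Ux.
have df x : U x -> differentiable f x.
  move=> Ux; have -> : f = \sum_(i < n) (fun x => f x 0 i *: delta_mx 0 i).
    by apply/funext => y; rewrite fct_sumE [LHS]row_sum_delta.
  by apply: differentiable_sum => i; apply: differentiableZl; case: (h i) => + _; apply.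
split=> // v; apply: ih => i; have [_ hi] := h i.
apply: (Cn_eq oU _ (hi v)) => x Ux.
by rewrite derive_mx ?mxE //; exact: diff_derivable (df _ Ux).
Unshelve. all: by end_near. Qed.

Lemma Cn_coord_comp (V : normedModType R) m n (U : set V) (f : V -> 'M[R]_(m, n)) i k j :
  open U -> Cn j U f -> Cn j U (fun x => f x i k).
Proof.
move=> oU; elim: j f => [|j ih] f h.
  move=> x Ux; apply: (@continuous_comp _ _ _ f (fun N : 'M[R]_(m, n) => N i k)); first exact: h.
  exact: coord_continuous.
have [df hf] := h; split=> [x Ux|v].
  apply: (@differentiable_comp _ _ _ _ f (fun N : 'M[R]_(m, n) => N i k : R)).
    exact: df.
  exact: differentiable_coord.
apply: (Cn_eq oU _ (ih _ (hf v))) => x Ux.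
by rewrite derive_mx ?mxE //; exact: diff_derivable (df _ Ux).
Qed.

Lemma Cn_coord n (U : set 'rV[R]_n) i k j : open U -> Cn j U (fun x : 'rV[R]_n => x i k).
Proof.
move=> oU; case: j => [|j].
  by move=> x Ux; exact: coord_continuous.
split=> [x Ux|v]; first exact: differentiable_coord.
apply: (Cn_eq oU _ (Cn_cst U (v i k) j)) => x Ux.
have dc : derivable (fun x : 'rV[R]_n => x) x v by exact: derivable_id.
by have := congr1 (fun M : 'rV_n => M i k) (derive_mx dc); rewrite mxE derive_id.
Qed.

Lemma Cn_idrV n (U : set 'rV[R]_n) j : open U -> Cn j U (fun x : 'rV[R]_n => x).
Proof. by move=> oU; apply: Cn_rV => // i; exact: Cn_coord. Qed.

End RowSmoothness.

(** * Dot products and fundamental forms *)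

Section Dot.
Variables (R : realType).

Lemma dotE k (u v : 'rV[R]_k) : dot u v = (u *m v^T) 0 0.
Proof. by rewrite /dot mxE; apply: eq_bigr => i _; rewrite mxE. Qed.

Lemma dotC k (u v : 'rV[R]_k) : dot u v = dot v u.
Proof. by rewrite /dot; apply: eq_bigr => i _; rewrite mulrC. Qed.

Lemma dotDl k (u v w : 'rV[R]_k) : dot (u + v) w = dot u w + dot v w.
Proof. by rewrite !dotE mulmxDl mxE. Qed.

Lemma dotZl k (a : R) (u v : 'rV[R]_k) : dot (a *: u) v = a * dot u v.
Proof. by rewrite !dotE -scalemxAl mxE. Qed.

Lemma dotDr k (u v w : 'rV[R]_k) : dot u (v + w) = dot u v + dot u w.
Proof. by rewrite !(dotC u) dotDl. Qed.

Lemma dotZr k (a : R) (u v : 'rV[R]_k) : dot u (a *: v) = a * dot u v.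
Proof. by rewrite !(dotC u) dotZl. Qed.

Lemma dot0l k (u : 'rV[R]_k) : dot 0 u = 0.
Proof. by rewrite dotE mul0mx mxE. Qed.

Lemma dot_row_mx k l (a c : 'rV[R]_k) (b d : 'rV[R]_l) :
  dot (row_mx a b) (row_mx c d) = dot a c + dot b d.
Proof. by rewrite !dotE tr_row_mx mul_row_col mxE. Qed.

Lemma dot_scalar (a b : R) : dot (a%:M : 'rV_1) b%:M = a * b.
Proof. by rewrite /dot big_ord1 !mxE /= !mulr1n. Qed.

Lemma dot_ge0 k (u : 'rV[R]_k) : 0 <= dot u u.
Proof. by apply: sumr_ge0 => i _; rewrite -expr2 sqr_ge0. Qed.

Lemma dot_eq0 k (u : 'rV[R]_k) : dot u u = 0 -> u = 0.
Proof.
move=> /eqP; rewrite psumr_eq0 => [|i _]; last by rewrite -expr2 sqr_ge0.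
move=> /allP h; apply/rowP => i; rewrite mxE.
by have := h i (mem_index_enum _); rewrite /= -expr2 sqrf_eq0 => /eqP.
Qed.

End Dot.

Section FundamentalFormAlgebra.
Variables (R : realType) (n : nat) (s : 'rV[R]_n) (B : 'M[R]_n) (b : 'rV[R]_n).
Variable rad : R.
Hypothesis rad0 : rad != 0.
(** In a parametrization of a hypersurface of revolution, [s] is the differential
    of the arc length of the profile, and the rows of [B] are the partial
    derivatives of the direction [b] in the sphere. *)
Hypotheses (b1 : dot b b = 1) (Bb : B *m b^T = 0).
Hypothesis inj : forall v : 'rV[R]_n, v *m s^T = 0 -> v *m B = 0 -> v = 0.

Let g : 'M[R]_n := s^T *m s + rad ^+ 2 *: (B *m B^T).

Lemma rotation_metric_unit : g \in unitmx.
Proof.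
rewrite -row_free_unit; apply: inj_row_free => v vg.
have : (v *m g *m v^T) 0 0 = 0 by rewrite vg mul0mx mxE.
have -> : v *m g *m v^T = (v *m s^T) *m (v *m s^T)^T
    + rad ^+ 2 *: ((v *m B) *m (v *m B)^T).
  rewrite /g mulmxDr mulmxDl -scalemxAr -scalemxAl !trmx_mul trmxK !mulmxA.
  by [].
rewrite mxE [X in _ + X]mxE -!dotE => h.
have h1 := dot_ge0 (v *m s^T); have h2 := dot_ge0 (v *m B).
have h3 : 0 < rad ^+ 2 by rewrite exprn_even_gt0.
have h4 : 0 <= rad ^+ 2 * dot (v *m B) (v *m B) by rewrite mulr_ge0 // ltW.
apply: inj; apply: dot_eq0; first by lra.
have /eqP : rad ^+ 2 * dot (v *m B) (v *m B) = 0 by lra.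
by rewrite mulf_eq0 gt_eqF //= => /eqP.
Qed.

(** The second fundamental form is [- (x' / rad) *: g] plus a multiple of
    [s^T *m s], and [invmx g *m (s^T *m s)] has trace 1: a vector [v] in the
    kernel of [B], which exists because [b] is orthogonal to the rows of [B],
    satisfies [v *m g = c *: s] with [v *m s^T = c%:M]. This works in any
    coordinates. *)
Lemma rotation_trace (k x' : R) (h : 'M[R]_n) :
  h = k *: (s^T *m s) - (rad * x') *: (B *m B^T) ->
  \tr (invmx g *m h) = k + x' / rad - n%:R * (x' / rad).
Proof.
move=> hE; have gu := rotation_metric_unit.
have {hE} -> : h = (k + x' / rad) *: (s^T *m s) - (x' / rad) *: g.
  rewrite hE /g scalerDr scalerA; apply/matrixP => i j; rewrite !mxE.
  by field.
rewrite mulmxBr -!scalemxAr mulVmx // raddfB /= !mxtraceZ mxtrace1.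
suff -> : \tr (invmx g *m (s^T *m s)) = 1 by ring.
have [v v0 vB] : exists2 v : 'rV[R]_n, v != 0 & v *m B = 0.
  have : ~~ row_free B.
    apply/negP; rewrite row_free_unit => uB.
    have : b^T = 0 by rewrite -[b^T](mulKmx uB) Bb mulmx0.
    move=> /(congr1 trmx); rewrite trmxK trmx0 => b0.
    by move: b1; rewrite b0 dot0l => /eqP; rewrite eq_sym oner_eq0.
  rewrite -kermx_eq0 => /rowV0Pn[v /sub_kermxP vB v0]; by exists v.
pose c := (v *m s^T) 0 0.
have vs : v *m s^T = c%:M by apply/matrixP => i j; rewrite !ord1 !mxE mulr1n /c mxE.
have vg : v *m g = c *: s.
  rewrite /g mulmxDr -scalemxAr !mulmxA vB mul0mx scaler0 addr0 vs.
  exact: mul_scalar_mx.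
have c0 : c != 0.
  apply/eqP => c0; move/eqP: v0; apply; apply: inj => //.
  by rewrite vs c0 raddf0.
have sg : s *m invmx g = c^-1 *: v.
  by rewrite -[v in RHS](mulmxK gu) vg -scalemxAl scalerA mulVf // scale1r.
rewrite mulmxA mxtrace_mulC mulmxA sg -scalemxAl vs /mxtrace big_ord1 !mxE /=.
by rewrite mulr1n mulVf.
Qed.

End FundamentalFormAlgebra.

Section DerivativeRules.
Variables (R : realType) (V : normedModType R).

Lemma derive_dot k (f g : V -> 'rV[R]_k) (x v : V) :
  differentiable f x -> differentiable g x ->
  'D_v (fun y => dot (f y) (g y)) x = dot ('D_v f x) (g x) + dot (f x) ('D_v g x).
Proof.
move=> df dg.
have dfi i : differentiable (fun y => f y 0 i : R) x.
  apply: (@differentiable_comp _ _ _ _ f (fun N : 'rV[R]_k => N 0 i : R)) => //.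
  exact: differentiable_coord.
have dgi i : differentiable (fun y => g y 0 i : R) x.
  apply: (@differentiable_comp _ _ _ _ g (fun N : 'rV[R]_k => N 0 i : R)) => //.
  exact: differentiable_coord.
have hf i : derivable (fun y => f y 0 i : R) x v by exact: diff_derivable.
have hg i : derivable (fun y => g y 0 i : R) x v by exact: diff_derivable.
have -> : (fun y => dot (f y) (g y)) = \sum_(i < k) (fun y => f y 0 i * g y 0 i).
  by apply/funext => y; rewrite fct_sumE.
rewrite derive_sum => [|i]; last first.
  exact: (derivableM (hf i) (hg i)).
rewrite /dot -big_split; apply: eq_bigr => i _ /=.
rewrite (deriveM (hf i) (hg i)).
have -> : 'D_v f x 0 i = 'D_v (fun y => f y 0 i) x.
  by rewrite derive_mx ?mxE //; exact: diff_derivable.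
have -> : 'D_v g x 0 i = 'D_v (fun y => g y 0 i) x.
  by rewrite derive_mx ?mxE //; exact: diff_derivable.
by rewrite addrC /GRing.scale /= [g x 0 i * _]mulrC.
Qed.

Lemma derive_row_mx k l (f : V -> 'rV[R]_k) (g : V -> 'rV[R]_l) (x v : V) :
  differentiable f x -> differentiable g x ->
  derivable (fun y => row_mx (f y) (g y)) x v /\
  'D_v (fun y => row_mx (f y) (g y)) x = row_mx ('D_v f x) ('D_v g x).
Proof.
move=> df dg.
have d : derivable (fun y => row_mx (f y) (g y)) x v.
  apply/derivable_mxP => i j; case: (split_ordP j) => j' ->.
    rewrite (_ : (fun y => _) = (fun y => f y i j')); last first.
      by apply/funext => y; rewrite row_mxEl.
    by move: i j'; apply/derivable_mxP/diff_derivable.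
  rewrite (_ : (fun y => _) = (fun y => g y i j')); last first.
    by apply/funext => y; rewrite row_mxEr.
  by move: i j'; apply/derivable_mxP/diff_derivable.
split=> //; rewrite derive_mx //; apply/rowP => j; rewrite mxE.
case: (split_ordP j) => j' ->.
  rewrite row_mxEl (_ : (fun y => _) = (fun y => f y 0 j')); last first.
    by apply/funext => y; rewrite row_mxEl.
  by rewrite [in RHS]derive_mx ?mxE //; exact: diff_derivable.
rewrite row_mxEr (_ : (fun y => _) = (fun y => g y 0 j')); last first.
  by apply/funext => y; rewrite row_mxEr.
by rewrite [in RHS]derive_mx ?mxE //; exact: diff_derivable.
Qed.

Lemma differentiable_rV n (f : V -> 'rV[R]_n) x :
  (forall i, differentiable (fun y => f y 0 i : R) x) -> differentiable f x.
Proof.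
move=> h; have -> : f = \sum_(i < n) (fun x => f x 0 i *: delta_mx 0 i).
  by apply/funext => y; rewrite fct_sumE [LHS]row_sum_delta.
by apply: differentiable_sum => i; apply: differentiableZl.
Qed.

Lemma derive_scalar (f : V -> R) (x v : V) : differentiable f x ->
  differentiable (fun y => (f y)%:M : 'rV[R]_1) x /\
  'D_v (fun y => (f y)%:M : 'rV[R]_1) x = ('D_v f x)%:M.
Proof.
move=> df.
have e i : (fun y => ((f y)%:M : 'rV[R]_1) 0 i) = f.
  by apply/funext => y; rewrite !ord1 mxE mulr1n.
have d : differentiable (fun y => (f y)%:M : 'rV[R]_1) x.
  by apply: differentiable_rV => i; rewrite e.
split=> //; rewrite derive_mx; last exact: diff_derivable.
by apply/rowP => i; rewrite !mxE e !ord1 mulr1n.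
Qed.

Lemma derive_scale_row k (f : V -> R) (g : V -> 'rV[R]_k) (x v : V) :
  differentiable f x -> differentiable g x ->
  differentiable (fun y => f y *: g y) x /\
  'D_v (fun y => f y *: g y) x = 'D_v f x *: g x + f x *: 'D_v g x.
Proof.
move=> df dg.
have dgi i : differentiable (fun y => g y 0 i : R) x.
  apply: (@differentiable_comp _ _ _ _ g (fun N : 'rV[R]_k => N 0 i : R)) => //.
  exact: differentiable_coord.
have e i : (fun y => (f y *: g y) 0 i) = (fun y => f y * g y 0 i).
  by apply/funext => y; rewrite mxE.
have d : differentiable (fun y => f y *: g y) x.
  by apply: differentiable_rV => i; rewrite e; apply: differentiableM.
split=> //; rewrite derive_mx; last exact: diff_derivable.
apply/rowP => i; rewrite !mxE e.
rewrite (deriveM (diff_derivable df) (diff_derivable (dgi i))).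
have -> : 'D_v g x 0 i = 'D_v (fun y => g y 0 i) x.
  by rewrite derive_mx ?mxE //; exact: diff_derivable.
by rewrite addrC /GRing.scale /= [g x 0 i * _]mulrC.
Qed.

End DerivativeRules.

(** * Hypersurfaces of revolution *)

Section RowMx.
Variables (R : realType) (V : normedModType R).

Lemma Cn_row_mx k l (U : set V) (f : V -> 'rV[R]_k) (g : V -> 'rV[R]_l) j :
  open U -> Cn j U f -> Cn j U g -> Cn j U (fun y => row_mx (f y) (g y)).
Proof.
move=> oU hf hg; apply: Cn_rV => // i; case: (split_ordP i) => i' ->.
  apply: (Cn_eq oU _ (Cn_coord_comp 0 i' oU hf)) => y _; by rewrite row_mxEl.
apply: (Cn_eq oU _ (Cn_coord_comp 0 i' oU hg)) => y _; by rewrite row_mxEr.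
Qed.

Lemma Cn_scalar (U : set V) (f : V -> R) j :
  open U -> Cn j U f -> Cn j U (fun y => (f y)%:M : 'rV[R]_1).
Proof.
move=> oU hf; apply: Cn_rV => // i.
by apply: (Cn_eq oU _ hf) => y _; rewrite !ord1 mxE mulr1n.
Qed.

Lemma Cn_scale_row k (U : set V) (f : V -> R) (g : V -> 'rV[R]_k) j :
  open U -> Cn j U f -> Cn j U g -> Cn j U (fun y => f y *: g y).
Proof.
move=> oU hf hg; apply: Cn_rV => // i.
by apply: (Cn_eq oU _ (Cn_mul oU hf (Cn_coord_comp 0 i oU hg))) => y _; rewrite mxE.
Qed.

End RowMx.

Section Rotation.
Variables (R : realType) (V : normedModType R) (n : nat) (U : set V).
Variables (s : V -> R) (b : V -> 'rV[R]_n).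
Hypothesis oU : open U.

Definition rotate (f g : R -> R) (w : V) : 'rV[R]_(1 + n) :=
  row_mx (f (s w))%:M (g (s w) *: b w).

Lemma Cn_rotate f g j : Cn j U s -> Cn j U b -> Cn j setT f -> Cn j setT g ->
  Cn j U (rotate f g).
Proof.
move=> hs hb hf hg.
have UT x : U x -> setT (s x) by [].
apply: Cn_row_mx => //; first exact/Cn_scalar/(Cn_comp oU UT hs hf).
exact: (Cn_scale_row oU (Cn_comp oU UT hs hg) hb).
Qed.

Lemma derive_rotate (f g f' g' : R -> R) (H : V -> 'rV[R]_(1 + n)) (w v : V) :
  (forall t : R, is_derive t 1 f (f' t)) -> (forall t : R, is_derive t 1 g (g' t)) ->
  differentiable s w -> differentiable b w ->
  U w -> (forall y, U y -> H y = rotate f g y) ->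
  'D_v H w = row_mx (f' (s w) * 'D_v s w)%:M
                    ((g' (s w) * 'D_v s w) *: b w + g (s w) *: 'D_v b w).
Proof.
move=> df dg ds db Uw HE.
have [dfw f'E] := df (s w); have [dgw g'E] := dg (s w).
have /derivable1_diffP Dfw := dfw; have /derivable1_diffP Dgw := dgw.
have Dfs : differentiable (fun y => f (s y)) w by exact: differentiable_comp.
have Dgs : differentiable (fun y => g (s y)) w by exact: differentiable_comp.
have -> : 'D_v H w = 'D_v (rotate f g) w.
  apply: near_eq_derive; near do apply: HE; exact: open_nbhs_nbhs.
have [d1 e1] := derive_scalar v Dfs; have [d2 e2] := derive_scale_row v Dgs db.
have [_ ->] := derive_row_mx v d1 d2; rewrite e1 e2.
by rewrite (derive_comp1 v ds Dfw) (derive_comp1 v ds Dgw) f'E g'E.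
Unshelve. all: by end_near. Qed.

End Rotation.

(** A hypersurface of revolution [F] and its normal [G], read in an arbitrary
    parametrization [w] of the pairs (arc length [s w], direction [b w]). *)
Section RotationGeometry.
Variables (R : realType) (lam : R) (q : nat) (x r th : R -> R).
Hypothesis prof : forall t, profile_at lam q%:R x r th t.
Let n := q.+1.
Variables (U : set 'rV[R]_n) (s : 'rV[R]_n -> R) (b : 'rV[R]_n -> 'rV[R]_n).
Hypotheses (oU : open U) (cs : forall j, Cn j U s) (cb : forall j, Cn j U b).
Hypothesis b1 : forall w, U w -> dot (b w) (b w) = 1.
Variables (F G : 'rV[R]_n -> 'rV[R]_(1 + n)).
Let k t := curvature lam q%:R (x t) (r t) (th t).
Let x' t := cos (th t).
Let r' t := sin (th t).
Hypothesis FE : forall w, U w -> F w = rotate s b x r w.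
Hypothesis GE : forall w, U w -> G w = rotate s b (fun t => - r' t) x' w.
Hypothesis cF : Cn 2 U F.
Hypothesis cG : Cn 1 U G.

Let ds w : U w -> differentiable s w. Proof. by case: (cs 1) => h _; apply: h. Qed.
Let db w : U w -> differentiable b w. Proof. by case: (cb 1) => h _; apply: h. Qed.
Let dx (t : R) : is_derive t 1 x (x' t). Proof. by case: (prof t). Qed.
Let dr (t : R) : is_derive t 1 r (r' t). Proof. by case: (prof t). Qed.
Let dth (t : R) : is_derive t 1 th (k t). Proof. by case: (prof t). Qed.
Let dx' (t : R) : is_derive t 1 x' (- (k t * r' t)).
Proof. by apply: (dv_eq (dvcos (dth t))); rewrite /r'; ring. Qed.
Let dnr' (t : R) : is_derive t 1 (fun t => - r' t) (- (k t * x' t)).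
Proof. by apply: (dv_eq (dvN (dvsin (dth t)))); rewrite /x'; ring. Qed.
Let unit_speed t : x' t ^+ 2 + r' t ^+ 2 = 1.
Proof. exact: cos2Dsin2. Qed.

Let DF w v : U w -> 'D_v F w = row_mx (x' (s w) * 'D_v s w)%:M
  ((r' (s w) * 'D_v s w) *: b w + r (s w) *: 'D_v b w).
Proof. by move=> Uw; apply: (derive_rotate oU v dx dr (ds Uw) (db Uw) Uw FE). Qed.

Let DG w v : U w -> 'D_v G w = row_mx (- (k (s w) * x' (s w)) * 'D_v s w)%:M
  ((- (k (s w) * r' (s w)) * 'D_v s w) *: b w + x' (s w) *: 'D_v b w).
Proof. by move=> Uw; apply: (derive_rotate oU v dnr' dx' (ds Uw) (db Uw) Uw GE). Qed.

(** [b] runs in the unit sphere. *)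
Let bDb w v : U w -> dot (b w) ('D_v b w) = 0.
Proof.
move=> Uw; have : 'D_v (fun w => dot (b w) (b w)) w = 0.
  rewrite -(derive_cst (1 : R) w v); apply: near_eq_derive.
  near do apply: b1; exact: open_nbhs_nbhs.
rewrite (derive_dot v (db Uw) (db Uw)) (dotC ('D_v b w)) => h.
by move: h; lra.
Unshelve. all: by end_near. Qed.

Lemma rotation_normal w v : U w -> dot ('D_v F w) (G w) = 0.
Proof.
move=> Uw; rewrite DF // GE // /rotate dot_row_mx dot_scalar dotDl.
rewrite !(dotZl, dotZr) b1 // (dotC ('D_v b w)) bDb //; ring.
Qed.

Lemma rotation_support w : U w ->
  dot (F w) (G w) = r (s w) * x' (s w) - x (s w) * r' (s w).
Proof.
move=> Uw; rewrite FE // GE // /rotate dot_row_mx dot_scalar dotZl dotZr b1 //.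
ring.
Qed.

Variable u : 'rV[R]_n.
Hypothesis Uu : U u.
Hypothesis inj : forall v : 'rV[R]_n, 'D_v s u = 0 -> 'D_v b u = 0 -> v = 0.

Let dF : differentiable F u. Proof. by case: cF => h _; apply: h. Qed.
Let dG : differentiable G u. Proof. by case: cG => h _; apply: h. Qed.
Let r0 : r (s u) != 0. Proof. by case: (prof (s u)) => h _ _ _; rewrite gt_eqF. Qed.

Lemma rotation_immersed : row_free ('J F u).
Proof.
apply: inj_row_free => v; rewrite -(deriveEjacobian _ dF) DF // => h.
have := congr1 (@lsubmx _ _ 1 n) h; rewrite row_mxKl linear0 => h1.
have := congr1 (@rsubmx _ _ 1 n) h; rewrite row_mxKr linear0 => h2.
have := congr1 (dot (b u)) h2.
rewrite dotDr !dotZr b1 // bDb // mulr1 mulr0 addr0 dotC dot0l => h3.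
have h4 : x' (s u) * 'D_v s u = 0.
  by have := congr1 (fun M : 'rV[R]_1 => M 0 0) h1; rewrite !mxE mulr1n.
have sv : 'D_v s u = 0.
  rewrite -[LHS]mul1r -(unit_speed (s u)) mulrDl !expr2 -!mulrA h3 h4.
  by rewrite !mulr0 addr0.
apply: inj => //; move: h2; rewrite sv mulr0 scale0r add0r => /eqP.
by rewrite scaler_eq0 (negPf r0) => /eqP.
Qed.

Let e i : 'rV[R]_n := delta_mx 0 i.
Let sv : 'rV[R]_n := \row_i 'D_(e i) s u.
Let B : 'M[R]_n := \matrix_(i, j) ('D_(e i) b u) 0 j.

Let DsE (v : 'rV[R]_n) : ('D_v s u)%:M = v *m sv^T.
Proof.
rewrite (deriveE v (ds Uu)) {1}(row_sum_delta v) linear_sum /=.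
apply/matrixP => i j; rewrite !ord1 !mxE mulr1n; apply: eq_bigr => l _.
by rewrite linearZ /= !mxE (deriveE _ (ds Uu)).
Qed.

Let DbE (v : 'rV[R]_n) : 'D_v b u = v *m B.
Proof.
rewrite (deriveE v (db Uu)) {1}(row_sum_delta v) linear_sum /=.
apply/rowP => j; rewrite summxE mxE; apply: eq_bigr => l _.
by rewrite linearZ /= !mxE (deriveE _ (db Uu)).
Qed.

Let Bij i j : (B *m B^T) i j = dot ('D_(e i) b u) ('D_(e j) b u).
Proof. by rewrite mxE /dot; apply: eq_bigr => l _; rewrite !mxE. Qed.

Let svij i j : (sv^T *m sv) i j = 'D_(e i) s u * 'D_(e j) s u.
Proof. by rewrite mxE big_ord1 !mxE. Qed.

Let formE (a c : R) i j : (a *: (sv^T *m sv) + c *: (B *m B^T)) i j =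
  a * ('D_(e i) s u * 'D_(e j) s u) + c * dot ('D_(e i) b u) ('D_(e j) b u).
Proof. by rewrite -svij -Bij; move: (sv^T *m sv) (B *m B^T) => M N; rewrite !mxE. Qed.

Lemma rotation_first_form :
  first_form F u = sv^T *m sv + r (s u) ^+ 2 *: (B *m B^T).
Proof.
apply/matrixP => i j; rewrite mxE !DF // dot_row_mx dot_scalar.
rewrite dotDl !dotDr !(dotZl, dotZr) b1 // bDb // (dotC ('D__ b u) (b u)) bDb //.
rewrite -[sv^T *m sv]scale1r formE.
move: (unit_speed (s u)) ('D_(e i) s u) ('D_(e j) s u) (r (s u)) (dot _ _).
move: (x' (s u)) (r' (s u)) => X' R' h a a' c d.
by rewrite !mulr1 -h; ring.
Qed.

(** Differentiating [dot ('D_v F) G = 0] trades the second derivatives of [F] for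
    the first ones of [G]. *)
Lemma rotation_second_form : second_form F (G u) u =
  k (s u) *: (sv^T *m sv) - (r (s u) * x' (s u)) *: (B *m B^T).
Proof.
rewrite -scaleNr; apply/matrixP => i j; rewrite mxE.
have cDF : Cn 1 U (fun w => 'D_(e j) F w) by have [_ h] := cF; exact: (h (e j)).
have dDF : differentiable (fun w => 'D_(e j) F w) u.
  by have [h _] := cDF; exact: (h u Uu).
have : 'D_(e i) (fun w => dot ('D_(e j) F w) (G w)) u = 0.
  rewrite -(derive_cst (0 : R) u (e i)); apply: near_eq_derive.
  near=> w; apply: rotation_normal; near: w; exact: open_nbhs_nbhs.
rewrite derive_dot // => /eqP; rewrite addr_eq0 => /eqP ->.
rewrite DF // DG // dot_row_mx dot_scalar.
rewrite dotDl !dotDr !(dotZl, dotZr) b1 // bDb // (dotC ('D__ b u) (b u)) bDb //.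
rewrite formE (dotC ('D_(e j) b u)).
move: (unit_speed (s u)) ('D_(e i) s u) ('D_(e j) s u) (r (s u)) (dot _ _).
move: (x' (s u)) (r' (s u)) (k (s u)) => X' R' K h a a' c d.
by rewrite !mulr1 -[K in RHS]mulr1 -h; ring.
Unshelve. all: by end_near. Qed.

Lemma rotation_curvature : dot (F u) (G u) + mean_curvature F (G u) u = lam.
Proof.
rewrite rotation_support // /mean_curvature rotation_first_form.
have Bb : B *m (b u)^T = 0.
  apply/matrixP => i j; rewrite ord1 [RHS]mxE -(bDb (e i) Uu) dotC /dot mxE.
  by apply: eq_bigr => l _; rewrite !mxE.
have injB (v : 'rV[R]_n) : v *m sv^T = 0 -> v *m B = 0 -> v = 0.
  rewrite -DsE -DbE => h1 h2; apply: inj => //.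
  by have := congr1 (fun M : 'rV[R]_1 => M 0 0) h1; rewrite !mxE mulr1n.
rewrite (rotation_trace r0 (b1 Uu) Bb injB rotation_second_form).
rewrite /k /curvature -/(x' (s u)) -/(r' (s u)) -natr1.
by field.
Qed.

End RotationGeometry.

(** * Local branches of the polar angle *)

Section Angles.
Variable R : realType.
Implicit Types (t : R) (a : 'rV[R]_2).

Definition circ t : 'rV[R]_2 := \row_i (if i == 0 then cos t else sin t).

Lemma circ0 t : circ t 0 0 = cos t. Proof. by rewrite mxE. Qed.
Lemma circ1 t : circ t 0 1 = sin t. Proof. by rewrite mxE. Qed.

Lemma rV2P (a b : 'rV[R]_2) : a 0 0 = b 0 0 -> a 0 1 = b 0 1 -> a = b.
Proof.
move=> h0 h1; apply/rowP => i; case: (unliftP 0 i) => [j|] ->.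
  by rewrite !ord1 (_ : lift 0 0 = 1) //; apply/val_inj.
exact: h0.
Qed.

Lemma dot2 (a b : 'rV[R]_2) : dot a b = a 0 0 * b 0 0 + a 0 1 * b 0 1.
Proof.
rewrite /dot big_ord_recl big_ord1; congr (_ + _).
by rewrite (_ : lift ord0 ord0 = 1) //; apply/val_inj.
Qed.

Lemma dot_circ t : dot (circ t) (circ t) = 1.
Proof. by rewrite dot2 circ0 circ1 -!expr2 cos2Dsin2. Qed.

Lemma unit_circle_angle a : dot a a = 1 -> exists t, a = circ t.
Proof.
rewrite dot2 -!expr2; set c := a 0 0; set s := a 0 1 => cs.
have c1 : -1 <= c <= 1.
  by have := sqr_ge0 s => s2; apply/andP; split; nra.
have h1 : cos (acos c) = c by apply: acosK; rewrite in_itv.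
have h2 : sin (acos c) = `|s|.
  by rewrite sin_acos // (_ : 1 - c ^+ 2 = s ^+ 2) ?sqrtr_sqr //; lra.
case: (leP 0 s) => s0.
  by exists (acos c); apply: rV2P; rewrite ?circ0 ?circ1 ?h1 ?h2 // ger0_norm.
exists (- acos c); apply: rV2P; rewrite ?circ0 ?circ1 ?cosN ?sinN ?h1 ?h2 //.
by rewrite ltr0_norm // opprK.
Qed.

Lemma same_angle t t' : circ t = circ t' ->
  exists k : int, t' = t + (pi *+ 2) * k%:~R.
Proof.
move=> e; have pi0 := pi_gt0 R.
have ec : cos t = cos t' by rewrite -!circ0 e.
have es : sin t = sin t' by rewrite -!circ1 e.
have pp : 0 < pi *+ 2 :> R by rewrite pmulrn_lgt0.
have [k /andP[k0 k1]] := reduce_period (t' - t) pp.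
set d := _ + _ in k0 k1.
have cd : cos d = 1.
  rewrite /d (periodic_int (@cosD2pi R)) cosB ec es -!expr2; exact: cos2Dsin2.
have sd : sin d = 0.
  rewrite /d (periodic_int (@sinD2pi R)) sinB ec es mulrC; exact: subrr.
have d0 : d = 0.
  apply/eqP; rewrite eq_le k0 andbT leNgt; apply/negP => dp.
  case: (ltgtP d pi) => dpi.
  - by have := @sin_gt0_pi R d; rewrite dp dpi sd ltxx => /(_ isT).
  - have := @sin_gt0_pi R (d - pi); have := @sinDpi R (d - pi).
    rewrite subrK sd => h; rewrite subr_gt0 dpi ltrBlDr -mulr2n k1 => /(_ isT).
    by rewrite -[sin _]opprK -h oppr0 ltxx.
  - by move: cd; rewrite dpi cospi; lra.
exists (- k); rewrite intrN mulrN.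
by have : t' - t + pi *+ 2 * k%:~R = 0 := d0; lra.
Qed.

Definition facing t0 a := a 0 0 * cos t0 + a 0 1 * sin t0.
(** The branch of the polar angle on the open half plane of the points facing the
    direction [t0]: rotate by [- t0], then the tangent determines the angle. *)
Definition local_angle t0 a :=
  t0 + atan ((a 0 1 * cos t0 - a 0 0 * sin t0) / facing t0 a).

Lemma local_angle_near t0 a :
  - (pi / 2) < local_angle t0 a - t0 < pi / 2.
Proof. by rewrite /local_angle addrAC subrr add0r atan_gtNpi2 atan_ltpi2. Qed.

Lemma facing_circ t0 t : facing t0 (circ t) = cos (t - t0).
Proof. by rewrite /facing circ0 circ1 cosB. Qed.

Lemma facing_near t0 t : - (pi / 2) < t - t0 < pi / 2 -> 0 < facing t0 (circ t).
Proof. by move=> h; rewrite facing_circ; apply: cos_gt0_pihalf. Qed.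

Lemma local_angle_circ t0 t : - (pi / 2) < t - t0 < pi / 2 ->
  local_angle t0 (circ t) = t.
Proof.
move=> h; rewrite /local_angle facing_circ circ0 circ1 -sinB -/(tan (t - t0)).
by rewrite tanK ?in_itv // addrC subrK.
Qed.

Lemma circ_local_angle t0 a : dot a a = 1 -> 0 < facing t0 a ->
  circ (local_angle t0 a) = a.
Proof.
move=> /unit_circle_angle[t ->] h; rewrite facing_circ in h.
set u := cos (t - t0) in h; set v := sin (t - t0).
have uv : u ^+ 2 + v ^+ 2 = 1 by exact: cos2Dsin2.
have e : local_angle t0 (circ t) = t0 + atan (v / u).
  by rewrite /local_angle facing_circ circ0 circ1 -sinB.
have c : cos (atan (v / u)) = u.
  rewrite cos_atan (_ : 1 + (v / u) ^+ 2 = (u^-1) ^+ 2).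
    by rewrite sqrtr_sqr gtr0_norm ?invr_gt0 // invrK.
  have -> : 1 + (v / u) ^+ 2 = (u ^+ 2 + v ^+ 2) * u^-1 ^+ 2.
    by field; rewrite gt_eqF.
  by rewrite uv mul1r.
have s : sin (atan (v / u)) = v.
  have := @atanK R (v / u); rewrite /tan c => h2.
  by apply: (mulIf _ h2); rewrite invr_eq0 gt_eqF.
have te : t = t0 + (t - t0) by ring.
by apply: rV2P; rewrite ?circ0 ?circ1 e ?cosD ?sinD c s /u /v -?cosD -?sinD -te.
Qed.

Lemma Cn_circ (V : normedModType R) (U : set V) (f : V -> R) j : open U ->
  Cn j U f -> Cn j U (fun w => circ (f w)).
Proof.
move=> oU hf; apply: Cn_rV => // i.
have UT w : U w -> setT (f w) by [].
have [hs hc] := Cn_sin_cos j (@openT R).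
case: (eqVneq i 0) => i0.
  by apply: (Cn_eq oU _ (Cn_comp oU UT hf hc)) => w _; rewrite mxE i0.
by apply: (Cn_eq oU _ (Cn_comp oU UT hf hs)) => w _; rewrite mxE (negPf i0).
Qed.

Lemma Cn_facing (V : normedModType R) (U : set V) (f : V -> 'rV[R]_2) t0 j :
  open U -> Cn j U f -> Cn j U (fun w => facing t0 (f w)).
Proof.
move=> oU hf; rewrite /facing.
by apply: Cn_add => //; apply: Cn_mul => //;
  [exact: Cn_coord_comp|exact: Cn_cst|exact: Cn_coord_comp|exact: Cn_cst].
Qed.

Lemma Cn_local_angle (V : normedModType R) (U : set V) (f : V -> 'rV[R]_2) t0 j :
  open U -> Cn j U f -> (forall w, U w -> 0 < facing t0 (f w)) ->
  Cn j U (fun w => local_angle t0 (f w)).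
Proof.
move=> oU hf pos; apply: Cn_add; [exact: oU|exact: Cn_cst|].
have h : Cn j U (fun w =>
    (f w 0 1 * cos t0 - f w 0 0 * sin t0) / facing t0 (f w)).
  apply: Cn_div => //; [by move=> w /pos h; rewrite gt_eqF| |exact: Cn_facing].
  by apply: Cn_sub_fun => //; apply: Cn_mul => //;
    [exact: Cn_coord_comp|exact: Cn_cst|exact: Cn_coord_comp|exact: Cn_cst].
have UT w : U w -> setT ((f w 0 1 * cos t0 - f w 0 0 * sin t0) / facing t0 (f w)).
  by [].
exact: (Cn_comp oU UT h (@Cn_atan R j)).
Qed.

Lemma Cn_lsubmx (V : normedModType R) m k (U : set V) (f : V -> 'rV[R]_(m + k)) j :
  open U -> Cn j U f -> Cn j U (fun w => lsubmx (f w)).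
Proof.
move=> oU hf; apply: Cn_rV => // i.
by apply: (Cn_eq oU _ (Cn_coord_comp 0 (lshift k i) oU hf)) => w _; rewrite mxE.
Qed.

Lemma Cn_rsubmx (V : normedModType R) m k (U : set V) (f : V -> 'rV[R]_(m + k)) j :
  open U -> Cn j U f -> Cn j U (fun w => rsubmx (f w)).
Proof.
move=> oU hf; apply: Cn_rV => // i.
by apply: (Cn_eq oU _ (Cn_coord_comp 0 (rshift m i) oU hf)) => w _; rewrite mxE.
Qed.

Lemma Cn_dot (V : normedModType R) k (U : set V) (f g : V -> 'rV[R]_k) j :
  open U -> Cn j U f -> Cn j U g -> Cn j U (fun w => dot (f w) (g w)).
Proof.
move=> oU hf hg; apply: Cn_sum => // i.
by apply: Cn_mul => //; exact: Cn_coord_comp.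
Qed.

End Angles.

(** * Preimages and embeddings of compact sets *)

Section OpenSets.
Variables (R : realType) (V W : normedModType R).

Lemma open_preimage (U : set V) (f : V -> W) (O : set W) :
  open U -> Cn 0 U f -> open O -> open (U `&` f @^-1` O).
Proof.
move=> oU cf oO; rewrite openE => x [Ux Ofx]; apply: filterI.
  exact: open_nbhs_nbhs.
apply: (cf x Ux); exact: open_nbhs_nbhs.
Qed.

Lemma smooth_on_continuous (A : set V) (f : V -> W) :
  smooth_on A f -> {within A, continuous f}.
Proof.
move=> h; apply/subspace_continuousP => p Ap.
have [U [g [oU Up sg fg]]] := h p Ap.
have cg : g w @[w --> p] --> g p := sg 0%N p Up.
suff : f w @[w --> within A (nbhs p)] --> g p by rewrite -(fg p Ap Up).
have cw : g w @[w --> within A (nbhs p)] --> g p by exact: cvg_within_filter cg.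
apply: cvg_trans cw.
apply: near_eq_cvg; near=> w; symmetry; apply: fg.
  by near: w; exact: withinT.
by near: w; apply: cvg_within; exact: open_nbhs_nbhs.
Unshelve. all: by end_near. Qed.

Lemma smooth_on_global (A : set V) (f : V -> W) : smooth setT f -> smooth_on A f.
Proof. by move=> sf x Ax; exists setT, f; split=> //; exact: openT. Qed.

End OpenSets.

Section CompactInverse.
Variables (S T : topologicalType).

(** The inverse is continuous because closed subsets of the compact set have
    compact, hence closed, images. *)
Lemma compact_inverse (K : set S) (X : S -> T) (p0 : S) :
  hausdorff_space T -> compact K ->
  {within K, continuous X} -> {in K &, injective X} ->
  exists2 Y : T -> S, {within X @` K, continuous Y} & forall p, K p -> Y (X p) = p.
Proof.
move=> hT cK cX iX.
have /choice[Y hY] : forall q, exists p, (X @` K) q -> K p /\ X p = q.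
  move=> q; case: (pselect ((X @` K) q)) => [[p Kp e]|n]; first by exists p.
  by exists p0.
have YX p : K p -> Y (X p) = p.
  move=> Kp; have [|h1 h2] := hY (X p); first by exists p.
  by apply: iX; rewrite ?inE.
exists Y => //; apply/continuous_closedP => C cC.
apply/closed_subspaceP; exists (X @` (K `&` C)).
  apply: compact_closed => //; apply: continuous_compact.
    exact: (continuous_subspaceW (@subIsetl _ K C) cX).
  by apply: compact_closedI.
apply/seteqP; split=> q [].
  move=> [p [Kp Cp] <-] h; split; last exact: h.
  by suff : C (Y (X p)) by []; rewrite YX.
move=> CY [p Kp e]; split; last by exists p.
by exists p => //; split => //; rewrite -(YX p Kp) e.
Qed.

End CompactInverse.

(** * The standard torus as a manifold *)

Section StandardTorus.
Variables (R : realType) (n : nat).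
Let T := @standard_torus R n.

Lemma torusP (p : 'rV[R]_(2 + n)) : T p <->
  dot (lsubmx p) (lsubmx p) = 1 /\ dot (rsubmx p) (rsubmx p) = 1.
Proof.
split=> [[a ha [b hb <-]]|[h1 h2]]; first by rewrite row_mxKl row_mxKr.
by exists (lsubmx p) => //; exists (rsubmx p) => //; rewrite hsubmxK.
Qed.

Lemma coord_le_dot k (a : 'rV[R]_k) i : dot a a = 1 -> `|a 0 i| <= 1.
Proof.
move=> h; rewrite -(@expr_le1 _ 2) // -normrX ger0_norm ?sqr_ge0 // -h.
rewrite /dot (bigD1 i) //= -expr2 lerDl.
by apply: sumr_ge0 => j _; rewrite -expr2 sqr_ge0.
Qed.

Lemma torus_compact : compact T.
Proof.
apply: bounded_closed_compact.
  exists 1; split=> // M M1 p /torusP[h1 h2].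
  rewrite /Num.Def.normr /= mx_normrE; apply: bigmax_le => [|[i j] _ /=].
    by apply: ltW; apply: lt_trans M1.
  apply: le_trans (ltW M1); rewrite ord1 -[p]hsubmxK.
  by case: (split_ordP j) => j' ->; rewrite ?row_mxEl ?row_mxEr; apply: coord_le_dot.
have -> : T = (fun p => dot (lsubmx p) (lsubmx p)) @^-1` [set 1 : R] `&`
              (fun p => dot (rsubmx p) (rsubmx p)) @^-1` [set 1 : R].
  by apply/seteqP; split=> p; [move=> /torusP[]|move=> [? ?]; apply/torusP].
have c1 : Cn 0 setT (fun p : 'rV[R]_(2 + n) => dot (lsubmx p) (lsubmx p)).
  have oT := @openT 'rV[R]_(2 + n); have h := Cn_lsubmx oT (@Cn_idrV R _ _ 0%N oT).
  exact: (Cn_dot oT h h).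
have c2 : Cn 0 setT (fun p : 'rV[R]_(2 + n) => dot (rsubmx p) (rsubmx p)).
  have oT := @openT 'rV[R]_(2 + n); have h := Cn_rsubmx oT (@Cn_idrV R _ _ 0%N oT).
  exact: (Cn_dot oT h h).
apply: closedI; apply: preimage_closed.
- by move=> p _; exact: c1.
- exact: closed_eq.
- by move=> p _; exact: c2.
- exact: closed_eq.
Qed.

Lemma open_pos (V : normedModType R) (f : V -> R) :
  Cn 0 setT f -> open [set w | 0 < f w].
Proof.
move=> cf; have := open_preimage (@openT V) cf (@open_gt R 0).
by rewrite setTI.
Qed.

End StandardTorus.

Section Stereographic.
Variables (R : realType) (q : nat).

(** The inverse of the stereographic projection from the pole [(e, 0)], where [e]
    is 1 or -1. *)
Definition stereo (e : R) (z : 'rV[R]_q) : 'rV[R]_(1 + q) :=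
  row_mx (e * (dot z z - 1) / (dot z z + 1))%:M ((2 / (dot z z + 1)) *: z).

Definition unstereo (e : R) (b : 'rV[R]_(1 + q)) : 'rV[R]_q :=
  (1 - e * b 0 0)^-1 *: rsubmx b.

Let dz1 (z : 'rV[R]_q) : 0 < dot z z + 1.
Proof. by rewrite ltr_wpDl // dot_ge0. Qed.

Let head (b : 'rV[R]_(1 + q)) : (lsubmx b : 'rV[R]_1) = (b 0 0)%:M.
Proof.
apply/rowP => i; rewrite !ord1 !mxE mulr1n; congr (b _ _).
exact/val_inj.
Qed.

Let head_row (a : R) (y : 'rV[R]_q) : (row_mx (a%:M : 'rV[R]_1) y) 0 0 = a.
Proof.
have -> : (0 : 'I_(1 + q)) = lshift q (0 : 'I_1) by exact/val_inj.
by rewrite row_mxEl mxE mulr1n.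
Qed.

Lemma stereo_unit e z : e ^+ 2 = 1 -> dot (stereo e z) (stereo e z) = 1.
Proof.
move=> e1; rewrite /stereo dot_row_mx dot_scalar dotZl dotZr.
have := dz1 z; move: (dot z z) => d d0.
have -> : e * (d - 1) / (d + 1) * (e * (d - 1) / (d + 1)) =
  e ^+ 2 * ((d - 1) / (d + 1)) ^+ 2 by ring.
by rewrite e1; field; rewrite gt_eqF.
Qed.

Lemma stereo_pole e z : e ^+ 2 = 1 -> 1 - e * stereo e z 0 0 = 2 / (dot z z + 1).
Proof.
move=> e1; rewrite /stereo head_row; have := dz1 z; move: (dot z z) => d d0.
have -> : e * (e * (d - 1) / (d + 1)) = e ^+ 2 * ((d - 1) / (d + 1)) by ring.
by rewrite e1; field; rewrite gt_eqF.
Qed.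

Lemma stereoK e (z : 'rV[R]_q) : e ^+ 2 = 1 -> unstereo e (stereo e z) = z.
Proof.
move=> e1; rewrite /unstereo stereo_pole // row_mxKr scalerA mulVf ?scale1r //.
by rewrite mulf_neq0 // invr_eq0 gt_eqF.
Qed.

Lemma unstereoK e (b : 'rV[R]_(1 + q)) : e ^+ 2 = 1 -> dot b b = 1 -> 0 < 1 - e * b 0 0 ->
  stereo e (unstereo e b) = b.
Proof.
move=> e1 b1 pos; rewrite /stereo /unstereo dotZl dotZr scalerA.
have b2 : dot (rsubmx b) (rsubmx b) = (1 - e * b 0 0) * (1 + e * b 0 0).
  move: b1; rewrite -{1 2}[b]hsubmxK dot_row_mx head dot_scalar => h.
  have -> : (1 - e * b 0 0) * (1 + e * b 0 0) = 1 - e ^+ 2 * (b 0 0 * b 0 0) by ring.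
  by rewrite e1; lra.
rewrite b2; set m := e * b 0 0 in pos *.
have m0 : 1 - m != 0 by rewrite gt_eqF.
have -> : (1 - m)^-1 * ((1 - m)^-1 * ((1 - m) * (1 + m))) = (1 + m) / (1 - m).
  by field.
have -> : (1 + m) / (1 - m) + 1 = 2 / (1 - m) by field.
have -> : (1 + m) / (1 - m) - 1 = 2 * m / (1 - m) by field.
have -> : e * (2 * m / (1 - m)) / (2 / (1 - m)) = b 0 0.
  have -> : e * (2 * m / (1 - m)) / (2 / (1 - m)) = e * m by field.
  by rewrite /m mulrA -expr2 e1 mul1r.
have -> : 2 / (2 / (1 - m)) * (1 - m)^-1 = 1 by field.
by rewrite scale1r -head hsubmxK.
Qed.

Variables (V : normedModType R) (U : set V).
Hypothesis oU : open U.

Lemma Cn_stereo e (f : V -> 'rV[R]_q) j : Cn j U f -> Cn j U (fun w => stereo e (f w)).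
Proof.
move=> hf; have hd : Cn j U (fun w => dot (f w) (f w)) by exact: Cn_dot.
have hd1 : Cn j U (fun w => dot (f w) (f w) + 1) by apply: Cn_add => //; exact: Cn_cst.
have n0 w : U w -> dot (f w) (f w) + 1 != 0 by rewrite gt_eqF.
apply: Cn_row_mx => //; first apply: Cn_scalar => //.
  apply: Cn_div => //; apply: Cn_mul => //; first exact: Cn_cst.
  by apply: Cn_sub_fun => //; exact: Cn_cst.
by apply: Cn_scale_row => //; apply: Cn_div => //; exact: Cn_cst.
Qed.

Lemma Cn_unstereo e (f : V -> 'rV[R]_(1 + q)) j : Cn j U f ->
  (forall w, U w -> 0 < 1 - e * f w 0 0) -> Cn j U (fun w => unstereo e (f w)).
Proof.
move=> hf pos; apply: Cn_scale_row => //; last exact: Cn_rsubmx.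
have h : Cn j U (fun w => 1 - e * f w 0 0).
  apply: Cn_sub_fun => //; first exact: Cn_cst.
  by apply: Cn_mul => //; [exact: Cn_cst|exact: Cn_coord_comp].
have n0 w : U w -> [set t : R | t != 0] (1 - e * f w 0 0).
  by move=> /pos; rewrite /= => h'; rewrite gt_eqF.
exact: (Cn_comp oU n0 h (Cn_inv R j)).
Qed.

End Stereographic.

Section TorusManifold.
Variables (R : realType) (q : nat).
Let T := @standard_torus R (1 + q).

(** Around [p = (a, b)], a branch of the polar angle of [a] and the stereographic
    projection of [b] from a pole different from [b] are coordinates. *)
Lemma torus_manifold : manifold (1 + q) T.
Proof.
move=> p Tp; have /torusP[a1 b1] := Tp.
have [t0 at0] := unit_circle_angle a1.
have [e e1 ep] : exists2 e : R, e ^+ 2 = 1 & 0 < 1 - e * (rsubmx p) 0 0.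
  case: (ltP ((rsubmx p) 0 0) 1) => h.
    by exists 1; rewrite ?expr1n // mul1r subr_gt0.
  by exists (- 1); [rewrite sqrrN expr1n|lra].
pose phi (u : 'rV[R]_(1 + q)) : 'rV[R]_(2 + (1 + q)) :=
  row_mx (circ (u 0 0)) (stereo e (rsubmx u)).
pose psi (y : 'rV[R]_(2 + (1 + q))) : 'rV[R]_(1 + q) :=
  row_mx (local_angle t0 (lsubmx y))%:M (unstereo e (rsubmx y)).
pose V := [set u : 'rV[R]_(1 + q) | 0 < pi / 2 - (u 0 0 - t0)] `&`
          [set u : 'rV[R]_(1 + q) | 0 < (u 0 0 - t0) + pi / 2].
pose O := [set y : 'rV[R]_(2 + (1 + q)) | 0 < facing t0 (lsubmx y)] `&`
          [set y : 'rV[R]_(2 + (1 + q)) | 0 < 1 - e * (rsubmx y) 0 0].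
have oT1 := @openT 'rV[R]_(1 + q); have oT2 := @openT 'rV[R]_(2 + (1 + q)).
have oV : open V.
  have h : Cn 0 setT (fun u : 'rV[R]_(1 + q) => u 0 0 - t0).
    by apply: Cn_sub_fun => //; [exact: Cn_coord|exact: Cn_cst].
  apply: openI; apply: open_pos.
    by apply: Cn_sub_fun => //; exact: Cn_cst.
  by apply: Cn_add => //; exact: Cn_cst.
have oO : open O.
  have hid := @Cn_idrV R _ _ 0%N oT2.
  apply: openI; apply: open_pos.
    exact: (Cn_facing t0 oT2 (Cn_lsubmx oT2 hid)).
  apply: (Cn_sub_fun oT2 (Cn_cst _ _ _)); apply: (Cn_mul oT2 (Cn_cst _ _ _)).
  exact: (Cn_coord_comp 0 0 oT2 (Cn_rsubmx oT2 hid)).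
have Vnear u : V u -> - (pi / 2) < u 0 0 - t0 < pi / 2.
  by move=> [/= h1 h2]; apply/andP; split; lra.
have phiT u : T (phi u).
  by apply/torusP; rewrite row_mxKl row_mxKr dot_circ stereo_unit.
have phiO u : V u -> O (phi u).
  move=> Vu; split; rewrite /= ?row_mxKl ?row_mxKr.
    exact/facing_near/Vnear.
  by rewrite stereo_pole // divr_gt0 // ltr_wpDl // dot_ge0.
have psiK u : V u -> psi (phi u) = u.
  move=> Vu; rewrite /psi /phi row_mxKl row_mxKr stereoK // local_angle_circ ?Vnear //.
  rewrite -[RHS](@hsubmxK _ _ 1 q); congr row_mx.
  apply/rowP => i; rewrite !ord1 !mxE mulr1n; congr (u _ _); exact/val_inj.
have psi0 y : psi y 0 0 = local_angle t0 (lsubmx y).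
  have -> : (0 : 'I_(1 + q)) = lshift q (0 : 'I_1) by exact/val_inj.
  by rewrite row_mxEl mxE mulr1n.
have phiK y : T y -> O y -> V (psi y) /\ phi (psi y) = y.
  move=> /torusP[y1 y2] [/= h1 h2]; split.
    by have /andP[? ?] := local_angle_near t0 (lsubmx y); split; rewrite /= psi0; lra.
  rewrite /phi psi0 circ_local_angle // /psi row_mxKr unstereoK //.
  exact: hsubmxK.
have img : phi @` V = T `&` O.
  apply/seteqP; split=> [y [u Vu <-]|y [Ty Oy]].
    by split; [exact: phiT|exact: phiO].
  by have [h1 h2] := phiK y Ty Oy; exists (psi y).
have Op : O p by split=> //=; rewrite at0 facing_circ subrr cos0.
exists V, phi; split; last by rewrite img; split.
split=> //.
- move=> j; apply: (Cn_row_mx oV); first exact: (Cn_circ oV (Cn_coord 0 0 j oV)).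
  exact: (Cn_stereo oV e (@Cn_rsubmx _ _ 1 q _ _ _ oV (@Cn_idrV R _ _ j oV))).
- by exists O.
exists psi => // y; rewrite img => -[Ty Oy].
exists O, psi; split=> // j.
have hid := @Cn_idrV R _ _ j oO.
have hfac w : O w -> 0 < facing t0 (lsubmx w) by case.
have hpole w : O w -> 0 < 1 - e * (rsubmx w) 0 0 by case.
apply: (Cn_row_mx oO).
  exact: (Cn_scalar oO (Cn_local_angle oO (Cn_lsubmx oO hid) hfac)).
exact: (Cn_unstereo oO (Cn_rsubmx oO hid) hpole).
Qed.

End TorusManifold.

(** * The torus swept out by the closed profile *)

Section LocalParam.
Variables (R : realType) (m k : nat) (M : set 'rV[R]_k).
Variables (V : set 'rV[R]_m) (phi : 'rV[R]_m -> 'rV[R]_k).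
Hypothesis lp : local_param M V phi.

Lemma local_param_in u : V u -> M (phi u).
Proof.
move=> Vu; case: lp => _ _ [Q _ e] _.
by have := imageP phi Vu; rewrite e => -[].
Qed.

(** A parametrization has locally a smooth left inverse. *)
Lemma local_param_inj u (v : 'rV[R]_m) : V u -> 'D_v phi u = 0 -> v = 0.
Proof.
move=> Vu dv0; case: lp => oV sphi _ [psi spsi psiK].
have [U [g [oU Uu sg eg]]] := spsi (phi u) (imageP phi Vu).
have [dphi _] := sphi 1%N; have [dg _] := sg 1%N.
have Dphi := dphi u Vu; have Dg := dg _ Uu.
have oW : open (V `&` phi @^-1` U) := open_preimage oV (sphi 0%N) oU.
have e : \forall w \near u, g (phi w) = w.
  have : \forall w \near u, (V `&` phi @^-1` U) w by exact: open_nbhs_nbhs.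
  apply: filterS => w [Vw Uw]; rewrite -(eg (phi w)) ?psiK //; exact: imageP.
have h1 : 'D_v (fun w => g (phi w)) u = 'D_v (fun w => w) u.
  exact: near_eq_derive.
move: h1; rewrite derive_id => <-.
rewrite deriveE; last exact: differentiable_comp.
rewrite (@diff_comp _ _ _ _ phi g) //=.
by rewrite -(deriveE v Dphi) dv0 linear0.
Qed.

End LocalParam.

Section Assembly.
Variables (R : realType) (lam : R) (q : nat) (x r th : R -> R) (l : R).
Hypothesis l0 : 0 < l.
Hypothesis prof : forall t, profile_at lam q%:R x r th t.
Hypothesis sym : forall t, [/\ x (- t) = - x t, r (- t) = r t & th (- t) = - th t].
Hypothesis per : forall t, [/\ x (t + 2 * l) = x t, r (t + 2 * l) = r t &
  th (t + 2 * l) = th t + pi *+ 2].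
Hypothesis pos : forall t, 0 < t < l -> 0 < x t /\ 0 < th t < pi.
Let n := (1 + q)%N.
Let T := @standard_torus R n.

Let dx (t : R) : is_derive t 1 x (cos (th t)). Proof. by case: (prof t). Qed.
Let dr (t : R) : is_derive t 1 r (sin (th t)). Proof. by case: (prof t). Qed.
Let dth (t : R) : is_derive t 1 th (curvature lam q%:R (x t) (r t) (th t)).
Proof. by case: (prof t). Qed.
Let r_gt0 t : 0 < r t. Proof. by case: (prof t). Qed.

(** The right-hand side of the equation is as smooth as the solution. *)
Lemma profile_smooth j : [/\ Cn j setT x, Cn j setT r & Cn j setT th].
Proof.
have oT := @openT R.
elim: j => [|j [hx hr ht]].
  split; [exact: (@Cn0_derive _ _ _ (fun t => cos (th t)))|
    exact: (@Cn0_derive _ _ _ (fun t => sin (th t)))|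
    exact: (@Cn0_derive _ _ _ (fun t => curvature lam q%:R (x t) (r t) (th t)))].
have [hs hc] := Cn_sin_cos j oT.
have TT t : setT t -> setT (th t) by [].
have hsin : Cn j setT (fun t => sin (th t)) := Cn_comp oT TT ht hs.
have hcos : Cn j setT (fun t => cos (th t)) := Cn_comp oT TT ht hc.
split.
- exact: (Cn_derive oT (fun t _ => dx t) hcos).
- exact: (Cn_derive oT (fun t _ => dr t) hsin).
have hk : Cn j setT (fun t => curvature lam q%:R (x t) (r t) (th t)).
  apply: (Cn_sub_fun oT (Cn_add oT (Cn_cst _ lam j) (Cn_mul oT hx hsin))).
  apply: (Cn_mul oT _ hcos); apply: (Cn_sub_fun oT hr).
  by apply: (Cn_div oT _ (Cn_cst _ _ j) hr) => t _; rewrite gt_eqF.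
exact: (Cn_derive oT (fun t _ => dth t) hk).
Qed.

Let N1 t := - sin (th t).
Let N2 t := cos (th t).

Lemma gauss_smooth j : Cn j setT N1 /\ Cn j setT N2.
Proof.
have oT := @openT R; have [_ _ ht] := profile_smooth j.
have [hs hc] := Cn_sin_cos j oT.
have TT t : setT t -> setT (th t) by [].
by split; [exact: (Cn_opp oT (Cn_comp oT TT ht hs))|exact: (Cn_comp oT TT ht hc)].
Qed.

Let xper t : x (t + 2 * l) = x t. Proof. by case: (per t). Qed.
Let rper t : r (t + 2 * l) = r t. Proof. by case: (per t). Qed.
Let N1per t : N1 (t + 2 * l) = N1 t.
Proof. by rewrite /N1; case: (per t) => _ _ ->; rewrite sinD2pi. Qed.
Let N2per t : N2 (t + 2 * l) = N2 t.
Proof. by rewrite /N2; case: (per t) => _ _ ->; rewrite cosD2pi. Qed.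

(** On the half period [[0, l]] the radius is strictly increasing and [x] is
    nonnegative; the other half is its mirror image, with [x] negative inside. *)
Lemma profile_simple s t : x s = x t -> r s = r t ->
  exists k : int, t = s + (2 * l) * k%:~R.
Proof.
have incr a b : 0 <= a -> a < b -> b <= l -> r a < r b.
  move=> a0 ab bl; apply: (@dv_lt _ r (fun t => sin (th t)) _ _ ab) => u.
    by move=> _; exact: dr.
  move=> /andP[au ub]; have [|_ hu] := pos (t := u); last exact: sin_gt0_pi.
  by apply/andP; split; lra.
have x0 : x 0 = 0.
  by have [] := sym 0; rewrite oppr0 => h _ _; lra.
have xl : x l = 0.
  have [h _ _] := sym l; have := xper (- l).
  by rewrite (_ : - l + 2 * l = l); [rewrite h; lra|ring].
have xge a : 0 <= a <= l -> 0 <= x a.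
  move=> /andP[a0 al]; case: (ltgtP a 0) => [|a0'|->]; [lra| |by rewrite x0].
  case: (ltgtP a l) => [al'| |->]; [|lra|by rewrite xl].
  by have [|/ltW//] := pos (t := a); rewrite a0'.
have fold a : x (2 * l - a) = - x a /\ r (2 * l - a) = r a.
  have [h1 h2 _] := sym a; rewrite addrC xper rper.
  by split; [exact: h1|exact: h2].
have xlt a : l < a < 2 * l -> x a < 0.
  move=> /andP[a1 a2]; have [h _] := fold a.
  by have [|h2 _] := pos (t := 2 * l - a); [apply/andP; split; lra|lra].
have inj a b : 0 <= a <= l -> 0 <= b <= l -> r a = r b -> a = b.
  move=> /andP[a0 al] /andP[b0 bl] e; case: (ltgtP a b) => // h.
    by have := incr a b a0 h bl; rewrite e ltxx.
  by have := incr b a b0 h al; rewrite e ltxx.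
have l2 : 0 < 2 * l by rewrite mulr_gt0.
have [ks /andP[s0 s1]] := reduce_period s l2.
have [kt /andP[t0 t1]] := reduce_period t l2.
rewrite -(periodic_int xper ks s) -(periodic_int rper ks s).
rewrite -(periodic_int xper kt t) -(periodic_int rper kt t).
set a := s + _ in s0 s1 *; set b := t + _ in t0 t1 * => ex er.
suff ab : a = b.
  exists (ks - kt); rewrite intrB mulrBr.
  by have := ab; rewrite /a /b; lra.
case: (leP a l) => al; case: (leP b l) => bl.
- by apply: inj => //; rewrite ?s0 ?t0.
- have h1 : 0 <= x a by apply: xge; rewrite s0.
  by have h2 : x b < 0; [apply: xlt; rewrite bl|lra].
- have h1 : 0 <= x b by apply: xge; rewrite t0.
  by have h2 : x a < 0; [apply: xlt; rewrite al|lra].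
have [_ ra] := fold a; have [_ rb] := fold b.
suff : 2 * l - a = 2 * l - b by lra.
by apply: inj; rewrite ?ra ?rb //; apply/andP; split; lra.
Qed.

Variable arg : 'rV[R]_2 -> R.
Hypothesis argK : forall a, dot a a = 1 -> circ (arg a) = a.
Let kap := l / pi.
Let S (p : 'rV[R]_(2 + n)) := kap * arg (lsubmx p).
Let b (p : 'rV[R]_(2 + n)) : 'rV[R]_n := rsubmx p.
(** [arg] is any choice of the polar angle, possibly discontinuous; the factor
    [kap] turns the angle period [2 * pi] into the period [2 * l] of the profile.
    A [2 * l]-periodic function of the arc [S p] does not depend on the
    choice. *)
Definition torus_map (f g : R -> R) : 'rV[R]_(2 + n) -> 'rV[R]_(1 + n) :=
  rotate S b f g.

Let kap0 : kap != 0.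
Proof. by rewrite gt_eqF // divr_gt0 // pi_gt0. Qed.

Let pin : pi != 0 :> R. Proof. by rewrite gt_eqF // pi_gt0. Qed.

Let period_scale (k : int) : kap * (pi *+ 2 * k%:~R) = 2 * l * k%:~R.
Proof.
by rewrite mulrA -[pi *+ 2]mulr_natr mulrA divfK ?pin // [l * _]mulrC.
Qed.

Let same_point (f : R -> R) t t' : (forall u, f (u + 2 * l) = f u) ->
  circ t = circ t' -> f (kap * t) = f (kap * t').
Proof.
move=> pf /same_angle[k ->].
rewrite mulrDr period_scale.
by rewrite (periodic_int pf).
Qed.

(** A branch of the angle that is smooth near [p] gives the same value, by
    periodicity. *)
Lemma torus_map_local (f g : R -> R) t0 (p : 'rV[R]_(2 + n)) :
  (forall u, f (u + 2 * l) = f u) -> (forall u, g (u + 2 * l) = g u) ->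
  T p -> 0 < facing t0 (lsubmx p) ->
  torus_map f g p = rotate (fun p => kap * local_angle t0 (lsubmx p)) b f g p.
Proof.
move=> pf pg /torusP[p1 _] h; rewrite /torus_map /rotate /S.
have e : circ (arg (lsubmx p)) = circ (local_angle t0 (lsubmx p)).
  by rewrite argK // circ_local_angle.
by rewrite (same_point pf e) (same_point pg e).
Qed.

Lemma facing_arg p : T p -> 0 < facing (arg (lsubmx p)) (lsubmx p).
Proof. by move=> /torusP[p1 _]; rewrite -{2}(argK p1) facing_circ subrr cos0. Qed.

(** The torus maps read in a smooth family [phi] of points of the torus: where
    [phi] faces the direction [t0] they are the rotations of a curve with smooth
    arc [along_arc] and direction [along_dir]. *)
Section Along.
Variables (V' : normedModType R) (V : set V') (phi : V' -> 'rV[R]_(2 + n)).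
Hypotheses (oV : open V) (sphi : smooth V phi) (phiT : forall w, V w -> T (phi w)).
Variable t0 : R.
Definition along := V `&` phi @^-1` [set p | 0 < facing t0 (lsubmx p)].
Definition along_arc w := kap * local_angle t0 (lsubmx (phi w)).
Definition along_dir w : 'rV[R]_n := rsubmx (phi w).

Lemma along_open : open along.
Proof.
apply: (open_preimage oV (sphi 0%N)); apply: open_pos.
have oT2 := @openT 'rV[R]_(2 + n).
exact: (Cn_facing t0 oT2 (Cn_lsubmx oT2 (@Cn_idrV R _ _ 0%N oT2))).
Qed.

Lemma along_arc_smooth j : Cn j along along_arc.
Proof.
have oA := along_open; have VA : along `<=` V by move=> w [].
have h := Cn_sub VA (sphi j).
have hf w : along w -> 0 < facing t0 (lsubmx (phi w)) by case.
apply: (Cn_mul oA (Cn_cst _ _ _)).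
exact: (Cn_local_angle oA (Cn_lsubmx oA h) hf).
Qed.

Lemma along_dir_smooth j : Cn j along along_dir.
Proof.
have oA := along_open; have VA : along `<=` V by move=> w [].
exact: (Cn_rsubmx oA (Cn_sub VA (sphi j))).
Qed.

Lemma along_map (f g : R -> R) w :
  (forall u, f (u + 2 * l) = f u) -> (forall u, g (u + 2 * l) = g u) ->
  along w -> torus_map f g (phi w) = rotate along_arc along_dir f g w.
Proof. by move=> pf pg [Vw h]; rewrite (torus_map_local pf pg (phiT Vw) h). Qed.

Lemma along_map_smooth (f g : R -> R) j :
  (forall u, f (u + 2 * l) = f u) -> (forall u, g (u + 2 * l) = g u) ->
  Cn j setT f -> Cn j setT g -> Cn j along (torus_map f g \o phi).
Proof.
move=> pf pg sf sg; have oA := along_open.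
have h := Cn_rotate oA (along_arc_smooth j) (along_dir_smooth j) sf sg.
by apply: (Cn_eq oA _ h) => w Aw; rewrite /= (along_map pf pg Aw).
Qed.

End Along.

Lemma torus_map_smooth (f g : R -> R) :
  (forall u, f (u + 2 * l) = f u) -> (forall u, g (u + 2 * l) = g u) ->
  (forall j, Cn j setT f) -> (forall j, Cn j setT g) -> smooth_on T (torus_map f g).
Proof.
move=> pf pg sf sg p Tp; have oT2 := @openT 'rV[R]_(2 + n).
pose t0 := arg (lsubmx p).
pose s (y : 'rV[R]_(2 + n)) := kap * local_angle t0 (lsubmx y).
pose O := [set y : 'rV[R]_(2 + n) | 0 < facing t0 (lsubmx y)].
have oO : open O.
  apply: open_pos.
  exact: (Cn_facing t0 oT2 (Cn_lsubmx oT2 (@Cn_idrV R _ _ 0%N oT2))).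
exists O, (rotate s b f g); split=> //; first exact: facing_arg.
  move=> j; have hid := @Cn_idrV R _ _ j oO.
  have hO w : O w -> 0 < facing t0 (lsubmx w) by [].
  apply: (Cn_rotate oO _ (Cn_rsubmx oO hid) (sf j) (sg j)).
  apply: (Cn_mul oO (Cn_cst _ _ _)).
  exact: (Cn_local_angle oO (Cn_lsubmx oO hid) hO).
by move=> y Ty Oy; apply: torus_map_local.
Qed.

Let X := torus_map x r.
Let N := torus_map N1 N2.

Lemma torus_X_smooth : smooth_on T X.
Proof.
by apply: torus_map_smooth => // j; case: (profile_smooth j).
Qed.

Lemma torus_N_smooth : smooth_on T N.
Proof.
by apply: torus_map_smooth => // j; case: (gauss_smooth j).
Qed.

Lemma torus_N_unit p : T p -> dot (N p) (N p) = 1.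
Proof.
move=> /torusP[_ p2]; rewrite /N /torus_map /rotate dot_row_mx dot_scalar.
rewrite dotZl dotZr p2 mulr1 /N1 /N2.
by have := cos2Dsin2 (th (S p)); rewrite !expr2 mulrNN addrC.
Qed.

(** The profile curve is simple and stays off the axis of rotation, so a point
    of the image determines the arc up to periods, and the direction. *)
Lemma torus_X_inj : {in T &, injective X}.
Proof.
move=> p p'; rewrite !inE => /torusP[a1 b1] /torusP[a2 b2] e.
have ex : x (S p) = x (S p').
  have := congr1 (@lsubmx _ _ 1 n) e; rewrite !row_mxKl.
  by move=> /(congr1 (fun M : 'rV[R]_1 => M 0 0)); rewrite !mxE !mulr1n.
have eb : r (S p) *: b p = r (S p') *: b p'.
  by have := congr1 (@rsubmx _ _ 1 n) e; rewrite !row_mxKr.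
have er : r (S p) = r (S p').
  have := congr1 (fun v => dot v v) eb; rewrite /= !dotZl !dotZr b1 b2 !mulr1.
  move=> /eqP; rewrite -!expr2 eqf_sqr => /orP[/eqP//|/eqP h].
  by have := r_gt0 (S p); have := r_gt0 (S p'); rewrite h; lra.
have bb : b p = b p'.
  by apply: (scalerI _ (etrans eb _)); [rewrite gt_eqF|rewrite er].
have [k hk] := profile_simple ex er.
have : arg (lsubmx p') = arg (lsubmx p) + pi *+ 2 * k%:~R.
  apply: (mulfI kap0); by rewrite -/(S p') hk /S mulrDr period_scale.
move=> h; rewrite -[p]hsubmxK -[p']hsubmxK -/(b p) -/(b p') bb; congr row_mx.
rewrite -(argK a1) -(argK a2) h; apply: rV2P; rewrite ?circ0 ?circ1.
  by rewrite (periodic_int (@cosD2pi R)).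
by rewrite (periodic_int (@sinD2pi R)).
Qed.

Section AtPoint.
Variables (V : set 'rV[R]_n) (phi : 'rV[R]_n -> 'rV[R]_(2 + n)).
Hypothesis lp : local_param T V phi.
Variable u : 'rV[R]_n.
Hypothesis Vu : V u.

(** Near the point the parametrization has the form treated in the section
    [RotationGeometry]; its hypothesis [inj] holds because the arc and the
    direction together determine the point of the torus smoothly. *)
Lemma torus_geometry : [/\ row_free ('J (X \o phi) u),
  forall v : 'rV[R]_n, dot ('D_v (X \o phi) u) (N (phi u)) = 0 &
  dot (X (phi u)) (N (phi u)) + mean_curvature (X \o phi) (N (phi u)) u = lam].
Proof.
have [oV sphi _ _] := lp.
have phiT w : V w -> T (phi w) by move=> Vw; exact: (local_param_in lp Vw).
pose t0 := arg (lsubmx (phi u)).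
pose A := along V phi t0.
have oA : open A by exact: along_open.
have Au : A u by split; [exact: Vu|exact: (facing_arg (phiT u Vu))].
pose s := along_arc phi t0; pose bb := along_dir phi.
have cs j : Cn j A s by exact: along_arc_smooth.
have cb j : Cn j A bb by exact: along_dir_smooth.
have bb1 w : A w -> dot (bb w) (bb w) = 1.
  by move=> [Vw _]; have /torusP[] := phiT w Vw.
have FE w : A w -> (X \o phi) w = rotate s bb x r w.
  by move=> Aw; exact: (along_map phiT xper rper Aw).
have GE w : A w -> (N \o phi) w = rotate s bb N1 N2 w.
  by move=> Aw; exact: (along_map phiT N1per N2per Aw).
have [cx cr _] := profile_smooth 2; have [c1 c2] := gauss_smooth 1.
have cF : Cn 2 A (X \o phi) by exact: (along_map_smooth oV sphi phiT t0 xper rper cx cr).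
have cG : Cn 1 A (N \o phi) by exact: (along_map_smooth oV sphi phiT t0 N1per N2per c1 c2).
have inj (v : 'rV[R]_n) : 'D_v s u = 0 -> 'D_v bb u = 0 -> v = 0.
  move=> sv bv; apply: (local_param_inj lp Vu).
  have [dphi _] := sphi 1%N; have Dphi := dphi u Vu.
  have [ds _] := cs 1%N; have Ds := ds u Au.
  have [dl _] := Cn_lsubmx oV (sphi 1%N); have Dl := dl u Vu.
  have [db _] := cb 1%N; have Db := db u Au.
  have e : (fun w => row_mx (lsubmx (phi w)) (bb w)) = phi.
    by apply/funext => w; rewrite hsubmxK.
  have [_] := derive_row_mx v Dl Db; rewrite e => ->; rewrite bv.
  suff -> : 'D_v (fun w => lsubmx (phi w)) u = 0 by rewrite row_mx0.
  have -> : 'D_v (fun w => lsubmx (phi w)) u = 'D_v (fun w => circ (kap^-1 * s w)) u.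
    apply: near_eq_derive; near=> w.
    have [Vw hw] : A w by near: w; exact: open_nbhs_nbhs.
    have /torusP[w1 _] := phiT w Vw.
    by rewrite /s /along_arc mulKf // circ_local_angle.
  have cc : Cn 1 A (fun w => circ (kap^-1 * s w)).
    exact: (Cn_circ oA (Cn_mul oA (Cn_cst _ _ _) (cs 1%N))).
  have [dc _] := cc; rewrite derive_mx; last exact: diff_derivable (dc u Au).
  apply/rowP => i; rewrite !mxE.
  have Dcos t : differentiable (fun t : R => circ (kap^-1 * t) 0 i : R) t.
    have h := Cn_coord_comp 0 i (@openT R) (Cn_circ (@openT R)
      (Cn_mul (@openT R) (Cn_cst _ kap^-1 1) (Cn_id 1 (@openT R)))).
    by have [h' _] := h; exact: h'.
  by rewrite (derive_comp1 v Ds (Dcos (s u))) sv mulr0.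
split.
- exact: (rotation_immersed prof oA cs cb bb1 FE cF Au inj).
- by move=> v; exact: (rotation_normal prof oA cs cb bb1 FE GE v Au).
exact: (rotation_curvature prof oA cs cb bb1 FE GE cF cG Au inj).
Unshelve. all: by end_near. Qed.

End AtPoint.

Lemma torus_embedding : embedding n T X.
Proof.
split.
  split; first exact: torus_X_smooth.
  by move=> V phi lp u Vu; case: (torus_geometry lp Vu).
apply: (compact_inverse (0 : 'rV[R]_(2 + n))).
- exact: norm_hausdorff.
- exact: torus_compact.
- exact/smooth_on_continuous/torus_X_smooth.
- exact: torus_X_inj.
Qed.

Lemma torus_lambda : lambda_hypersurface T X N lam.
Proof.
split.
- by case: torus_embedding.
- split; [exact: torus_N_smooth|exact: torus_N_unit|].
  by move=> V phi lp u Vu v; case: (torus_geometry lp Vu).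
by move=> V phi lp u Vu; case: (torus_geometry lp Vu).
Qed.

(** The torus is covered by the line of arc lengths times the sphere, through the
    circle of angles. *)
Lemma torus_rotational : rotational T X N.
Proof.
pose Phi (w : 'rV[R]_(1 + n)) : 'rV[R]_(2 + n) :=
  row_mx (circ (kap^-1 * w 0 0)) (rsubmx w).
have PhiE t (a : 'rV[R]_n) :
    Phi (row_mx t%:M a) = row_mx (circ (kap^-1 * t)) a.
  rewrite /Phi row_mxKr; congr (row_mx (circ (_ * _)) _).
  have -> : (0 : 'I_(1 + n)) = lshift n (0 : 'I_1) by exact/val_inj.
  by rewrite row_mxEl mxE mulr1n.
have arcE (f : R -> R) t (a : 'rV[R]_n) : (forall v, f (v + 2 * l) = f v) ->
    f (S (row_mx (circ (kap^-1 * t)) a)) = f t.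
  move=> pf; rewrite /S row_mxKl.
  have -> : f t = f (kap * (kap^-1 * t)) by rewrite mulVKf.
  by apply: same_point => //; rewrite argK // dot_circ.
have d1x t : derive1 x t = cos (th t) by rewrite derive1E; case: (dx t).
have d1r t : derive1 r t = sin (th t) by rewrite derive1E; case: (dr t).
exists setT, x, r, Phi; split.
- by split; [exact: openT|move=> ? ? ? ? ?].
- by split=> j; case: (profile_smooth j).
- by move=> s _; split; [exact: r_gt0|rewrite d1x d1r cos2Dsin2].
- split.
    apply: smooth_on_global => j; have oT1 := @openT 'rV[R]_(1 + n).
    apply: (Cn_row_mx oT1); last exact: (Cn_rsubmx oT1 (@Cn_idrV R _ _ j oT1)).
    exact: (Cn_circ oT1 (Cn_mul oT1 (Cn_cst _ _ _) (Cn_coord 0 0 j oT1))).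
  apply/seteqP; split=> [p [w [s _ [a ha <-]] <-]|p Tp].
    by rewrite PhiE; apply/torusP; rewrite row_mxKl row_mxKr dot_circ.
  have /torusP[p1 p2] := Tp.
  exists (row_mx (S p)%:M (rsubmx p)); first by exists (S p) => //; exists (rsubmx p).
  by rewrite PhiE mulKf // argK // hsubmxK.
move=> s a _ ha; rewrite PhiE /X /N /torus_map /rotate !arcE // /b row_mxKr.
by rewrite d1x d1r.
Qed.

End Assembly.

Theorem theorem1p1 (R : realType) (n : nat) (lambda : R)
    (hn : (2 <= n)%N) (hlambda : 0 < lambda) :
  exists (k : nat) (M : set 'rV[R]_k) (X N : 'rV[R]_k -> 'rV[R]_(1 + n)),
    [/\ manifold n M /\ compact M,
        diffeomorphic M (@standard_torus R n),
        embedding n M X,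
        rotational M X N &
        lambda_hypersurface M X N lambda].
Proof.
case: n hn => [//|q] q1.
have [x [r [th [l [l0 prof sym per pos]]]]] := closed_profile hlambda q1.
have /choice[arg argK] : forall a : 'rV[R]_2, exists t, dot a a = 1 -> circ t = a.
  move=> a; case: (pselect (dot a a = 1)) => [/unit_circle_angle[t ->]|h].
    by exists t.
  by exists 0.
exists (2 + q.+1)%N, (@standard_torus R q.+1), (torus_map l arg x r),
  (torus_map l arg (fun t => - sin (th t)) (fun t => cos (th t))).
split.
- by split; [exact: torus_manifold|exact: torus_compact].
- exists id, id; split=> //; split; apply: smooth_on_global => j;
    apply: Cn_idrV; exact: openT.
- exact: (torus_embedding l0 prof sym per pos argK).
- exact: (torus_rotational l0 prof per argK).
exact: (torus_lambda l0 prof sym per pos argK).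
Qed.
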